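(* Let $\lambda_1,\dots,\lambda_n$ be distinct real numbers with $\lambda_j>-1/2$ for all $j$, and let $B=(B_t,t\ge 0)$ be a standard Brownian motion. Assume that $n<\infty$. Then $$k_n(t,s)=\begin{cases} t^{-1}K_n(s/t) & \text{if } s\le t,\\ 0 & \text{otherwise,}\end{cases}$$ where $$K_n(s)=\sum_{j=1}^n a_{j,n}s^{\lambda_j},\qquad a_{j,n}=\frac{\prod_{l=1}^n(\lambda_j+\lambda_l+1)}{\prod_{l=1,\,l\ne j}^n(\lambda_j-\lambda_l)},\quad j=1,\dots,n,$$ is a Goursat--Volterra kernel of order $n$. Furthermore, writing $T_n$ for the Goursat--Volterra transform associated to $k_n$, i.e. $$T_n(B)_t=B_t-\int_0^t ds\int_0^s k_n(s,v)\,dB_v,$$ the orthogonal complement of $H_t(T_n(B))$ in $H_t(B)$ is $$G_t(\lambda_1,\dots,\lambda_n;B)=\mathrm{Span}\Big\{\int_0^t s^{\lambda_j}\,dB_s,\ j=1,\dots,n\Big\}$$ for all $t\ge 0$. Moreover, $T_n$ is of the form $T_n(B)_t=\int_0^t\rho_n(t/s)\,dB_s$, $t>0$, with $\rho_n\in\mathcal M$ given by $$\rho_n(x)=1-\int_1^x K_n(1/r)\frac{dr}{r},\quad x\ge 1.$$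
   Context: $B$ is defined on a complete probability space $(\Omega,\mathcal F,\mathbb P)$. For a process $X$ such as $B$ or $T_n(B)$, $H_t(X)$ denotes the closed linear span in $L^2(\Omega,\mathcal F,\mathbb P)$ of $\{X_s,\ s\le t\}$; in particular $H_t(B)=\{\int_0^t f(u)\,dB_u:\ f\in L^2[0,t]\}$. Orthogonality is in $L^2(\Omega,\mathcal F,\mathbb P)$. $\mathcal M$ is the set of measurable functions $\rho:[1,\infty)\to\mathbb R$ such that $\int_0^1\rho^2(1/v)\,dv<\infty$. A Volterra transform with kernel $l$ is a linear transform of the form $T(B)_t=B_t-\int_0^t ds\int_0^s l(s,v)\,dB_v$ for all $t>0$, where the kernel $l:\mathbb R_+^2\to\mathbb R$ satisfies $l(s,v)=0$ for $s<v$ and is such that the symmetrized kernel $\tilde l(t,s)$ (equal to $l(t,s)$ if $s\le t$ and to $l(s,t)$ if $s\ge t$) is continuous on $\mathbb R_+^2$. Transforms are defined only up to a stochastic modification, and the continuous one is used. Such a transform $T$ (resp. its kernel) is called a Goursat--Volterra transform (resp. kernel) of order $n$ if $(T(B)_t,t\ge0)$ is a Brownian motion and there exist $n$ linearly independent functions $g_1,\dots,g_n\in L^2_{loc}(\mathbb R_+)=\{f:\mathbb R_+\to\mathbb R:\ f\in L^2[0,t]\text{ for all }0<t<\infty\}$ such that, for all $t>0$, one has the orthogonal decomposition $H_t(B)=H_t(T(B))\oplus\mathrm{Span}\{\int_0^t g_j(s)\,dB_s,\ j=1,\dots,n\}$.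
   Formalization: Continuity of the symmetrized kernel is required only on the open quadrant t,s>0, since k_n is homogeneous of degree -1 and cannot be continuous at the origin (for n=1, λ=0 it is 1/max(t,s)). *)

(* Defs.v *)
From HB Require Import structures.
From mathcomp Require Import all_boot all_order all_algebra.
From mathcomp Require Import all_classical all_reals all_analysis.

Set Implicit Arguments.
Unset Strict Implicit.
Unset Printing Implicit Defensive.

Import Order.TTheory GRing.Theory Num.Theory.
Import numFieldNormedType.Exports.

Local Open Scope classical_set_scope.
Local Open Scope ring_scope.

(** Processes are maps [X : R -> T -> R], of which only the times [t >= 0]
    matter. Elements of L^2(P) are represented by functions: all the subspaces
    of L^2(P) below are closed under almost sure equality. *)

(** Possibly degenerate normal law: [normal_prob m 0] is not the Dirac mass at
    [m] in the library. *)
Definition gaussian_rv (d : measure_display) (T : measurableType d)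
    (R : realType) (P : probability T R) (X : T -> R) : Prop :=
  measurable_fun [set: T] X /\
  exists m s : R, 0 <= s /\
    forall A : set R, measurable A ->
      P (X @^-1` A) = if s == 0 then \d_m A else normal_prob m s A.

Definition gaussian_process (d : measure_display) (T : measurableType d)
    (R : realType) (P : probability T R) (X : R -> T -> R) : Prop :=
  forall (m : nat) (c t : 'I_m -> R), (forall i, 0 <= t i) ->
    gaussian_rv P (fun w => \sum_i c i * X (t i) w).

Definition continuous_paths (d : measure_display) (T : measurableType d)
    (R : realType) (P : probability T R) (X : R -> T -> R) : Prop :=
  {ae P, forall w, {within `[0, +oo[, continuous (fun t : R => X t w)}}.

(** The covariance clause for [s = t = 0] contains [X 0 = 0] almost surely. *)
Definition brownian_motion (d : measure_display) (T : measurableType d)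
    (R : realType) (P : probability T R) (X : R -> T -> R) : Prop :=
  [/\ gaussian_process P X,
      forall t, 0 <= t -> ('E_P[X t] = 0)%E,
      forall s t, 0 <= s -> 0 <= t ->
        covariance P (X s) (X t) = (Num.min s t)%:E
    & continuous_paths P X].

Definition L2norm (d : measure_display) (T : measurableType d)
    (R : realType) (mu : {measure set T -> \bar R}) (f : T -> R) : \bar R :=
  'N[mu]_2%:E[EFin \o f]%E.

(** The space L^2[0,t]; [f \_ A] is [f] on [A] and 0 elsewhere. *)
Definition L2on (R : realType) (t : R) (f : R -> R) : Prop :=
  f \_ `[0, t] \in Lfun (@lebesgue_measure R) 2%:E.

Definition L2loc (R : realType) (f : R -> R) : Prop :=
  forall t, 0 < t -> L2on t f.

(** [X] is a version of the integral of [f] over [0,t] with respect to [B]: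
    the pair [(f, X)] is in the closure, in L^2[0,t] x L^2(P), of the graph of
    the elementary integral of step functions. *)
Definition is_wiener_int (d : measure_display) (T : measurableType d)
    (R : realType) (P : probability T R) (B : R -> T -> R) (t : R)
    (f : R -> R) (X : T -> R) : Prop :=
  [/\ L2on t f, X \in Lfun P 2%:E
    & forall e : R, 0 < e ->
      exists (m : nat) (c a b : 'I_m -> R),
        [/\ forall i, 0 <= a i <= b i /\ b i <= t,
            (L2norm (@lebesgue_measure R)
               ((fun x => (f x - \sum_i c i * \1_(`]a i, b i]) x)%R)
                  \_ `[0%R, t]) < e%:E)%E
          & (L2norm P
               (fun w => (X w - \sum_i c i * (B (b i) w - B (a i) w))%R)
               < e%:E)%E]].

(** A version of the integral of [f] over [0,t] with respect to [B]; it is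
    unique up to almost sure equality, and is a junk value unless [f] is in
    L^2[0,t]. *)
Definition wiener_int (d : measure_display) (T : measurableType d)
    (R : realType) (P : probability T R) (B : R -> T -> R) (t : R)
    (f : R -> R) : T -> R :=
  xget (cst 0) [set X | is_wiener_int P B t f X].

(** [Hspace P X t] is H_t(X). *)
Definition Hspace (d : measure_display) (T : measurableType d)
    (R : realType) (P : probability T R) (X : R -> T -> R) (t : R) :
    set (T -> R) :=
  [set Y | Y \in Lfun P 2%:E /\
    forall e : R, 0 < e ->
      exists (m : nat) (c s : 'I_m -> R),
        (forall i, 0 <= s i <= t) /\
        (L2norm P (fun w => (Y w - \sum_i c i * X (s i) w)%R) < e%:E)%E].

Definition L2span (d : measure_display) (T : measurableType d)
    (R : realType) (P : probability T R) (n : nat) (W : 'I_n -> T -> R) :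
    set (T -> R) :=
  [set Y | Y \in Lfun P 2%:E /\
    exists c : 'I_n -> R, {ae P, forall w, Y w = \sum_j c j * W j w}].

Definition L2orthogonal (d : measure_display) (T : measurableType d)
    (R : realType) (P : probability T R) (X Y : T -> R) : Prop :=
  ('E_P[X \* Y] = 0)%E.

Definition orthogonal_complement (d : measure_display) (T : measurableType d)
    (R : realType) (P : probability T R) (F H : set (T -> R)) :
    set (T -> R) :=
  [set Y | H Y /\ forall X, F X -> L2orthogonal P X Y].

(** [H] is the orthogonal direct sum of [F] and [G]. *)
Definition orthogonal_sum (d : measure_display) (T : measurableType d)
    (R : realType) (P : probability T R) (H F G : set (T -> R)) : Prop :=
  (forall X Y, F X -> G Y -> L2orthogonal P X Y) /\
  H = [set Z | exists X Y, [/\ F X, G Y & Z = X \+ Y]].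

(** Linear independence in L^2_loc, hence modulo almost everywhere equality. *)
Definition linearly_independent (R : realType) (n : nat)
    (g : 'I_n -> R -> R) : Prop :=
  forall c : 'I_n -> R,
    {ae @lebesgue_measure R, forall x, 0 <= x -> \sum_j c j * g j x = 0} ->
    forall j, c j = 0.

Definition symmetrized (R : realType) (l : R -> R -> R) (t s : R) : R :=
  if s <= t then l t s else l s t.

(** Continuity is required on the open quadrant: the kernels of interest are
    homogeneous of degree -1, hence singular at the origin. *)
Definition volterra_kernel (R : realType) (l : R -> R -> R) : Prop :=
  (forall s v, 0 <= s -> s < v -> l s v = 0) /\
  {within [set p : R * R | 0 < p.1 /\ 0 < p.2],
    continuous (fun p : R * R => symmetrized l p.1 p.2)}.

(** [Z] is the continuous modification of the process
      B_t - int_0^t ds int_0^s l(s,v) dB_v.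
    As [wiener_int] picks, for each [s], an arbitrary version of the inner
    integral, the outer one is taken along a jointly measurable modification
    [Y] of the process of inner integrals. *)
Definition volterra_transform (d : measure_display) (T : measurableType d)
    (R : realType) (P : probability T R) (B : R -> T -> R)
    (l : R -> R -> R) (Z : R -> T -> R) : Prop :=
  [/\ forall t, 0 <= t -> measurable_fun [set: T] (Z t),
      continuous_paths P Z,
      forall s, 0 < s -> L2on s (l s)
    & exists Y : R -> T -> R,
      [/\ measurable_fun [set: R * T] (fun p : R * T => Y p.1 p.2),
          forall s, 0 < s ->
            {ae P, forall w, Y s w = wiener_int P B s (l s) w},
          {ae P, forall w, forall t, 0 < t ->
            (@lebesgue_measure R).-integrable `[0, t]
              (EFin \o (fun s => Y s w))}
        & forall t, 0 <= t ->
            {ae P, forall w,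
              Z t w = B t w - \int[@lebesgue_measure R]_(s in `[0, t]) Y s w}]].

(** [Z = T(B)] is the image of [B] by a Goursat-Volterra transform of
    order [n]. *)
Definition goursat_volterra_transform (d : measure_display)
    (T : measurableType d) (R : realType) (P : probability T R)
    (B : R -> T -> R) (n : nat) (Z : R -> T -> R) : Prop :=
  brownian_motion P Z /\
  exists g : 'I_n -> R -> R,
    [/\ forall j, L2loc (g j),
        linearly_independent g
      & forall t, 0 < t ->
          orthogonal_sum P (Hspace P B t) (Hspace P Z t)
            (L2span P (fun j => wiener_int P B t (g j)))].

(** The transform with kernel [l] exists; it is unique up to
    indistinguishability, so that quantifying over all its versions [Z] does
    not strengthen the definition. *)
Definition goursat_volterra_kernel (d : measure_display)
    (T : measurableType d) (R : realType) (P : probability T R)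
    (B : R -> T -> R) (n : nat) (l : R -> R -> R) : Prop :=
  [/\ volterra_kernel l,
      exists Z, volterra_transform P B l Z
    & forall Z, volterra_transform P B l Z ->
        goursat_volterra_transform P B n Z].

(** The class of functions denoted by a calligraphic M. *)
Definition Mclass (R : realType) (rho : R -> R) : Prop :=
  measurable_fun (`[1, +oo[ : set R) rho /\
  (\int[@lebesgue_measure R]_(v in `]0%R, 1%R]) ((rho v^-1) ^+ 2)%:E < +oo)%E.

Definition a_coef (R : realType) (n : nat) (lam : 'I_n -> R) (j : 'I_n) : R :=
  (\prod_(l < n) (lam j + lam l + 1)) /
  (\prod_(l < n | l != j) (lam j - lam l)).

Definition K_fun (R : realType) (n : nat) (lam : 'I_n -> R) (s : R) : R :=
  \sum_(j < n) a_coef lam j * s `^ lam j.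

Definition k_ker (R : realType) (n : nat) (lam : 'I_n -> R) (t s : R) : R :=
  if s <= t then t^-1 * K_fun lam (s / t) else 0.

Definition rho_fun (R : realType) (n : nat) (lam : 'I_n -> R) (x : R) : R :=
  1 - \int[@lebesgue_measure R]_(r in `[1, x]) (K_fun lam r^-1 / r).

(* Main.v *)
(** Everything rests on the identity sum_j a_j / (lam_i + lam_j + 1) = 1 (Lagrange
    interpolation). It gives int_0^s v^lam_j k(s,v) dv = s^lam_j, so that the inner
    integrals Y_s = int_0^s k(s,v) dB_v satisfy E[Y_s Y_r] = k(r,s) for s <= r. Hence
    Z_s = B_s - int_0^s Y is orthogonal to Y_r for r >= s, which yields
    E[Z_s Z_t] = min(s,t), and Z_r is orthogonal to int_0^t s^lam_j dB_s for r <= t.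

    An element X of L^2(P) is a version of int_0^t f dB as soon as
    E[X B_u] = int_0^u f for all u <= t and E[X^2] <= int_0^t f^2, because the
    indicators of the intervals ]0,u] span L^2[0,t]. With respect to B, this criterion
    recognizes s^lam B_s - lam int_0^s v^(lam-1) B_v dv as int_0^s v^lam dB_v, which
    provides a jointly measurable Y, and identifies Z_t with int_0^t rho(t/s) dB_s.
    With respect to Z, it shows that B_u minus its projection on the span of the
    int_0^t s^lam_j dB_s belongs to H_t(Z); the projection is explicit, because
    the inverse of the Cauchy matrix 1/(lam_i + lam_j + 1) is
    (a_i a_j / (lam_i + lam_j + 1)). *)
Require Import Defs.
From HB Require Import structures.
From mathcomp Require Import all_boot all_order all_algebra.
From mathcomp Require Import all_classical all_reals all_analysis.
From mathcomp Require Import measurable_realfun ring lra.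

Set Implicit Arguments.
Unset Strict Implicit.
Unset Printing Implicit Defensive.

Import Order.TTheory GRing.Theory Num.Theory.
Import numFieldNormedType.Exports.
Local Open Scope classical_set_scope.
Local Open Scope ring_scope.

(** * The inner product of L^2 *)

(** The kernel is singular at the origin: the norm of Y_s is proportional to s^(-1/2), which is
    integrable near 0 while its square is not. Integrals in s are therefore taken with a weight, and
    identities are claimed for s > 0 only. The processes are known up to versions, so almost every
    step is reduced to inner products, which ignore null sets. Paths matter only for joint
    measurability and for the continuity of the transform. In the recognition criterion, the values
    E[X B_u] determine only the projection of X on H_t(B); the bound on E[X^2] leaves no room for a
    remainder orthogonal to it. Applied with respect to Z, this bound expresses that H_t(Z) misses
    nothing of H_t(B) but the n-dimensional span, and it becomes an exact algebraic identity on the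
    coefficients a_j. The covariance min(s,t) does not make Z a Brownian motion: joint Gaussianity
    is also required. It holds because Z_t lies in H_t(B) and L^2-limits of centered Gaussian
    variables are Gaussian, which is proved here by comparing distribution functions. *)

Section L2_space.
Context d (T : measurableType d) (R : realType).
Variable mu : {measure set T -> \bar R}.
Local Notation L2 := (Lfun mu 2%:E).
Implicit Types (f g h : T -> R) (c : R).

Definition ip f g : R := \int[mu]_x (f x * g x).

Lemma L2_measurable f : f \in L2 -> measurable_fun setT f.
Proof. by rewrite inE => /andP[]; rewrite inE. Qed.

Lemma L2normE f : L2norm mu f = ((\int[mu]_x (f x ^+ 2)%:E) `^ 2^-1)%E.
Proof.
rewrite /L2norm unlock; congr (_ `^ _)%E.
by apply: eq_integral => x _ /=; rewrite powR_mulrn// real_normK// num_real.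
Qed.

Lemma sqr_integral_ge0 f : (0 <= \int[mu]_x (f x ^+ 2)%:E)%E.
Proof. by apply: integral_ge0 => x _; rewrite lee_fin sqr_ge0. Qed.

Lemma L2norm_lt f (e : R) : 0 < e ->
  (L2norm mu f < e%:E)%E = (\int[mu]_x (f x ^+ 2)%:E < (e ^+ 2)%:E)%E.
Proof.
move=> e0; rewrite L2normE; have := sqr_integral_ge0 f.
case: (integral _ _ _) => [r||] // r0; last by rewrite poweRyr ?invr_neq0.
rewrite poweR_EFin !lte_fin.
rewrite -[RHS](ltr_sqrt _) ?exprn_gt0// sqrtr_sqr (gtr0_norm e0).
by rewrite -powR12_sqrt -?lee_fin.
Qed.

Lemma L2P f : f \in L2 <->
  measurable_fun setT f /\ (\int[mu]_x (f x ^+ 2)%:E < +oo)%E.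
Proof.
split.
  move=> fL; split; first exact: L2_measurable.
  have /integrableP[_] := Lfun2_integrable_sqr fL.
  by under eq_integral do rewrite /= ger0_norm ?sqr_ge0//.
move=> [mf fy]; rewrite inE; apply/andP; split; rewrite inE //=.
rewrite /finite_norm -/(L2norm mu f) L2normE.
exact: poweR_lty.
Qed.

Lemma L2_0 : (0 : T -> R) \in L2.
Proof.
by have [] := Lfun_submod_closed mu (lee1n 2).
Qed.

Lemma L2_axpy c f g : f \in L2 -> g \in L2 -> c *: f + g \in L2.
Proof.
by have [_] := Lfun_submod_closed mu (lee1n 2); apply.
Qed.

Lemma L2Z c f : f \in L2 -> c *: f \in L2.
Proof. by move=> fL; rewrite -[X in X \in _]addr0 L2_axpy// L2_0. Qed.

Lemma L2D f g : f \in L2 -> g \in L2 -> f + g \in L2.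
Proof. by move=> fL gL; rewrite -[f]scale1r L2_axpy. Qed.

Lemma L2B f g : f \in L2 -> g \in L2 -> f - g \in L2.
Proof. by move=> fL gL; rewrite addrC -scaleN1r L2_axpy. Qed.

Lemma L2_sum I (r : seq I) (F : I -> T -> R) :
  (forall i, F i \in L2) -> \sum_(i <- r) F i \in L2.
Proof.
by move=> FL; elim/big_ind : _ => //; [exact: L2_0|exact: L2D].
Qed.

Lemma ip_integrable f g : f \in L2 -> g \in L2 ->
  mu.-integrable setT (EFin \o (f \* g)).
Proof. by move=> fL gL; apply/Lfun1_integrable/Lfun2_mul_Lfun1. Qed.

Lemma ipC f g : ip f g = ip g f.
Proof. by apply: eq_Rintegral => x _; rewrite mulrC. Qed.

Lemma ip_axpyl c f g h : f \in L2 -> g \in L2 -> h \in L2 ->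
  ip (c *: f + g) h = c * ip f h + ip g h.
Proof.
move=> fL gL hL; rewrite /ip -RintegralZl//; last exact: ip_integrable.
rewrite -RintegralD//; last exact: ip_integrable.
  by apply: eq_Rintegral => x _ /=; rewrite mulrDl mulrA.
have := ip_integrable (L2Z c fL) hL; apply: eq_integrable => // x _ /=.
by rewrite mulrA.
Qed.

Lemma ip0l f : ip 0 f = 0.
Proof.
rewrite /ip; under eq_Rintegral do rewrite mul0r.
by rewrite Rintegral_cst// mul0r.
Qed.

Lemma ipDl f g h : f \in L2 -> g \in L2 -> h \in L2 ->
  ip (f + g) h = ip f h + ip g h.
Proof. by move=> *; rewrite -[f]scale1r ip_axpyl// scale1r mul1r. Qed.

Lemma ipZl c f h : f \in L2 -> h \in L2 -> ip (c *: f) h = c * ip f h.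
Proof. by move=> *; rewrite -[_ *: _]addr0 ip_axpyl ?L2_0// ip0l addr0. Qed.

Lemma ipBl f g h : f \in L2 -> g \in L2 -> h \in L2 ->
  ip (f - g) h = ip f h - ip g h.
Proof.
by move=> *; rewrite addrC -scaleN1r ip_axpyl// mulN1r addrC.
Qed.

Lemma ipDr f g h : f \in L2 -> g \in L2 -> h \in L2 ->
  ip h (f + g) = ip h f + ip h g.
Proof. by move=> *; rewrite ipC ipDl// !(ipC h). Qed.

Lemma ipZr c f h : f \in L2 -> h \in L2 -> ip h (c *: f) = c * ip h f.
Proof. by move=> *; rewrite ipC ipZl// !(ipC h). Qed.

Lemma ipBr f g h : f \in L2 -> g \in L2 -> h \in L2 ->
  ip h (f - g) = ip h f - ip h g.
Proof. by move=> *; rewrite ipC ipBl// !(ipC h). Qed.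

Lemma ip_suml I (r : seq I) (F : I -> T -> R) h :
  (forall i, F i \in L2) -> h \in L2 ->
  ip (\sum_(i <- r) F i) h = \sum_(i <- r) ip (F i) h.
Proof.
move=> FL hL; elim: r => [|i r IH]; first by rewrite !big_nil ip0l.
by rewrite !big_cons ipDl// ?IH//; exact: L2_sum.
Qed.

Lemma ip_sumr I (r : seq I) (F : I -> T -> R) h :
  (forall i, F i \in L2) -> h \in L2 ->
  ip h (\sum_(i <- r) F i) = \sum_(i <- r) ip h (F i).
Proof.
by move=> FL hL; rewrite ipC ip_suml//; apply: eq_bigr => i _; rewrite ipC.
Qed.

Lemma ip_ge0 f : 0 <= ip f f.
Proof. by apply: Rintegral_ge0 => x _; rewrite -expr2 sqr_ge0. Qed.

Lemma ip_EFin f g : f \in L2 -> g \in L2 ->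
  (\int[mu]_x (f x * g x)%:E)%E = (ip f g)%:E.
Proof.
move=> fL gL; rewrite /ip /Rintegral fineK//.
exact: (integrable_fin_num measurableT (ip_integrable fL gL)).
Qed.

Lemma sqr_integralE f : f \in L2 -> (\int[mu]_x (f x ^+ 2)%:E)%E = (ip f f)%:E.
Proof.
by move=> fL; rewrite -ip_EFin//; apply: eq_integral => x _; rewrite expr2.
Qed.

Lemma L2norm_ltE f (e : R) : f \in L2 -> 0 < e ->
  (L2norm mu f < e%:E)%E = (ip f f < e ^+ 2).
Proof. by move=> fL e0; rewrite L2norm_lt// sqr_integralE// lte_fin. Qed.

Lemma L2_ae f g : f \in L2 -> measurable_fun setT g ->
  {ae mu, forall x, g x = f x} -> g \in L2.
Proof.
move=> /L2P[mf fy] mg fg; apply/L2P; split => //.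
rewrite (ae_eq_integral (fun x => (f x ^+ 2)%:E))//.
- exact/measurable_EFinP/measurable_funX.
- exact/measurable_EFinP/measurable_funX.
- by apply: filterS fg => x + _ => ->.
Qed.

Lemma ip_ae f g h : f \in L2 -> g \in L2 -> h \in L2 ->
  {ae mu, forall x, g x = f x} -> ip g h = ip f h.
Proof.
move=> fL gL hL fg; congr fine; apply: ae_eq_integral => //.
- by have /measurable_int := ip_integrable gL hL.
- by have /measurable_int := ip_integrable fL hL.
- by apply: filterS fg => x + _ => ->.
Qed.

Lemma ip_self0 f : f \in L2 -> ip f f = 0 -> {ae mu, forall x, f x = 0}.
Proof.
move=> fL f0; have mf := L2_measurable fL.
have : (\int[mu]_x `|(f x ^+ 2)%:E| = 0)%E.
  by under eq_integral do rewrite gee0_abs ?lee_fin ?sqr_ge0//; rewrite sqr_integralE// f0.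
move/ae_eq_integral_abs => /(_ measurableT).
have mf2 : measurable_fun setT (fun x => (f x ^+ 2)%:E).
  exact/measurable_EFinP/measurable_funX.
move=> /(_ mf2).
apply: filterS => x /(_ I) /= [] /eqP; rewrite sqrf_eq0 => /eqP.
by [].
Qed.

Lemma cauchy_schwarz_sqr f g : f \in L2 -> g \in L2 ->
  ip f g ^+ 2 <= ip f f * ip g g.
Proof.
move=> fL gL.
have H c : 0 <= ip f f + 2 * c * ip f g + c ^+ 2 * ip g g.
  have := ip_ge0 (c *: g + f); rewrite ip_axpyl ?L2_axpy//.
  rewrite !(ipC _ (_ + _)) !ip_axpyl// (ipC g f) => /le_trans; apply.
  by rewrite le_eqVlt; apply/orP; left; apply/eqP; ring.
have [g0|g0] := eqVneq (ip g g) 0.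
  rewrite g0 mulr0; have [->|b0] := eqVneq (ip f g) 0; first by rewrite expr0n.
  (* With [ip g g = 0] the quadratic [H] is affine in [c]; this [c] gives it the value -1. *)
  have := H (- (ip f f + 1) / (2 * ip f g)); rewrite g0.
  have -> : 2 * (- (ip f f + 1) / (2 * ip f g)) * ip f g = - (ip f f + 1).
    by field.
  lra.
have gp : 0 < ip g g by rewrite lt_neqAle eq_sym g0 ip_ge0.
(* The minimizer of the quadratic [H]. *)
have := H (- ip f g / ip g g).
have -> : ip f f + 2 * (- ip f g / ip g g) * ip f g +
   (- ip f g / ip g g) ^+ 2 * ip g g = ip f f - ip f g ^+ 2 / ip g g by field.
by rewrite subr_ge0 ler_pdivrMr.
Qed.

Definition nrm f : R := Num.sqrt (ip f f).

Lemma nrm_ge0 f : 0 <= nrm f. Proof. exact: sqrtr_ge0. Qed.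

Lemma sqr_nrm f : nrm f ^+ 2 = ip f f.
Proof. by rewrite sqr_sqrtr// ip_ge0. Qed.

Lemma cauchy_schwarz f g : f \in L2 -> g \in L2 ->
  `|ip f g| <= nrm f * nrm g.
Proof.
move=> fL gL; rewrite -sqrtrM ?ip_ge0// -sqrtr_sqr ler_sqrt ?sqr_ge0//.
  exact: cauchy_schwarz_sqr.
by rewrite mulr_ge0// ip_ge0.
Qed.

Lemma nrmD f g : f \in L2 -> g \in L2 -> nrm (f + g) <= nrm f + nrm g.
Proof.
move=> fL gL; rewrite -(@ler_pXn2r _ 2)// ?nnegrE ?addr_ge0 ?nrm_ge0//.
rewrite sqr_nrm ipDl ?L2D// !ipDr// -!sqr_nrm (ipC g f).
have := le_trans (ler_norm _) (cauchy_schwarz fL gL); lra.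
Qed.

Lemma nrmZ c f : f \in L2 -> nrm (c *: f) = `|c| * nrm f.
Proof.
move=> fL; rewrite /nrm ipZl ?L2Z// ipZr// mulrA -expr2.
by rewrite sqrtrM ?sqr_ge0// sqrtr_sqr.
Qed.

Lemma nrm0 : nrm 0 = 0. Proof. by rewrite /nrm ip0l sqrtr0. Qed.

Lemma nrmB_sqr f g : f \in L2 -> g \in L2 ->
  nrm (f - g) ^+ 2 = ip f f - 2 * ip f g + ip g g.
Proof.
move=> fL gL; rewrite sqr_nrm ipBl ?L2B// !ipBr// (ipC g f); ring.
Qed.

Lemma L2norm_nrm f (e : R) : f \in L2 -> 0 < e ->
  (L2norm mu f < e%:E)%E = (nrm f < e).
Proof.
move=> fL e0; rewrite L2norm_ltE// -sqr_nrm ltr_pXn2r//.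
  by rewrite nnegrE nrm_ge0.
by rewrite nnegrE ltW.
Qed.

End L2_space.

(** * Integrals of power functions *)

Section power_integrals.
Context (R : realType).
Local Notation leb := (@lebesgue_measure R).
Implicit Types (a t u x : R) (f F : R -> R).

Lemma FTC2_pos f F u t : 0 < u -> u <= t ->
  (forall x, 0 < x -> is_derive x 1 F (f x)) ->
  (forall x, 0 < x -> {for x, continuous f}) ->
  leb.-integrable `[u, t] (EFin \o f) /\
  (\int[leb]_(x in `[u, t]) (f x)%:E = (F t - F u)%:E)%E.
Proof.
move=> u0 ut dF cf.
have cw : {within `[u, t], continuous f}.
  apply: continuous_in_subspaceT => x; rewrite inE /= in_itv/= => /andP[ux _].
  by apply: cf; rewrite (lt_le_trans u0).
have cF x : 0 < x -> {for x, continuous F}.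
  move=> x0; apply: differentiable_continuous; apply/derivable1_diffP.
  exact: (@ex_derive _ _ _ _ _ _ _ (dF x x0)).
split; first by apply: continuous_compact_integrable => //; exact: segment_compact.
move: ut; rewrite le_eqVlt => /predU1P[<-|ut].
  by rewrite set_itv1 integral_set1 subrr.
rewrite EFinB; apply: continuous_FTC2 => //.
  split.
  - move=> x /[!in_itv]/= /andP[ux _]; have x0 := lt_trans u0 ux.
    exact: (@ex_derive _ _ _ _ _ _ _ (dF x x0)).
  - by apply: cvg_at_right_filter; exact: cF.
  - by apply: cvg_at_left_filter; apply: cF; exact: lt_trans ut.
move=> x /[!in_itv]/= /andP[ux _]; have x0 := lt_trans u0 ux.
by rewrite derive1E (@derive_val _ _ _ _ _ _ _ (dF x x0)).
Qed.

(** The integrand may blow up at 0: the interval is exhausted by the segments [t/(n+1), t], and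
    monotone convergence applies since [f] is nonnegative. *)
Lemma FTC2_pos0 f F t : 0 < t ->
  (forall x, 0 < x -> 0 <= f x) ->
  (forall x, 0 < x -> is_derive x 1 F (f x)) ->
  (forall x, 0 < x -> {for x, continuous f}) ->
  F x @[x --> 0^'+] --> 0 ->
  (\int[leb]_(x in `]0%R, t]) (f x)%:E = (F t)%:E)%E.
Proof.
move=> t0 f0 dF cf F0.
pose G n : set R := `[t / n.+1%:R, t]%classic.
have GE : `]0, t]%classic = \bigcup_n G n.
  apply/seteqP; split=> x /=; rewrite ?in_itv/=.
    move=> /andP[x0 xt].
    have [n] := ltr_add_invr (divr_gt0 x0 t0).
    rewrite add0r ltr_pdivlMr// => nx.
    by exists n => //=; rewrite /G/= in_itv/= xt andbT mulrC ltW.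
  move=> [n _]; rewrite /G/= in_itv/= => /andP[nx ->]; rewrite andbT.
  by rewrite (lt_le_trans _ nx)// divr_gt0.
have Gpos n : 0 < t / n.+1%:R by rewrite divr_gt0.
have Gle n : t / n.+1%:R <= t by rewrite ler_pdivrMr// ler_pMr// ler1n.
have tn0 : (fun n => t / n.+1%:R) @ \oo --> (0 : R).
  rewrite -[X in _ --> X](mulr0 t); apply: cvgM; first exact: cvg_cst.
  exact: cvg_harmonic.
have H : (\int[leb]_(x in G n) (f x)%:E)%E @[n --> \oo] --> (F t)%:E.
  have -> : (fun n => \int[leb]_(x in G n) (f x)%:E)%E =
      EFin \o (fun n => F t - F (t / n.+1%:R)).
    by apply/funext => n; have [_ ->] := FTC2_pos (Gpos n) (Gle n) dF cf.
  apply: cvg_EFin; first exact: nearW.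
  rewrite -[X in _ --> X]subr0; apply: cvgB; first exact: cvg_cst.
  by apply: (cvg_at_rightP F 0 0).1.
rewrite GE; apply: (cvg_unique _ _ H) => //.
apply: ge0_nondecreasing_set_cvg_integral => [m n mn|n|n|n x].
- rewrite subsetEset /G; apply: subset_itvr; rewrite bnd_simp.
  by rewrite ler_pM2l// lef_pV2 ?posrE// ler_nat.
- exact: measurable_itv.
- by have [/measurable_int] := FTC2_pos (Gpos n) (Gle n) dF cf.
- rewrite /G/= in_itv/= => /andP[nx _].
  by rewrite lee_fin f0// (lt_le_trans _ nx).
Qed.

Lemma is_derive_powR_prim a x : a != -1 -> 0 < x ->
  is_derive x 1 (fun y => y `^ (a + 1) / (a + 1)) (x `^ a).
Proof.
move=> a1 x0; have a10 : a + 1 != 0 by rewrite addr_eq0.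
have H := @is_derive1_powR _ (a + 1) x x0.
have -> : (fun y => y `^ (a + 1) / (a + 1)) = (a + 1)^-1 *: (fun y : R => y `^ (a + 1)).
  by apply/funext => y /=; rewrite mulrC.
apply: is_derive_eq.
by rewrite addrK /GRing.scale /= mulrA mulVf// mul1r.
Qed.

Lemma continuous_powR a x : 0 < x -> {for x, continuous (fun y : R => y `^ a)}.
Proof.
move=> x0; apply: differentiable_continuous; apply/derivable1_diffP.
by apply: derivable_powR; rewrite in_itv/= x0.
Qed.

Lemma integral_powR_pos a u t : a != -1 -> 0 < u -> u <= t ->
  leb.-integrable `[u, t] (EFin \o (fun y : R => y `^ a)) /\
  (\int[leb]_(x in `[u, t]) (x `^ a)%:E =
    ((t `^ (a + 1) - u `^ (a + 1)) / (a + 1))%:E)%E.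
Proof.
move=> a1 u0 ut; rewrite mulrBl.
apply: (FTC2_pos (F := fun y => y `^ (a + 1) / (a + 1))) => // x x0.
  exact: is_derive_powR_prim.
exact: continuous_powR.
Qed.

Lemma integral_powR a t : -1 < a -> 0 <= t ->
  (\int[leb]_(x in `[0%R, t]) (x `^ a)%:E = (t `^ (a + 1) / (a + 1))%:E)%E.
Proof.
move=> a1; have a10 : 0 < a + 1 by rewrite -ltrBlDr sub0r.
rewrite le_eqVlt => /predU1P[<-|t0].
  by rewrite set_itv1 integral_set1 powR0 ?mul0r// gt_eqF.
rewrite -integral_itv_obnd_cbnd; last exact/measurable_EFinP/measurable_funTS.
apply: (FTC2_pos0 (F := fun y => y `^ (a + 1) / (a + 1))) => //.
- by move=> x _; exact: powR_ge0.
- by move=> x x0; apply: is_derive_powR_prim => //; rewrite gt_eqF.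
- by move=> x; exact: continuous_powR.
- rewrite -[X in _ --> X](mul0r (a + 1)^-1); apply: cvgM; last exact: cvg_cst.
  exact: powR_cvg0.
Qed.

Lemma integrable_powR a t : -1 < a -> 0 <= t ->
  leb.-integrable `[0%R, t] (EFin \o (fun y : R => y `^ a)).
Proof.
move=> a1 t0; apply/integrableP; split.
  exact/measurable_EFinP/measurable_funTS.
under eq_integral do rewrite /= ger0_norm ?powR_ge0//.
by rewrite integral_powR// ltry.
Qed.

Lemma Rintegral_powR a t : -1 < a -> 0 <= t ->
  \int[leb]_(x in `[0%R, t]) (x `^ a) = t `^ (a + 1) / (a + 1).
Proof. by move=> a1 t0; rewrite /Rintegral integral_powR. Qed.

Definition res t f : R -> R := f \_ `[0, t].

Lemma resE t f x : res t f x = if 0 <= x <= t then f x else 0.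
Proof.
rewrite /res patchE; case: ifPn; rewrite ?inE ?notin_setE /= in_itv/=.
  by move=> ->.
by move/negP/negbTE => ->.
Qed.

Lemma measurable_res t f : measurable_fun `[0, t] f -> measurable_fun setT (res t f).
Proof. by move=> mf; apply/measurable_restrict => //=; rewrite setTI. Qed.

Lemma ip_resl t f g : ip leb (res t f) g = \int[leb]_(x in `[0, t]) (f x * g x).
Proof.
rewrite Rintegral_mkcond; apply: eq_Rintegral => x _.
by rewrite /res !patchE; case: ifPn => // _; rewrite mul0r.
Qed.

Lemma ip_res t f g :
  ip leb (res t f) (res t g) = \int[leb]_(x in `[0, t]) (f x * g x).
Proof.
rewrite ip_resl; apply: eq_Rintegral => x xt.
by rewrite /res patchE xt.
Qed.

Lemma L2_resP t f : measurable_fun `[0, t] f ->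
  (\int[leb]_(x in `[0%R, t]) (f x ^+ 2)%:E < +oo)%E -> res t f \in Lfun leb 2%:E.
Proof.
move=> mf fy; apply/L2P; split; first exact: measurable_res.
rewrite (_ : integral _ _ _ = (\int[leb]_(x in `[0%R, t]) (f x ^+ 2)%:E)%E)//.
rewrite [RHS]integral_mkcond; apply: eq_integral => x _.
by rewrite /res !patchE; case: ifPn => // _; rewrite expr0n.
Qed.

Lemma L2_res_powR a t : - (1 / 2) < a -> 0 <= t ->
  res t (fun y : R => y `^ a) \in Lfun leb 2%:E.
Proof.
move=> a1 t0; apply: L2_resP; first exact: measurable_funTS.
under eq_integral do rewrite -powR_mulrn ?powR_ge0// -powRrM.
by rewrite integral_powR ?ltry//; lra.
Qed.

Lemma ip_res_powR a b t : - (1 / 2) < a -> - (1 / 2) < b -> 0 <= t ->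
  ip leb (res t (fun y : R => y `^ a)) (res t (fun y : R => y `^ b)) =
  t `^ (a + b + 1) / (a + b + 1).
Proof.
move=> a1 b1 t0; rewrite ip_res -Rintegral_powR//; last lra.
rewrite /Rintegral; congr fine.
have m1 : measurable_fun `]0, t] (fun x => (x `^ a * x `^ b)%:E).
  by apply/measurable_EFinP/measurable_funM; exact: measurable_funTS.
have m2 : measurable_fun `]0, t] (fun x => (x `^ (a + b))%:E).
  by apply/measurable_EFinP; exact: measurable_funTS.
(* The point 0 is dropped because x^a x^b = x^(a+b) may fail there: for b = -a <> 0 the left side is
   0 and the right side is 1. *)
rewrite -!integral_itv_obnd_cbnd//; apply: eq_integral => x.
rewrite inE/= in_itv/= => /andP[x0 _].
by rewrite powRD// (gt_eqF x0) implybT.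
Qed.

End power_integrals.

(** * The Cauchy matrix 1/(lam_i + lam_j + 1) *)

Section cauchy_matrix.
Context (R : realType) (n : nat) (lam : 'I_n -> R).
Hypothesis lam_inj : injective lam.
Hypothesis lam_gt : forall j, - (1 / 2) < lam j.
Implicit Types i j k l : 'I_n.
Local Notation a := (a_coef lam).

Lemma lamD1_gt0 i j : 0 < lam i + lam j + 1.
Proof. by have := lam_gt i; have := lam_gt j; lra. Qed.

Lemma lam1_gt0 i : 0 < lam i + 1.
Proof. by have := lam_gt i; lra. Qed.

Lemma prod_except_size i (c : 'I_n -> R) :
  size (\prod_(l | l != i) ('X - (c l)%:P)) = n.
Proof.
rewrite -big_filter size_prod_XsubC -cardE cardC1 card_ord.
by case: n i => [[]|].
Qed.

Lemma prod_except_coef i (c : 'I_n -> R) :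
  (\prod_(l | l != i) ('X - (c l)%:P))`_n.-1 = 1.
Proof.
have := prod_except_size i c; set p : {poly R} := \prod_(l | _) _ => sp.
have /monicP : p \is monic by rewrite /p -big_filter monic_prod_XsubC.
by rewrite lead_coefE sp.
Qed.

(** [p] equals its interpolation polynomial [q], as [q - p] has size at most [n] and vanishes at the
    [n] distinct nodes. The identity compares the coefficients of degree n-1, each basis polynomial
    being a scalar multiple of a monic one of that degree. *)
Lemma lagrange_coef (p : {poly R}) : (size p <= n)%N ->
  \sum_j p.[lam j] / \prod_(l | l != j) (lam j - lam l) = p`_n.-1.
Proof.
move=> sp; pose c j := p.[lam j] / \prod_(l | l != j) (lam j - lam l).
pose q := \sum_j c j *: \prod_(l | l != j) ('X - (lam l)%:P).
have den j : \prod_(l | l != j) (lam j - lam l) != 0.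
  by apply/prodf_neq0 => l lj; rewrite subr_eq0 (inj_eq lam_inj) eq_sym.
have qE i : q.[lam i] = p.[lam i].
  rewrite /q horner_sum (bigD1 i)//= [X in _ + X]big1 ?addr0.
    rewrite hornerZ horner_prod /c.
    under [X in _ * X = _]eq_bigr do rewrite hornerXsubC.
    by rewrite divfK.
  move=> j ji; rewrite hornerZ horner_prod (bigD1 i) 1?eq_sym//=.
  by rewrite hornerXsubC subrr mul0r mulr0.
suff /eqP : q - p = 0.
  rewrite subr_eq0 => /eqP <-.
  rewrite /q coef_sum; apply: eq_bigr => j _.
  by rewrite -/q qE coefZ prod_except_coef mulr1.
apply/(@roots_geq_poly_eq0 _ _ [seq lam i | i <- enum 'I_n]).
- by apply/allP => _ /mapP[i _ ->]; rewrite rootE hornerD hornerN qE subrr.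
- by rewrite map_inj_uniq ?enum_uniq.
- rewrite size_map size_enum_ord (leq_trans (size_polyD _ _))// size_polyN geq_max sp andbT.
  apply: (leq_trans (size_sum _ _ _)); apply/bigmax_leqP => j _.
  by rewrite (leq_trans (size_scale_leq _ _))// prod_except_size.
Qed.

(* Lagrange interpolation of prod_(l != i) (X + lam l + 1) at the nodes lam j. *)
Lemma a_coef_sum i : \sum_j a j / (lam i + lam j + 1) = 1.
Proof.
pose p : {poly R} := \prod_(l | l != i) ('X - (- (lam l + 1))%:P).
have := @lagrange_coef p; rewrite prod_except_size prod_except_coef => /(_ (leqnn _)) E.
rewrite -[RHS]E.
apply: eq_bigr => j _; rewrite /a_coef mulrAC; congr (_ / _).
rewrite (bigD1 i)//= (addrC (lam j)) mulrAC mulfV ?mul1r; last first.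
  by rewrite gt_eqF// lamD1_gt0.
rewrite horner_prod; apply: eq_bigr => l _.
by rewrite hornerXsubC opprK addrA.
Qed.

(** Also the Gram matrix of the powers s^lam_j in L^2[0,1]. *)
Definition cm i j := (lam i + lam j + 1)^-1.

Lemma cmC i j : cm i j = cm j i.
Proof. by rewrite /cm (addrC (lam i)). Qed.

Lemma cm_sum i : \sum_j a j * cm i j = 1.
Proof. exact: a_coef_sum. Qed.

(** Partial fractions turn [cm i j * cm j k] into (cm i j - cm k j) / (lam k - lam i), and the two
    resulting sums are both 1 by [cm_sum]. *)
Lemma cm_off i k : i != k -> \sum_j cm i j * a j * cm j k = 0.
Proof.
move=> ik; have D : lam k - lam i != 0.
  by rewrite subr_eq0 (inj_eq lam_inj) eq_sym.
transitivity ((lam k - lam i)^-1 * (\sum_j a j * cm i j - \sum_j a j * cm k j)).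
  rewrite -sumrB mulr_sumr; apply: eq_bigr => j _; rewrite /cm.
  have := lamD1_gt0 i j; have := lamD1_gt0 j k => /lt0r_neq0 h1 /lt0r_neq0 h2.
  have h3 : lam k + lam j + 1 != 0 by rewrite (addrC (lam k)).
  by field; rewrite ?D ?h1 ?h2 ?h3.
by rewrite !cm_sum subrr mulr0.
Qed.

(** A double sum over j and k is evaluated twice: summing over k first gives 1 by two uses of
    [cm_sum], while summing over j first leaves only k = i by [cm_off]. *)
Lemma cm_diag i : a i * \sum_j cm i j * a j * cm j i = 1.
Proof.
rewrite -[RHS](cm_sum i).
transitivity (\sum_k \sum_j cm i j * a j * cm j k * a k).
  rewrite [RHS](bigD1 i)//= [X in _ = _ + X]big1 ?addr0.
    by rewrite mulrC mulr_suml.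
  move=> k ki; rewrite -mulr_suml cm_off ?mul0r//.
  by rewrite eq_sym.
rewrite exchange_big; apply: eq_bigr => j _ /=.
rewrite mulrC -[RHS]mulr1 -(cm_sum j) mulr_sumr; apply: eq_bigr => k _; ring.
Qed.

Lemma cm_inv i k : \sum_j cm i j * (a j * cm j k * a k) = (i == k)%:R.
Proof.
transitivity ((\sum_j cm i j * a j * cm j k) * a k).
  by rewrite mulr_suml; apply: eq_bigr => j _; ring.
have [->|ik] := eqVneq i k; first by rewrite mulrC cm_diag.
by rewrite cm_off// mul0r.
Qed.

(** The integral of K over [0,1]. By homogeneity it is also the common value of E[Y_s B_u] for all u
    >= s. *)
Definition Ssum := \sum_j a j / (lam j + 1).

(** With x = lam_i + 1 and y = lam_j + 1, the decomposition 1/(xy(x+y-1)) = 1/(x(x+y-1)) +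
    1/(y(x+y-1)) - 1/(xy) reduces the form to [cm_sum]. The value is 1 - (1 - S)^2, which cancels
    against (1 - S)^2 in [ip_innov]. *)
Lemma cm_quad : \sum_i \sum_j a i * a j / ((lam i + 1) * (lam j + 1)) * cm i j =
  2 * Ssum - Ssum ^+ 2.
Proof.
have E : \sum_i a i / (lam i + 1) * (\sum_j a j * cm i j) = Ssum.
  by apply: eq_bigr => i _; rewrite cm_sum mulr1.
have E' : \sum_i \sum_j a i / (lam i + 1) * (a j * cm i j) = Ssum.
  by rewrite -[RHS]E; apply: eq_bigr => i _; rewrite mulr_sumr.
have E2 : \sum_i \sum_j (a i / (lam i + 1)) * (a j / (lam j + 1)) = Ssum ^+ 2.
  rewrite expr2 {1}/Ssum mulr_suml; apply: eq_bigr => i _.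
  by rewrite /Ssum mulr_sumr.
have E'' : \sum_i \sum_j a j / (lam j + 1) * (a i * cm i j) = Ssum.
  rewrite exchange_big -[RHS]E'; apply: eq_bigr => i _; apply: eq_bigr => j _.
  by rewrite cmC.
transitivity (\sum_i \sum_j a i / (lam i + 1) * (a j * cm i j) +
    \sum_i \sum_j a j / (lam j + 1) * (a i * cm i j) -
    \sum_i \sum_j (a i / (lam i + 1)) * (a j / (lam j + 1))); last first.
  by rewrite E' E'' E2; ring.
rewrite -big_split -sumrB; apply: eq_bigr => i _ /=.
rewrite -big_split -sumrB; apply: eq_bigr => j _ /=.
rewrite /cm.
have := lamD1_gt0 i j; have := lam1_gt0 i; have := lam1_gt0 j.
move=> /lt0r_neq0 h1 /lt0r_neq0 h2 /lt0r_neq0 h3.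
by field; rewrite h1 h2 h3.
Qed.

End cauchy_matrix.

(** * Integrals of processes with values in L^2 *)

Section fubini_lebesgue.
Context d (T : measurableType d) (R : realType).
Variable mu : {sigma_finite_measure set T -> \bar R}.
Local Notation leb := (@lebesgue_measure R).
Local Notation GR := (measurableTypeR R).
Variable f : R -> T -> R.
Hypothesis mf : measurable_fun [set: R * T] (fun p : R * T => f p.1 p.2).
Let mf' : measurable_fun [set: GR * T] (fun p : GR * T => f p.1 p.2) := mf.
Let mEf : measurable_fun [set: GR * T] (fun p : GR * T => (f p.1 p.2)%:E).
Proof. exact/measurable_EFinP. Qed.

Lemma measurable_section w : measurable_fun [set: R] (f ^~ w).
Proof. exact: (measurableT_comp mf (@pair2_measurable _ _ R T w)). Qed.

Lemma measurable_integral_section :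
  measurable_fun [set: T] (fun w => \int[leb]_s (f s w)%:E)%E.
Proof.
rewrite [X in measurable_fun _ X](_ : _ = (fun w =>
   fubini_G leb (fun p : GR * T => (f p.1 p.2)%:E)^\+ w -
   fubini_G leb (fun p : GR * T => (f p.1 p.2)%:E)^\- w)%E); last first.
  apply/funext => w; rewrite integralE /fubini_G.
  by congr (_ - _)%E; apply: eq_integral => s _; rewrite ?funeposE ?funenegE.
apply: emeasurable_funB.
- apply: (@measurable_fun_fubini_tonelli_G _ _ GR T R leb) => //.
  exact: measurable_funepos.
- apply: (@measurable_fun_fubini_tonelli_G _ _ GR T R leb) => //.
  exact: measurable_funeneg.
Qed.

Lemma tonelli_lebesgue : (forall s w, 0 <= f s w) ->
  [/\ measurable_fun [set: T] (fun w => \int[leb]_s (f s w)%:E)%E,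
      measurable_fun [set: GR] (fun s => \int[mu]_w (f s w)%:E)%E
    & (\int[mu]_w \int[leb]_s (f s w)%:E = \int[leb]_s \int[mu]_w (f s w)%:E)%E].
Proof.
move=> f0; split.
- apply: (@measurable_fun_fubini_tonelli_G _ _ GR T R leb
    (fun p => (f p.1 p.2)%:E)) => // p; exact: f0.
- apply: (@measurable_fun_fubini_tonelli_F _ _ GR T R mu
    (fun p => (f p.1 p.2)%:E)) => // p; exact: f0.
- symmetry; apply: (@fubini_tonelli _ _ GR T R leb mu
    (fun p => (f p.1 p.2)%:E)) => // p; exact: f0.
Qed.

Lemma fubini_lebesgue : (\int[leb]_s \int[mu]_w `|(f s w)%:E| < +oo)%E ->
  [/\ {ae mu, forall w, leb.-integrable setT (EFin \o f ^~ w)},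
      leb.-integrable setT (fun s => \int[mu]_w (f s w)%:E)%E
    & (\int[mu]_w \int[leb]_s (f s w)%:E = \int[leb]_s \int[mu]_w (f s w)%:E)%E].
Proof.
move=> fy.
have := (@integrable12ltyP _ _ GR T R leb mu (fun p => (f p.1 p.2)%:E) mEf).2 fy.
move=> int; split.
- exact: (@ae_integrable2 _ _ GR T R leb mu _ int).
- exact: (@integrable_fubini_F _ _ GR T R leb mu _ int).
- by symmetry; exact: (@Fubini _ _ GR T R leb mu _ int).
Qed.

End fubini_lebesgue.

Section integral_process.
Context d (T : measurableType d) (R : realType).
Variable mu : {sigma_finite_measure set T -> \bar R}.
Local Notation leb := (@lebesgue_measure R).
Local Notation GR := (measurableTypeR R).
Local Notation L2 := (Lfun mu 2%:E).
Variables (Y : R -> T -> R) (t a C : R).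
Hypotheses (mY : measurable_fun [set: R * T] (fun p : R * T => Y p.1 p.2))
  (t0 : 0 <= t) (a1 : -1 < a)
  (YL : forall s, 0 < s -> s <= t -> Y s \in L2)
  (YC : forall s, 0 < s -> s <= t -> ip mu (Y s) (Y s) <= C * s `^ (a * 2)).

Let I : R -> R := \1_(`]0, t]).

Let IE (s : R) : I s = (0 < s <= t)%R%:R.
Proof. by rewrite /I indicE mem_setE in_itv. Qed.

Let mI : measurable_fun [set: R] I.
Proof. exact: measurable_indic. Qed.

(* [Y s * I s = F s * G s], where the weight s^(a/2) makes both factors square
   integrable: this replaces Minkowski's integral inequality. *)
Let F s w := Y s w * s `^ (- (a / 2)) * I s.
Let G s := s `^ (a / 2) * I s.

Let mIT : measurable_fun [set: R * T] (fun p : R * T => I p.1).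
Proof. exact: (measurableT_comp mI measurable_fst). Qed.

Let mF : measurable_fun [set: R * T] (fun p : R * T => F p.1 p.2).
Proof.
apply: measurable_funM => //.
apply: measurable_funM => //.
exact: (measurableT_comp (@measurable_powR R _) measurable_fst).
Qed.

Let mG : measurable_fun [set: R] G.
Proof. by apply: measurable_funM => //; exact: measurable_powR. Qed.

Let FG w s : F s w * G s = Y s w * I s.
Proof.
rewrite /F /G IE; have [/andP[s0 _]|] := boolP (0 < s <= t); last by rewrite !mulr0.
rewrite !mulr1 -mulrA -powRD ?addNr ?powRr0 ?mulr1//.
by rewrite (gt_eqF s0) implybT.
Qed.

Let I_integral (g : R -> R) :
  (\int[leb]_s (g s * I s)%:E = \int[leb]_(s in `]0%R, t]) (g s)%:E)%E.
Proof.
rewrite [RHS]integral_mkcond; apply: eq_integral => s _.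
rewrite patchE mem_setE in_itv/= IE; case: ifPn => _; rewrite ?mulr1 ?mulr0//.
Qed.

Let I_sqr s : I s ^+ 2 = I s.
Proof. by rewrite IE; case: (_ && _); rewrite ?expr1n ?expr0n. Qed.

Let I_powR (c : R) : (\int[leb]_s (c * s `^ a * I s)%:E)%E =
  (c * (t `^ (a + 1) / (a + 1)))%:E.
Proof.
rewrite I_integral [in RHS]EFinM -integral_powR//.
rewrite -integral_itv_obnd_cbnd; last exact/measurable_EFinP/measurable_funTS.
under eq_integral do rewrite EFinM.
rewrite integralZl//; apply: integrableS (integrable_powR a1 t0) => //.
by apply: subset_itvr; rewrite bnd_simp.
Qed.

Let GL : G \in Lfun leb 2%:E.
Proof.
apply/L2P; split => //.
have -> : (\int[leb]_s (G s ^+ 2)%:E = \int[leb]_s (1 * s `^ a * I s)%:E)%E.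
  apply: eq_integral => s _; rewrite /G exprMn I_sqr mul1r.
  rewrite -powR_mulrn ?powR_ge0// -powRrM; congr (_ `^ _ * _)%:E; lra.
by rewrite I_powR ltry.
Qed.

Let mFsq : measurable_fun [set: R * T] (fun p : R * T => F p.1 p.2 ^+ 2).
Proof. exact: measurable_funX. Qed.

Let Q w := (\int[leb]_s ((F s w) ^+ 2)%:E)%E.

Let mQ : measurable_fun [set: T] Q.
Proof.
by have [] := @tonelli_lebesgue _ T R mu (fun s w => F s w ^+ 2) mFsq (fun s w => sqr_ge0 _).
Qed.

Let C_ge0 s : 0 < s -> s <= t -> 0 <= C.
Proof.
move=> s0 st; have := le_trans (ip_ge0 _ _) (YC s0 st).
by rewrite pmulr_lge0// powR_gt0.
Qed.

Let intQ : (\int[mu]_w Q w < +oo)%E.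
Proof.
have [_ m2 ->] := @tonelli_lebesgue _ T R mu (fun s w => F s w ^+ 2) mFsq (fun s w => sqr_ge0 _).
apply: (@le_lt_trans _ _ (\int[leb]_s (C * s `^ a * I s)%:E)%E); last first.
  by rewrite I_powR ltry.
apply: ge0_le_integral => //.
- by move=> s _; apply: integral_ge0 => w _; rewrite lee_fin sqr_ge0.
- apply/measurable_EFinP/measurable_funM => //; apply: measurable_funM => //.
move=> s _; rewrite IE; have [/andP[s0 st]|nst] := boolP (0 < s <= t); last first.
  by rewrite integral0_eq ?mulr0// => w _; rewrite /F IE (negbTE nst) mulr0 expr0n.
rewrite (_ : \int[mu]_w _ = (ip mu (Y s) (Y s) * s `^ (- a))%:E)%E; last first.
  rewrite (_ : _ * _ = ip mu (s `^ (- (a / 2)) *: Y s) (s `^ (- (a / 2)) *: Y s)); last first.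
    rewrite ipZl ?L2Z ?YL// ipZr ?YL// mulrA -expr2 mulrC.
    rewrite -powR_mulrn ?powR_ge0// -powRrM; congr (_ `^ _ * _); lra.
  rewrite -sqr_integralE ?L2Z ?YL//; apply: eq_integral => w _.
  by rewrite /F IE s0 st mulr1 [in RHS]/GRing.scale/= mulrC.
rewrite mulr1 lee_fin (le_trans (ler_wpM2r (powR_ge0 _ _) (YC s0 st)))//.
rewrite -mulrA -powRD ?(gt_eqF s0) ?implybT//.
by rewrite (_ : a * 2 - a = a)//; lra.
Qed.

Let x w := \int[leb]_(s in `[0, t]) Y s w.

Let xE w : x w = \int[leb]_s (Y s w * I s).
Proof.
rewrite /x /Rintegral I_integral integral_itv_obnd_cbnd//.
apply/measurable_EFinP/measurable_funTS; exact: measurable_section.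
Qed.

Let mx : measurable_fun [set: T] x.
Proof.
rewrite [X in measurable_fun _ X](_ : _ = (fun w => \int[leb]_s (Y s w * I s))).
  apply: measurableT_comp => //.
  by apply: (@measurable_integral_section _ T R (fun s w => Y s w * I s)); exact: measurable_funM.
by apply/funext => w; rewrite xE.
Qed.

Let FL w : (Q w < +oo)%E -> F ^~ w \in Lfun leb 2%:E.
Proof. by move=> Qy; apply/L2P; split => //; exact: (measurable_section mF). Qed.

Let Q0 w : (0 <= Q w)%E. Proof. exact: sqr_integral_ge0. Qed.

Let Q_ae : {ae mu, forall w, (Q w < +oo)%E}.
Proof.
have : mu.-integrable setT Q.
  apply/integrableP; split => //.
  under eq_integral do rewrite gee0_abs ?Q0//.
  exact: intQ.
move=> /(integrable_ae measurableT); apply: filterS => w /(_ Logic.I).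
by rewrite ge0_fin_numE.
Qed.

Let YI_integrable w : (Q w < +oo)%E -> leb.-integrable setT (fun s => (Y s w * I s)%:E).
Proof.
move=> Qy; have := ip_integrable (FL Qy) GL.
by apply: eq_integrable => // s _ /=; rewrite FG.
Qed.

(** Pathwise Cauchy-Schwarz bounds x^2 by |G|^2 times [Q], and [Q] has finite mean since s^(-a)
    |Y_s|^2 <= C s^a with a > -1. *)
Lemma L2_integral_process : x \in L2.
Proof.
apply/L2P; split; first exact: mx.
apply: (@le_lt_trans _ _ (\int[mu]_w ((ip leb G G)%:E * Q w))%E).
  apply: ae_ge0_le_integral => //.
  - by move=> w _; rewrite lee_fin sqr_ge0.
  - by apply/measurable_EFinP/measurable_funX; exact: mx.
  - by move=> w _; rewrite mule_ge0// ?lee_fin ?ip_ge0// sqr_integral_ge0.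
  - exact: measurable_funeM.
  apply: filterS Q_ae => w Qy _.
  rewrite /Q sqr_integralE ?FL// -EFinM lee_fin xE.
  rewrite mulrC (_ : Rintegral _ _ _ = ip leb (F ^~ w) G); last first.
    by apply: eq_Rintegral => s _; rewrite FG.
  by rewrite cauchy_schwarz_sqr// FL.
rewrite ge0_integralZl//.
- apply: lte_mul_pinfty; [by rewrite lee_fin ip_ge0|by []|exact: intQ].
- by rewrite lee_fin ip_ge0.
Qed.

Let I_integrable (g : R -> R) : leb.-integrable setT (fun s => (g s * I s)%:E) ->
  leb.-integrable `[0, t] (EFin \o g).
Proof.
move=> gI; have : leb.-integrable `]0, t] (EFin \o g).
  apply/integrable_mkcond => //; apply: eq_integrable gI => // s _.
  by rewrite patchE mem_setE in_itv/= IE; case: ifPn => _; rewrite ?mulr1 ?mulr0.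
move=> /integrableP[mg gy]; apply/integrableP.
have mg' := (emeasurable_fun_itv_obnd_cbndP _ _ _).1 mg.
split => //; rewrite -integral_itv_obnd_cbnd//.
exact: measurableT_comp.
Qed.

Lemma integrable_process : {ae mu, forall w, leb.-integrable `[0, t] (EFin \o Y ^~ w)}.
Proof.
by apply: filterS Q_ae => w Qy; apply: I_integrable; exact: YI_integrable.
Qed.

(** Fubini, with the integrand dominated in mean by |Y_s| |W| <= sqrt(C) |W| s^a, integrable at 0
    because a > -1. *)
Lemma ip_integral_process W : W \in L2 ->
  leb.-integrable `[0, t] (fun s => (ip mu (Y s) W)%:E) /\
  ip mu x W = \int[leb]_(s in `[0, t]) ip mu (Y s) W.
Proof.
move=> WL; have mW := L2_measurable WL.
pose f s w := Y s w * I s * W w.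
have mf : measurable_fun [set: R * T] (fun p : R * T => f p.1 p.2).
  apply: measurable_funM; first exact: measurable_funM.
  exact: (measurableT_comp mW measurable_snd).
have fin s : (\int[mu]_w (f s w)%:E = (ip mu (Y s) W * I s)%:E)%E.
  rewrite /f IE; have [/andP[s0 st]|] := boolP (0 < s <= t).
    rewrite mulr1 -ip_EFin ?YL//.
    by apply: eq_integral => w _; rewrite mulr1.
  by rewrite mulr0 => _; apply: integral0_eq => w _; rewrite mulr0 mul0r.
have fy : (\int[leb]_s \int[mu]_w `|(f s w)%:E| < +oo)%E.
  apply: (@le_lt_trans _ _ (\int[leb]_s (Num.sqrt C * nrm mu W * s `^ a * I s)%:E)%E); last first.
    by rewrite I_powR ltry.
  apply: ge0_le_integral => //.
  - by move=> s _; apply: integral_ge0.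
  - have mnf : measurable_fun [set: R * T] (fun p : R * T => `|f p.1 p.2|).
      exact: measurableT_comp.
    by have [] := @tonelli_lebesgue _ T R mu (fun s w => `|f s w|) mnf (fun s w => normr_ge0 _).
  - apply/measurable_EFinP/measurable_funM => //; apply: measurable_funM => //.
  move=> s _; rewrite IE; have [/andP[s0 st]|nst] := boolP (0 < s <= t); last first.
    rewrite mulr0 integral0_eq// => w _.
    by rewrite /f IE (negbTE nst) mulr0 mul0r abse0.
  have absL (g : T -> R) : g \in L2 -> (fun w => `|g w|) \in L2 /\
      nrm mu (fun w => `|g w|) = nrm mu g.
    move=> gL; split.
      have [mg gy] := (L2P _ _).1 gL; apply/L2P; split; first exact: measurableT_comp.
      by under eq_integral do rewrite real_normK ?num_real//.
    by congr Num.sqrt; apply: eq_Rintegral => w _; rewrite -normrM ger0_norm// -expr2 sqr_ge0.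
  have [YL' YN] := absL _ (YL s0 st); have [WL' WN] := absL _ WL.
  rewrite (_ : \int[mu]_w _ = (ip mu (fun w => `|Y s w|) (fun w => `|W w|))%:E)%E; last first.
    by rewrite -ip_EFin//; apply: eq_integral => w _; rewrite /f IE s0 st mulr1 -normrM.
  rewrite mulr1 lee_fin (le_trans (ler_norm _))// (le_trans (cauchy_schwarz YL' WL'))//.
  rewrite YN WN mulrAC ler_wpM2r ?nrm_ge0//.
  rewrite -(@ler_pXn2r _ 2)// ?nnegrE ?nrm_ge0 ?mulr_ge0 ?sqrtr_ge0 ?powR_ge0//.
  rewrite sqr_nrm exprMn sqr_sqrtr ?(C_ge0 s0 st)// -powR_mulrn ?powR_ge0// -powRrM.
  exact: YC.
have [_ i1 i2] := fubini_lebesgue mf fy.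
have i3 : leb.-integrable `[0, t] (fun s => (ip mu (Y s) W)%:E).
  by apply: I_integrable; apply: eq_integrable i1 => // s _; rewrite fin.
split => //.
have xL := L2_integral_process.
apply: EFin_inj; rewrite -ip_EFin//.
transitivity (\int[mu]_w \int[leb]_s (f s w)%:E)%E.
  apply: ae_eq_integral => //.
  - by have /measurable_int := ip_integrable xL WL.
  - exact: measurable_integral_section.
  (* Where [Q] is finite the path is integrable, so the factor [W w] comes out of the inner
     integral. *)
  apply: filterS Q_ae => w Qy _.
  have YIw := YI_integrable Qy.
  under [RHS]eq_integral do rewrite EFinM.
  rewrite integralZr// EFinM; congr (_ * _)%E.
  by rewrite xE /Rintegral fineK//; exact: (integrable_fin_num measurableT YIw).
rewrite i2; under eq_integral do rewrite fin.
rewrite I_integral integral_itv_obnd_cbnd; last first.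
  apply/measurable_EFinP; have /measurable_int/measurable_EFinP := i3.
  by apply: measurable_funS => //; apply: subset_itvr; rewrite bnd_simp.
by rewrite /Rintegral fineK//; exact: (integrable_fin_num _ i3).
Qed.

End integral_process.

(** * Closed spans and Wiener integrals *)

Lemma small_eq0 (R : realType) (x K : R) :
  (forall e, 0 < e -> `|x| <= e * K) -> x = 0.
Proof.
move=> H; apply/eqP; rewrite -normr_eq0 eq_le normr_ge0 andbT.
apply/ler_addgt0Pl => e e0; rewrite addr0.
have K1 : 0 < `|K| + 1 by rewrite ltr_wpDl.
apply: le_trans (H (e / (`|K| + 1)) (divr_gt0 e0 K1)) _.
rewrite mulrAC ler_pdivrMr// ler_wpM2l// ?ltW//.
by have := ler_norm K; lra.
Qed.

Section closed_span.
Context d (T : measurableType d) (R : realType).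
Variable mu : {measure set T -> \bar R}.
Local Notation L2 := (Lfun mu 2%:E).
Implicit Types (B : R -> T -> R) (t : R) (X Y : T -> R).

(** [Hspace] over an arbitrary measure, so that the same lemmas serve indicators in L^2 of the line
    and Brownian motion in L^2(P). *)
Definition clspan B t : set (T -> R) :=
  [set Y | Y \in L2 /\ forall e, 0 < e -> exists (m : nat) (c s : 'I_m -> R),
    (forall i, 0 <= s i <= t) /\ nrm mu (Y - \sum_i c i *: B (s i)) < e].

(** The second-order part of being a Brownian motion. It is shared by B, by Z and, under Lebesgue
    measure, by the indicators of ]0,t]. *)
Definition brownian_cov B :=
  (forall t, 0 <= t -> B t \in L2) /\
  (forall s t, 0 <= s -> 0 <= t -> ip mu (B s) (B t) = Num.min s t).

Variables (B : R -> T -> R) (t : R).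
Hypothesis BL : forall s, 0 <= s -> s <= t -> B s \in L2.

Lemma L2_lin (m : nat) (c s : 'I_m -> R) : (forall i, 0 <= s i <= t) ->
  \sum_i c i *: B (s i) \in L2.
Proof. by move=> st; apply: L2_sum => i; have /andP[] := st i => *; rewrite L2Z ?BL. Qed.

Lemma nrmBC X Y : nrm mu (X - Y) = nrm mu (Y - X).
Proof.
by congr Num.sqrt; apply: eq_Rintegral => w _ /=; rewrite -mulrNN !opprB.
Qed.

Lemma clspan_closed X : X \in L2 ->
  (forall e, 0 < e -> exists2 Y, clspan B t Y & nrm mu (X - Y) < e) ->
  clspan B t X.
Proof.
move=> XL XY; split => // e e0; have e20 : 0 < e / 2 by rewrite divr_gt0.
have [Y [YL /(_ _ e20)[m [c [s [st Ys]]]] XY2]] := XY _ e20.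
exists m, c, s; split => //; have LL := L2_lin c st.
rewrite -(subrKA Y) (le_lt_trans (nrmD _ _)) ?L2B// (splitr e) ltrD//.
Qed.

Lemma clspan_gen s : 0 <= s -> s <= t -> clspan B t (B s).
Proof.
move=> s0 st; split; first exact: BL.
move=> e e0; exists 1%N, (fun=> 1), (fun=> s); split => [_|]; first by rewrite s0.
by rewrite big_ord1 scale1r subrr nrm0.
Qed.

Lemma clspan0 : clspan B t 0.
Proof.
split; first exact: L2_0.
move=> e e0; exists 0%N, (fun=> 0), (fun=> 0); split => [[]//|].
by rewrite big_ord0 subrr nrm0.
Qed.

Lemma clspanZ c X : clspan B t X -> clspan B t (c *: X).
Proof.
move=> [XL XY]; split; first exact: L2Z.
move=> e e0; have e1 : 0 < e / (`|c| + 1) by rewrite divr_gt0// ltr_wpDl.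
have [m [c' [s [st H]]]] := XY _ e1.
exists m, (fun i => c * c' i), s; split => //.
under eq_bigr do rewrite -scalerA.
rewrite -scaler_sumr -scalerBr nrmZ ?L2B ?L2_lin//.
apply: (@le_lt_trans _ _ ((`|c| + 1) * nrm mu (X - \sum_i c' i *: B (s i)))).
  by rewrite ler_wpM2r ?nrm_ge0// lerDl.
by rewrite mulrC -ltr_pdivlMr// ltr_wpDl.
Qed.

Lemma clspanD X Y : clspan B t X -> clspan B t Y -> clspan B t (X + Y).
Proof.
move=> [XL XX] [YL YY]; split; first exact: L2D.
move=> e e0; have e20 : 0 < e / 2 by rewrite divr_gt0.
have [m1 [c1 [s1 [st1 H1]]]] := XX _ e20.
have [m2 [c2 [s2 [st2 H2]]]] := YY _ e20.
pose u (f1 : 'I_m1 -> R) (f2 : 'I_m2 -> R) (i : 'I_(m1 + m2)) :=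
  match fintype.split i with inl j => f1 j | inr j => f2 j end.
have ul f1 f2 i : u f1 f2 (lshift m2 i) = f1 i.
  by rewrite /u (unsplitK (inl i)).
have ur f1 f2 i : u f1 f2 (rshift m1 i) = f2 i.
  by rewrite /u (unsplitK (inr i)).
exists (m1 + m2)%N, (u c1 c2), (u s1 s2); split.
  by move=> i; rewrite /u; case: (fintype.split i).
have -> : \sum_i u c1 c2 i *: B (u s1 s2 i) =
    \sum_i c1 i *: B (s1 i) + \sum_i c2 i *: B (s2 i).
  by rewrite big_split_ord; congr (_ + _); apply: eq_bigr => i _; rewrite ?ul ?ur.
rewrite opprD addrACA (le_lt_trans (nrmD _ _)) ?L2B ?L2_lin//.
by rewrite (splitr e) ltrD.
Qed.

Lemma clspanB X Y : clspan B t X -> clspan B t Y -> clspan B t (X - Y).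
Proof. by move=> ? ?; rewrite -scaleN1r; apply: clspanD => //; exact: clspanZ. Qed.

Lemma clspan_sum I (r : seq I) (F : I -> T -> R) :
  (forall i, clspan B t (F i)) -> clspan B t (\sum_(i <- r) F i).
Proof. by move=> FH; elim/big_ind : _ => //; [exact: clspan0|exact: clspanD]. Qed.

Lemma clspan_ae X Y : clspan B t X -> Y \in L2 ->
  {ae mu, forall w, Y w = X w} -> clspan B t Y.
Proof.
move=> HX YL YX; have XL := HX.1.
apply: clspan_closed => // e e0; exists X => //.
rewrite (_ : nrm _ _ = 0)//; apply/eqP; rewrite -sqrf_eq0 sqr_nrm.
rewrite ipBl ?L2B// (ip_ae (f := X) (g := Y))// ?subrr// L2B//.
Qed.

(** Replacing [X] by a combination of the generators at distance less than e changes the inner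
    product by at most e |Y|. *)
Lemma clspan_ip0 X Y : clspan B t X -> Y \in L2 ->
  (forall s, 0 <= s -> s <= t -> ip mu (B s) Y = 0) -> ip mu X Y = 0.
Proof.
move=> [XL XX] YL BY; apply: (@small_eq0 _ _ (nrm mu Y)) => e e0.
have [m [c [s [st H]]]] := XX _ e0; have LL := L2_lin c st.
have L0 : ip mu (\sum_i c i *: B (s i)) Y = 0.
  rewrite ip_suml//; last by move=> i; have /andP[*] := st i; rewrite L2Z ?BL.
  by rewrite big1// => i _; have /andP[*] := st i; rewrite ipZl ?BL// BY// mulr0.
rewrite -[ip mu X Y]subr0 -L0 -ipBl// (le_trans (cauchy_schwarz _ _))// ?L2B//.
by rewrite ler_wpM2r ?nrm_ge0// ltW.
Qed.

End closed_span.

Lemma clspan_le d (T : measurableType d) (R : realType)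
    (mu : {measure set T -> \bar R}) (B : R -> T -> R) (s t : R) : s <= t ->
  clspan mu B s `<=` clspan mu B t.
Proof.
move=> st X [XL H]; split => // e /H[m [c [u [us Xu]]]]; exists m, c, u; split => // i.
by have /andP[-> /le_trans ->] := us i.
Qed.

Import HBSimple HBNNSimple.

(** * Density of step functions in L^2[0,t] *)

Section heaviside.
Context (R : realType).
Local Notation leb := (@lebesgue_measure R).
Implicit Types (s t u : R) (f : R -> R).

Definition unit_step u : R -> R := \1_(`]0, u]).

Lemma unit_stepE u x : unit_step u x = (0 < x <= u)%R%:R.
Proof. by rewrite /unit_step indicE mem_setE in_itv. Qed.

Lemma measurable_unit_step u : measurable_fun setT (unit_step u).
Proof. exact: measurable_indic. Qed.

Lemma lebesgue_itv0c u : 0 <= u -> leb `]0%R, u] = u%:E.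
Proof.
move=> u0; rewrite lebesgue_measure_itv/= lte_fin; case: ltP => [_|u0'].
  by rewrite sube0.
by congr EFin; apply/le_anti/andP.
Qed.

Lemma integral_indic_itv0c u : 0 <= u ->
  (\int[leb]_x (\1_(`]0%R, u]) x)%:E = u%:E)%E.
Proof. by move=> u0; rewrite integral_indic//= setIT; exact: lebesgue_itv0c. Qed.

Lemma L2_unit_step u : 0 <= u -> unit_step u \in Lfun leb 2%:E.
Proof.
move=> u0; apply/L2P; split; first exact: measurable_unit_step.
have -> : (\int[leb]_x (unit_step u x ^+ 2)%:E = \int[leb]_x (\1_(`]0, u]) x)%:E)%E.
  by apply: eq_integral => x _; rewrite unit_stepE indicE mem_setE in_itv/=;
     case: (_ && _); rewrite ?expr1n ?expr0n.
by rewrite integral_indic_itv0c// ltry.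
Qed.

Lemma ip_unit_step s t : 0 <= s -> 0 <= t ->
  ip leb (unit_step s) (unit_step t) = Num.min s t.
Proof.
move=> s0 t0; rewrite /ip /Rintegral.
have -> : (\int[leb]_x (unit_step s x * unit_step t x)%:E =
    \int[leb]_x (\1_(`]0, Num.min s t]) x)%:E)%E.
  apply: eq_integral => x _; rewrite !unit_stepE indicE mem_setE in_itv/=.
  rewrite le_min -natrM mulnb; congr (_%:R)%:E.
  by case: (0 < x); rewrite ?andbF.
by rewrite integral_indic_itv0c// le_min s0.
Qed.

Lemma brownian_cov_unit_step : brownian_cov leb unit_step.
Proof. by split; [exact: L2_unit_step|exact: ip_unit_step]. Qed.

Lemma Rintegral_obnd_cbnd f u : measurable_fun `]0, u] f ->
  \int[leb]_(x in `]0, u]) f x = \int[leb]_(x in `[0, u]) f x.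
Proof.
by move=> mf; rewrite /Rintegral integral_itv_obnd_cbnd//; exact/measurable_EFinP.
Qed.

Lemma measurable_res_itv t u f : res t f \in Lfun leb 2%:E -> u <= t ->
  measurable_fun `[0, u] f.
Proof.
move=> /L2_measurable mf ut.
apply: (eq_measurable_fun (res t f)); last exact: measurable_funTS.
move=> x; rewrite inE/= in_itv/= resE => /andP[x0 xu].
by rewrite x0 (le_trans xu ut).
Qed.

Lemma ip_res_unit_step t u f : res t f \in Lfun leb 2%:E -> u <= t ->
  ip leb (res t f) (unit_step u) = \int[leb]_(x in `[0, u]) f x.
Proof.
move=> fL ut; rewrite -Rintegral_obnd_cbnd; last first.
  apply: measurable_funS (measurable_res_itv fL ut) => //.
  by apply: subset_itvr; rewrite bnd_simp.
rewrite Rintegral_mkcond; apply: eq_Rintegral => x _.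
rewrite unit_stepE patchE mem_setE in_itv/= resE.
have [/andP[x0 xu]|_] := boolP (0 < x <= u); last by rewrite mulr0.
by rewrite (ltW x0) (le_trans xu ut) mulr1.
Qed.

Variable t : R.
Hypothesis t0 : 0 <= t.
Local Notation SP := (clspan leb unit_step t).

Let stepL s : 0 <= s -> s <= t -> unit_step s \in Lfun leb 2%:E.
Proof. by move=> *; exact: L2_unit_step. Qed.

Let I : R -> R := unit_step t.

Let ind (A : set R) : R -> R := \1_(`]0, t] `&` A).

Let indL A : measurable A -> ind A \in Lfun leb 2%:E.
Proof.
move=> mA; have mtA : measurable (`]0, t] `&` A) by exact: measurableI.
apply/L2P; split; first exact: measurable_indic.
have -> : (\int[leb]_x (ind A x ^+ 2)%:E = \int[leb]_x (ind A x)%:E)%E.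
  by apply: eq_integral => x _; rewrite /ind indicE;
     case: (_ \in _); rewrite ?expr1n ?expr0n.
rewrite integral_indic// setIT (@le_lt_trans _ _ (leb `]0%R, t]))//.
  by apply: le_measure; rewrite ?inE.
by rewrite lebesgue_itv0c// ltry.
Qed.

Let ip_ind A : measurable A ->
  ((ip leb (ind A) (ind A))%:E = leb (`]0%R, t] `&` A))%E.
Proof.
move=> mA; have mtA : measurable (`]0, t] `&` A) by exact: measurableI.
rewrite -sqr_integralE ?indL//.
transitivity (\int[leb]_x (\1_(`]0, t] `&` A) x)%:E)%E.
  by apply: eq_integral => x _; rewrite /ind !indicE;
     case: (_ \in _); rewrite ?expr1n ?expr0n.
by rewrite integral_indic//= setIT.
Qed.

Let ind_in A x : ind A x = (0 < x <= t)%R%:R * (x \in A)%:R.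
Proof. by rewrite /ind indicE in_setI mem_setE in_itv/= -natrM mulnb. Qed.

Let SP_ind_oc a b : SP (ind `]a, b]).
Proof.
have [ba|ab] := leP (Num.min b t) (Num.max a 0).
  rewrite (_ : ind _ = 0); first exact: clspan0.
  apply/funext => x; rewrite ind_in mem_setE in_itv/=.
  have [/andP[x0 xt]|_] := boolP (0 < x <= t); last by rewrite mul0r.
  have [/andP[ax xb]|_] := boolP (a < x <= b); last by rewrite mulr0.
  have : Num.min b t < x by rewrite (le_lt_trans ba)// gt_max ax.
  by rewrite ltNge le_min xb xt.
have a0 : 0 <= Num.max a 0 by rewrite le_max lexx orbT.
have bt : Num.min b t <= t by rewrite ge_min lexx orbT.
rewrite (_ : ind _ = unit_step (Num.min b t) - unit_step (Num.max a 0)).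
  apply: clspanB => //; apply: clspan_gen => //.
    exact: le_trans a0 (ltW ab).
  exact: le_trans (ltW ab) bt.
apply/funext => x; rewrite ind_in mem_setE in_itv/= [RHS]/GRing.add/= [X in _ + X]/GRing.opp/=.
rewrite !unit_stepE le_min le_max.
move: ab; rewrite lt_min !gt_max => /andP[/andP[ab b0] /andP[at_ t_0]].
case: (ltP 0 x) => x0 /=; last by rewrite mul0r subrr.
rewrite orbF.
case: (leP x t) => xt; case: (ltP a x) => ax; case: (leP x b) => xb;
  rewrite ?mul1r ?mulr1 ?mul0r ?mulr0 ?subrr ?subr0//.
- by move: (le_lt_trans ax ab); rewrite ltNge (ltW xb).
- by move: (le_lt_trans ax at_); rewrite ltNge (ltW xt).
- by move: (le_lt_trans ax at_); rewrite ltNge (ltW xt).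
Qed.

(** Dynkin's lemma from the half-open intervals, which are stable under intersection. *)
Let SP_ind A : measurable A -> SP (ind A).
Proof.
move=> mA; have := @dynkin_induction _ (measurableTypeR R) (@ocitv R) (fun A => SP (ind A)).
apply => //.
- exact: ocitvI.
- rewrite (_ : ind _ = unit_step t); first exact: clspan_gen.
  by rewrite /ind setIT.
- by move=> _ [[a b] _ <-]; exact: SP_ind_oc.
- move=> S mS PS; rewrite (_ : ind _ = unit_step t - ind S).
    by apply: clspanB => //; exact: clspan_gen.
  apply/funext => x; rewrite [RHS]/GRing.add/= [X in _ + X]/GRing.opp/=.
  rewrite !ind_in unit_stepE in_setC.
  by case: (x \in S); rewrite ?mulr1 ?mulr0 ?subr0 ?subrr.
move=> F mF tF PF.
(* The union differs from its first [n] members by [tail n]. The tails decrease to the empty set, so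
   their measure within ]0,t], which is the squared L^2 distance, tends to 0. *)
pose tail n := \bigcup_k F (n + k)%N.
have mtail n : measurable (tail n) by exact: bigcupT_measurable.
have tailS n : ind (tail n) = ind (F n) + ind (tail n.+1).
  apply/funext => x; rewrite [RHS]/GRing.add/= !ind_in -mulrDr; congr (_ * _).
  have [xF|xF] := boolP (x \in F n).
    rewrite mem_set; last by exists 0%N => //; rewrite addn0; exact: set_mem.
    rewrite memNset ?addr0// => -[k _ xk].
    have := tF n (n.+1 + k)%N Logic.I Logic.I.
    by move=> /(_ (ex_intro _ x (conj (set_mem xF) xk))) /eqP; rewrite -[X in X == _]addn0 addSn -addnS eqn_add2l.
  rewrite add0r; suff -> : (x \in tail n) = (x \in tail n.+1) by [].
  apply/idP/idP => /set_mem[k _ xk]; apply/mem_set.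
    case: k xk => [|k] xk; first by move: xF; rewrite -[X in F X]addn0 (mem_set xk).
    by exists k => //; rewrite addSn -addnS.
  by exists k.+1 => //; rewrite addnS -addSn.
have indE n : ind (\bigcup_k F k) = \sum_(i < n) ind (F i) + ind (tail n).
  elim: n => [|n IH]; first by rewrite big_ord0 add0r.
  by rewrite big_ord_recr /= -addrA -tailS.
apply: clspan_closed => //; first by apply: indL; exact: bigcupT_measurable.
move=> e e0.
have : leb (`]0%R, t] `&` tail n) @[n --> \oo] --> leb (\bigcap_n (`]0%R, t] `&` tail n)).
  apply: nonincreasing_cvg_mu.
  - rewrite (@le_lt_trans _ _ (leb `]0%R, t]))//.
      by apply: le_measure; rewrite ?inE//; exact: measurableI.
    by rewrite lebesgue_itv0c// ltry.
  - by move=> n; exact: measurableI.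
  - by apply: bigcapT_measurable => n; exact: measurableI.
  - apply/nonincreasing_seqP => n; rewrite subsetEset; apply: setIS => x [k _ xk].
    by exists k.+1 => //; rewrite addnS -addSn.
rewrite (_ : \bigcap_n _ = set0) ?measure0; last first.
  apply/seteqP; split=> // x /= H; have [_ [k _ xk]] := H 0%N Logic.I.
  have [_ [k' _ xk']] := H k.+1 Logic.I.
  have := tF _ _ Logic.I Logic.I (ex_intro _ x (conj xk xk')).
  by move/eqP; rewrite add0n addSn -addnS -[X in X == _]addn0 eqn_add2l.
move=> /fine_cvg/cvgr_lt/(_ (e ^+ 2) (exprn_gt0 _ e0))[n _ /(_ n (leqnn n)) /= H].
exists (\sum_(i < n) ind (F i)); first by apply: clspan_sum => // i.
rewrite (indE n) addrAC subrr add0r -(@ltr_pXn2r _ 2)// ?nnegrE ?nrm_ge0 ?(ltW e0)//.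
by rewrite sqr_nrm; move: H; rewrite -ip_ind; [|exact: mtail].
Qed.

Let step_mul (g : R -> R) : R -> R := fun x => g x * unit_step t x.

Let SP_nnsfun (g : {nnsfun (measurableTypeR R) >-> R}) : SP (step_mul g).
Proof.
rewrite (_ : step_mul g = \sum_(y <- finmap.enum_fset (fset_set (range g))) y *: ind (g @^-1` [set y])).
  apply: clspan_sum => // y; apply: clspanZ => //; apply: SP_ind.
  have mg : measurable_fun setT g by exact: measurable_funP.
  by have := mg measurableT _ (measurable_set1 y); rewrite setTI.
apply/funext => x; rewrite /step_mul fimfunE fsbig_finite//= fct_sumE mulr_suml.
apply: eq_bigr => y _; rewrite -[RHS]/(y * ind (g @^-1` [set y]) x).
by rewrite ind_in unit_stepE indicE -mulrA; congr (_ * _); rewrite mulrC.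
Qed.

(** Simple functions increase to [f], and (f - g_n)^2 <= f^2 on ]0,t] allows dominated
    convergence. *)
Let SP_ge0 (f : R -> R) : measurable_fun setT f -> (forall x, 0 <= f x) ->
  step_mul f \in Lfun leb 2%:E -> SP (step_mul f).
Proof.
move=> mf f0 fL; have mEf : measurable_fun [set: measurableTypeR R] (EFin \o f).
  exact/measurable_EFinP.
pose g := nnsfun_approx measurableT mEf.
apply: clspan_closed => // e e0.
pose h n x := (f x - g n x) ^+ 2 * unit_step t x.
have gf n x : 0 <= g n x <= f x.
  rewrite fun_ge0/= -lee_fin /g nnsfun_approxE.
  by apply: le_approx => // y _; rewrite lee_fin.
have hcvg : (\int[leb]_x (h n x)%:E)%E @[n --> \oo] --> 0%E.
  have mg n : measurable_fun setT (g n) by exact: measurable_funP.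
  have mh n : measurable_fun setT (h n).
    apply: measurable_funM; last exact: measurable_unit_step.
    by apply: measurable_funX; exact: (measurable_funB mf (mg n)).
  have [_ fy] := (L2P _ _).1 fL.
  have c1 n : measurable_fun setT (fun x => (h n x)%:E) by exact/measurable_EFinP.
  have c2 : {ae leb, forall x, setT x -> (h n x)%:E @[n --> \oo] --> cst 0%E x}.
    apply: nearW => x _.
    have := @cvg_nnsfun_approx _ _ _ setT measurableT _ mEf (fun y _ => f0 y) x Logic.I.
    move=> /fine_cvg/= gx; apply: cvg_EFin; first exact: nearW.
    rewrite [X in _ --> X](_ : _ = (f x - f x) ^+ 2 * unit_step t x); last first.
      by rewrite subrr expr0n mul0r.
    apply: cvgM; last exact: cvg_cst.
    have fgx : f x - g n x @[n --> \oo] --> f x - f x.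
      by apply: cvgB gx; exact: cvg_cst.
    by rewrite expr2; exact: (cvgM fgx fgx).
  have c3 : leb.-integrable setT (fun x => (step_mul f x ^+ 2)%:E).
    exact: Lfun2_integrable_sqr.
  have c4 : {ae leb, forall x, forall n, setT x -> (`|(h n x)%:E| <= (step_mul f x ^+ 2)%:E)%E}.
    apply: nearW => x n _; rewrite lee_fin /h ger0_norm; last first.
      by rewrite mulr_ge0 ?sqr_ge0// unit_stepE; case: (_ && _).
    have /andP[g0 g1] := gf n x.
    rewrite /step_mul exprMn unit_stepE; case: (_ && _); rewrite ?expr1n ?expr0n ?mulr1 ?mulr0//.
    by rewrite ler_pXn2r ?nnegrE// ?subr_ge0// gerBl.
  have [_ _] := @dominated_convergence _ _ _ leb setT measurableT (fun n x => (h n x)%:E)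
    (cst 0%E) (fun x => (step_mul f x ^+ 2)%:E) c1 (@measurable_cst _ _ _ _ _ _) c2 c3 c4.
  by rewrite integral0.
have hE n : (\int[leb]_x (h n x)%:E = (ip leb (step_mul f - step_mul (g n)) (step_mul f - step_mul (g n)))%:E)%E.
  rewrite -sqr_integralE ?L2B//; last exact: (SP_nnsfun (g n)).1.
  apply: eq_integral => x _; rewrite /h /step_mul [in RHS]/GRing.add/= [X in (_ + X) ^+ _]/GRing.opp/=.
  rewrite -mulrBl exprMn unit_stepE; congr (_ * _)%:E.
  by case: (_ && _); rewrite ?expr1n ?expr0n.
move: hcvg => /fine_cvg/cvgr_lt/(_ (e ^+ 2) (exprn_gt0 _ e0))[n _ /(_ n (leqnn n)) /= H].
exists (step_mul (g n)); first exact: SP_nnsfun.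
rewrite -(@ltr_pXn2r _ 2)// ?nnegrE ?nrm_ge0 ?(ltW e0)// sqr_nrm.
by move: H; rewrite hE.
Qed.

Lemma step_functions_dense (f : R -> R) : res t f \in Lfun leb 2%:E -> SP (res t f).
Proof.
move=> fL; have mf := L2_measurable fL.
pose fp x := Num.max (res t f x) 0; pose fn x := Num.max (- res t f x) 0.
have mfp : measurable_fun setT fp by exact: measurable_maxr.
have mfn : measurable_fun setT fn by apply: measurable_maxr => //; exact: measurableT_comp.
have L2s (g : R -> R) : measurable_fun setT g -> (forall x, `|g x| <= `|res t f x|) ->
    step_mul g \in Lfun leb 2%:E.
  move=> mg gf; have [_ fy] := (L2P _ _).1 fL; apply/L2P; split.
    by apply: measurable_funM => //; exact: measurable_unit_step.
  apply: le_lt_trans fy; apply: ge0_le_integral => //.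
  - by move=> x _; rewrite lee_fin sqr_ge0.
  - apply/measurable_EFinP/measurable_funX/measurable_funM => //; exact: measurable_unit_step.
  - exact/measurable_EFinP/measurable_funX.
  - move=> x _; rewrite lee_fin -[leLHS]real_normK ?num_real// -[leRHS]real_normK ?num_real//.
    rewrite ler_pXn2r ?nnegrE// /step_mul normrM (le_trans _ (gf x))//.
    by rewrite ler_piMr// unit_stepE; case: (_ && _); rewrite ?normr1 ?normr0.
(* [res t f] lives on [0,t] and the generators on ]0,t]: the two sides can differ only at 0. *)
have E : {ae leb, forall x, res t f x = (step_mul fp - step_mul fn) x}.
  exists [set 0]; split => //; first by rewrite lebesgue_measure_set1.
  move=> x /= H; apply: contrapT => /eqP x0; apply: H.
  rewrite /step_mul [RHS]/GRing.add/= [X in _ + X]/GRing.opp/= -mulrBl unit_stepE.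
  have -> : fp x - fn x = res t f x.
    rewrite /fp /fn; case: (leP (res t f x) 0) => h; case: (leP (- res t f x) 0) => h'; lra.
  by rewrite resE lt_neqAle (eq_sym 0) x0/=; case: (_ && _); rewrite ?mulr1 ?mul0r.
apply: (clspan_ae stepL _ fL E); apply: clspanB => //; apply: SP_ge0 => //.
- by move=> x; rewrite /fp le_max lexx orbT.
- apply: L2s => // x; rewrite /fp; case: (leP (res t f x) 0) => //; rewrite normr0//.
- by move=> x; rewrite /fn le_max lexx orbT.
- apply: L2s => // x; rewrite /fn; case: (leP (- res t f x) 0); rewrite ?normr0 ?normrN//.
Qed.

End heaviside.

(** * Elementary integrals of step functions *)

Section increments.
Context d (T : measurableType d) (R : realType).
Variable mu : {measure set T -> \bar R}.
Variable B : R -> T -> R.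
Hypothesis hB : brownian_cov mu B.
Implicit Types (m : nat) (t : R).

Definition incr m (c a b : 'I_m -> R) : T -> R := \sum_i c i *: (B (b i) - B (a i)).

Definition admissible t m (a b : 'I_m -> R) : Prop :=
  forall i, 0 <= a i <= b i /\ b i <= t.

Lemma admissibleP t m (a b : 'I_m -> R) i : admissible t a b ->
  [/\ 0 <= a i, a i <= t, 0 <= b i & b i <= t].
Proof.
move=> /(_ i)[/andP[a0 ab] bt]; split => //; first exact: le_trans ab bt.
exact: le_trans ab.
Qed.

Lemma brownian_L2 s : 0 <= s -> B s \in Lfun mu 2%:E.
Proof. by case: hB => + _; exact. Qed.

Lemma L2_incr t m (c a b : 'I_m -> R) : admissible t a b ->
  incr c a b \in Lfun mu 2%:E.
Proof.
move=> ab; apply: L2_sum => i; have [? ? ? ?] := admissibleP i ab.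
by rewrite L2Z ?L2B ?brownian_L2.
Qed.

(** The right-hand side mentions neither the process nor the measure. Elementary integrals with
    equal data therefore have equal inner products over any two processes with this covariance,
    which is the isometry on step functions. *)
Lemma ip_incr t t' m m' (c a b : 'I_m -> R) (c' a' b' : 'I_m' -> R) :
  admissible t a b -> admissible t' a' b' ->
  ip mu (incr c a b) (incr c' a' b') = \sum_i \sum_j c i * (c' j *
    (Num.min (b i) (b' j) - Num.min (b i) (a' j) -
     (Num.min (a i) (b' j) - Num.min (a i) (a' j)))).
Proof.
move=> ab ab'; have L i := admissibleP i ab; have L' i := admissibleP i ab'.
have dL i : B (b i) - B (a i) \in Lfun mu 2%:E.
  by have [*] := L i; rewrite L2B ?brownian_L2.
have dL' i : B (b' i) - B (a' i) \in Lfun mu 2%:E.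
  by have [*] := L' i; rewrite L2B ?brownian_L2.
rewrite ip_suml; [|by move=> i; rewrite L2Z|exact: L2_incr ab'].
apply: eq_bigr => i _; rewrite ip_sumr; [|by move=> j; rewrite L2Z|by rewrite L2Z].
apply: eq_bigr => j _; rewrite ipZl ?L2Z// ipZr//; congr (_ * (_ * _)).
have [a0 _ b0 _] := L i; have [a'0 _ b'0 _] := L' j.
case: hB => BL Bip.
by rewrite ipBl ?ipBr ?BL// ?L2B ?BL// !Bip.
Qed.

Lemma clspan_incr t m (c a b : 'I_m -> R) : admissible t a b ->
  clspan mu B t (incr c a b).
Proof.
move=> ab.
have BL s : 0 <= s -> s <= t -> B s \in Lfun mu 2%:E by move=> *; exact: brownian_L2.
apply: clspan_sum => // i; have [*] := admissibleP i ab.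
by apply: clspanZ => //; apply: clspanB => //; exact: clspan_gen.
Qed.

End increments.

Section ip_approx.
Context d (T : measurableType d) (R : realType).
Variable mu : {measure set T -> \bar R}.
Local Notation L2 := (Lfun mu 2%:E).

(** The condition [e <= 1] absorbs the quadratic error e^2 into e. *)
Lemma ip_approx X X' Y Y' e : X \in L2 -> X' \in L2 -> Y \in L2 -> Y' \in L2 ->
  nrm mu (X - X') < e -> nrm mu (Y - Y') < e -> e <= 1 ->
  `|ip mu X Y - ip mu X' Y'| <= e * (nrm mu X + nrm mu Y + 1).
Proof.
move=> XL XL' YL YL' Xe Ye e1.
have -> : ip mu X Y - ip mu X' Y' = ip mu (X - X') Y + ip mu X' (Y - Y').
  by rewrite ipBl// ipBr//; ring.
have e0 : 0 <= e := le_trans (nrm_ge0 _ _) (ltW Xe).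
have X'1 : nrm mu X' <= nrm mu X + e.
  rewrite -[X'](subrK X) (le_trans (nrmD _ _)) ?L2B// addrC lerD2l.
  by rewrite nrmBC ltW.
have h1 := cauchy_schwarz (L2B XL XL') YL.
have h2 := cauchy_schwarz XL' (L2B YL YL').
rewrite (le_trans (ler_normD _ _))//.
have h3 : nrm mu (X - X') * nrm mu Y <= e * nrm mu Y by rewrite ler_wpM2r ?nrm_ge0// ltW.
have h4 : nrm mu X' * nrm mu (Y - Y') <= (nrm mu X + e) * e.
  by rewrite ler_pM ?nrm_ge0// ltW.
have h5 : e * e <= e by rewrite ler_piMr.
lra.
Qed.

End ip_approx.

(** * Characterization, isometry and uniqueness of Wiener integrals *)

Section wiener_integral.
Context d (T : measurableType d) (R : realType).
Variable P : probability T R.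
Variable B : R -> T -> R.
Hypothesis hB : brownian_cov P B.
Local Notation leb := (@lebesgue_measure R).
Implicit Types (t : R) (f g : R -> R) (X Y : T -> R).
Local Notation U := (@unit_step R).
Let hU := @brownian_cov_unit_step R.

(** The intervals ]a_i, b_i] lie inside ]0,t], so restricting to [0,t] does not alter the step
    function. *)
Lemma step_incrE t m (c a b : 'I_m -> R) f : admissible t a b ->
  (fun x => (f x - \sum_i c i * \1_(`]a i, b i]) x)%R) \_ `[0%R, t] =
  res t f - incr U c a b.
Proof.
move=> ab; apply/funext => x; rewrite -/(res t _) resE.
rewrite -[RHS]/(res t f x - incr U c a b x) resE /incr fct_sumE.
have E i : c i * \1_(`]a i, b i]) x = (c i *: (U (b i) - U (a i))) x.
  rewrite -[RHS]/(c i * (U (b i) x - U (a i) x)); congr (_ * _).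
  have [/andP[a0 aibi] bt] := ab i.
  rewrite !unit_stepE indicE mem_setE in_itv/=.
  case: (ltP (a i) x) => ax /=.
    by rewrite (le_lt_trans a0 ax)/= subr0.
  by rewrite (le_trans ax aibi) andbT subrr.
rewrite (eq_bigr _ (fun i _ => E i)); case: ifPn => // xt.
rewrite big1 ?subr0// => i _; rewrite -E indicE mem_setE in_itv/=.
have [/andP[ax xb]|_] := boolP (a i < x <= b i); last by rewrite mulr0.
have [/andP[a0 aibi] bt] := ab i.
by move: xt; rewrite (ltW (le_lt_trans a0 ax)) (le_trans xb bt).
Qed.

Lemma is_wiener_intP t f X : is_wiener_int P B t f X <->
  [/\ res t f \in Lfun leb 2%:E, X \in Lfun P 2%:E
    & forall e, 0 < e -> exists (m : nat) (c a b : 'I_m -> R),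
      [/\ admissible t a b, nrm leb (res t f - incr U c a b) < e
        & nrm P (X - incr B c a b) < e]].
Proof.
have E m (c a b : 'I_m -> R) :
    (fun w => (X w - \sum_i c i * (B (b i) w - B (a i) w))%R) = X - incr B c a b.
  by apply/funext => w; rewrite -[RHS]/(X w - incr B c a b w) /incr fct_sumE.
split=> [[fL XL H]|[fL XL H]]; split => // e e0; have [m [c [a [b [ab H1 H2]]]]] := H _ e0;
  exists m, c, a, b.
  move: H1 H2; rewrite step_incrE// E => H1 H2; split => //.
    by rewrite -L2norm_nrm// L2B//; exact: (L2_incr hU c ab).
  by rewrite -L2norm_nrm// L2B//; exact: (L2_incr hB c ab).
rewrite step_incrE// E; split => //.
  by rewrite L2norm_nrm// L2B//; exact: (L2_incr hU c ab).
by rewrite L2norm_nrm// L2B//; exact: (L2_incr hB c ab).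
Qed.

(* The distance from [X] to an elementary integral of [B] is computed by
   [ip P X (B u)], and is at most the distance from [f] to the step function. *)
Lemma is_wiener_int_char t f X : 0 <= t -> res t f \in Lfun leb 2%:E ->
  X \in Lfun P 2%:E ->
  (forall u, 0 <= u -> u <= t -> ip P X (B u) = \int[leb]_(v in `[0, u]) f v) ->
  ip P X X <= ip leb (res t f) (res t f) -> is_wiener_int P B t f X.
Proof.
move=> t0 fL XL XB XX; apply/is_wiener_intP; split => // e e0.
have [_ /(_ _ e0)[m [c [s [st H]]]]] := step_functions_dense t0 fL.
have ab : admissible t (fun=> 0 : R) s by move=> i; have /andP[-> ->] := st i; rewrite lexx.
exists m, c, (fun=> 0), s.
(* Since [U 0] vanishes, a combination of the [U (s i)] is one of increments starting at 0. For [B]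
   the increment from 0 is kept, as [B 0] vanishes only almost surely. *)
have U0 : U 0 = 0 by apply/funext => x; rewrite unit_stepE; case: ltP => // x0; rewrite leNgt x0.
have H' : nrm leb (res t f - incr U c (fun=> 0) s) < e.
  by rewrite /incr; under eq_bigr do rewrite U0 subr0.
split => //; apply: le_lt_trans H'.
have VL := L2_incr hB c ab; have SL := L2_incr hU c ab.
rewrite -(@ler_pXn2r _ 2)// ?nnegrE ?nrm_ge0// !nrmB_sqr//.
rewrite (ip_incr hB c c ab ab) (ip_incr hU c c ab ab) lerD2r.
suff -> : ip P X (incr B c (fun=> 0) s) = ip leb (res t f) (incr U c (fun=> 0) s).
  by rewrite lerD2r.
have BL i : B (s i) - B 0 \in Lfun P 2%:E.
  by have /andP[*] := st i; rewrite L2B ?(brownian_L2 hB).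
have UL i : U (s i) - U 0 \in Lfun leb 2%:E.
  by have /andP[s0 _] := st i; apply: L2B; apply: (brownian_L2 hU).
rewrite !ip_sumr// => [|i|i]; rewrite ?L2Z//.
apply: eq_bigr => i _; have /andP[s0 si] := st i.
rewrite !ipZr//; congr (_ * _).
by rewrite !ipBr ?(brownian_L2 hB) ?(brownian_L2 hU)// !XB// !ip_res_unit_step.
Qed.

(** Both inner products are approximated by those of the same step functions, which agree by
    [ip_incr]. The two horizons may differ because each restriction is extended by 0. *)
Lemma wiener_isometry s t f g X Y : is_wiener_int P B s f X ->
  is_wiener_int P B t g Y -> ip P X Y = ip leb (res s f) (res t g).
Proof.
move=> /is_wiener_intP[fL XL HX] /is_wiener_intP[gL YL HY].
apply/eqP; rewrite -subr_eq0; apply/eqP.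
apply: (@small_eq0 _ _ ((nrm P X + nrm P Y + 1) +
  (nrm leb (res s f) + nrm leb (res t g) + 1))) => e e0.
pose e' := Num.min e 1.
have e'0 : 0 < e' by rewrite lt_min e0 ltr01.
have e'1 : e' <= 1 by rewrite ge_min lexx orbT.
have e'e : e' <= e by rewrite ge_min lexx.
have [m [c [a [b [ab H1 H2]]]]] := HX _ e'0.
have [m' [c' [a' [b' [ab' H1' H2']]]]] := HY _ e'0.
have K1 := ip_approx XL (L2_incr hB c ab) YL (L2_incr hB c' ab') H2 H2' e'1.
have K2 := ip_approx fL (L2_incr hU c ab) gL (L2_incr hU c' ab') H1 H1' e'1.
have E : ip P (incr B c a b) (incr B c' a' b') = ip leb (incr U c a b) (incr U c' a' b').
  by rewrite (ip_incr hB c c' ab ab') (ip_incr hU c c' ab ab').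
rewrite E in K1.
rewrite -(subrKA (ip leb (incr U c a b) (incr U c' a' b'))).
rewrite (le_trans (ler_normD _ _))// mulrDr lerD//.
  by rewrite (le_trans K1)// ler_wpM2r// !addr_ge0 ?nrm_ge0.
by rewrite distrC (le_trans K2)// ler_wpM2r// !addr_ge0 ?nrm_ge0.
Qed.

Lemma is_wiener_int_unique t f X Y : is_wiener_int P B t f X ->
  is_wiener_int P B t f Y -> {ae P, forall w, X w = Y w}.
Proof.
move=> HX HY; have [_ XL _] := HX; have [_ YL _] := HY.
have : ip P (X - Y) (X - Y) = 0.
  rewrite ipBl ?L2B// !ipBr//.
  by rewrite !(wiener_isometry HX HX) !(wiener_isometry HX HY)
     !(wiener_isometry HY HX) !(wiener_isometry HY HY) !subrr.
move=> /(ip_self0 (L2B XL YL)); apply: filterS => w /eqP.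
by rewrite subr_eq0 => /eqP.
Qed.

Lemma wiener_intP t f X : is_wiener_int P B t f X ->
  is_wiener_int P B t f (wiener_int P B t f).
Proof. by move=> HX; rewrite /wiener_int; apply: xgetPex; exists X. Qed.

Lemma wiener_int_ae t f X : is_wiener_int P B t f X ->
  {ae P, forall w, X w = wiener_int P B t f w}.
Proof. by move=> HX; apply: is_wiener_int_unique HX (wiener_intP HX). Qed.

Lemma is_wiener_int_ae t f X Y : is_wiener_int P B t f X -> Y \in Lfun P 2%:E ->
  {ae P, forall w, Y w = X w} -> is_wiener_int P B t f Y.
Proof.
move=> /is_wiener_intP[fL XL HX] YL YX; apply/is_wiener_intP; split => // e e0.
have [m [c [a [b [ab H1 H2]]]]] := HX _ e0; exists m, c, a, b; split => //.
have VL := L2_incr hB c ab.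
suff -> : nrm P (Y - incr B c a b) = nrm P (X - incr B c a b) by [].
have E : {ae P, forall w, (Y - incr B c a b) w = (X - incr B c a b) w}.
  by apply: filterS YX => w Yw; rewrite -[LHS]/(Y w - incr B c a b w) Yw.
rewrite /nrm (ip_ae _ _ _ E) ?L2B// ipC (ip_ae _ _ _ E) ?L2B//.
Qed.

Lemma clspan_wiener_int t f X : 0 <= t -> is_wiener_int P B t f X -> clspan P B t X.
Proof.
move=> t0 /is_wiener_intP[fL XL HX]; apply: clspan_closed => //.
  by move=> s s0 _; exact: (brownian_L2 hB).
move=> e e0; have [m [c [a [b [ab H1 H2]]]]] := HX _ e0.
by exists (incr B c a b) => //; exact: clspan_incr.
Qed.

End wiener_integral.

Lemma HspaceE d (T : measurableType d) (R : realType) (P : probability T R)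
  (X : R -> T -> R) (t : R) : (forall s, 0 <= s -> s <= t -> X s \in Lfun P 2%:E) ->
  Hspace P X t = clspan P X t.
Proof.
move=> XL; apply/seteqP; split=> Y [YL H]; split => // e e0;
  have [m [c [s [st H']]]] := H _ e0; exists m, c, s; split => //; move: H';
  (have -> : (fun w => (Y w - \sum_i c i * X (s i) w)%R) = Y - \sum_i c i *: X (s i)
    by apply/funext => w; rewrite -[RHS]/(Y w - (\sum_i c i *: X (s i)) w) fct_sumE);
  by rewrite L2norm_nrm//; apply: L2B => //; exact: (L2_lin XL c st).
Qed.

(** * The kernel k and its Gram matrix *)

Section kernel.
Context (R : realType) (n : nat) (lam : 'I_n -> R).
Hypothesis lam_inj : injective lam.
Hypothesis lam_gt : forall j, - (1 / 2) < lam j.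
Local Notation leb := (@lebesgue_measure R).
Local Notation a := (a_coef lam).
Local Notation S := (Ssum lam).
Implicit Types (s r t u v : R) (i j : 'I_n).

Definition pw j : R -> R := fun v => v `^ lam j.

(** The kernel expanded in monomials, without the cut-off at v = s. This form also gives E[Y_s Y_r]
    for s <= r, as [kpow r s]. *)
Definition kpow s v := \sum_j a j * s `^ (- (lam j + 1)) * v `^ lam j.

Lemma powR_split s j : 0 < s -> s `^ (- (lam j + 1)) = s^-1 * (s `^ lam j)^-1.
Proof.
move=> s0; rewrite powRN powRD ?(gt_eqF s0) ?implybT// powRr1 ?ltW//.
by rewrite invfM mulrC.
Qed.

Lemma k_kerE s v : 0 < s -> 0 <= v -> v <= s -> k_ker lam s v = kpow s v.
Proof.
move=> s0 v0 vs; rewrite /k_ker vs /K_fun mulr_sumr; apply: eq_bigr => j _.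
have -> : (v / s) `^ lam j = v `^ lam j * (s `^ lam j)^-1.
  have s1 : 0 <= s^-1 by rewrite invr_ge0 ltW.
  by rewrite powRM//; congr (_ * _); rewrite -powR_inv1 ?ltW// -powRrM mulN1r powRN.
by rewrite powR_split//; ring.
Qed.

Lemma res_kE s : 0 < s -> res s (k_ker lam s) =
  \sum_j (a j * s `^ (- (lam j + 1))) *: res s (pw j).
Proof.
move=> s0; apply/funext => v; rewrite fct_sumE resE; case: ifPn => [/andP[v0 vs]|vs].
  rewrite k_kerE//; apply: eq_bigr => j _.
  by rewrite -[RHS]/(_ * res s (pw j) v) resE v0 vs.
rewrite big1// => j _.
by rewrite -[LHS]/(_ * res s (pw j) v) resE (negbTE vs) mulr0.
Qed.

Lemma L2_pw t j : 0 <= t -> res t (pw j) \in Lfun leb 2%:E.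
Proof. by move=> t0; exact: L2_res_powR. Qed.

Lemma L2_k s : 0 < s -> res s (k_ker lam s) \in Lfun leb 2%:E.
Proof.
by move=> s0; rewrite res_kE//; apply: L2_sum => j; rewrite L2Z ?L2_pw ?ltW.
Qed.

Lemma ip_res_le s t (f g : R -> R) : s <= t ->
  ip leb (res s f) (res t g) = ip leb (res s f) (res s g).
Proof.
move=> st; apply: eq_Rintegral => x _; rewrite !resE.
case: ifPn => [/andP[x0 xs]|_]; last by rewrite !mul0r.
by rewrite x0 (le_trans xs st).
Qed.

Lemma ip_pw s t i j : 0 <= s -> s <= t ->
  ip leb (res s (pw i)) (res t (pw j)) = s `^ (lam i + lam j + 1) * cm lam i j.
Proof. by move=> s0 st; rewrite ip_res_le// ip_res_powR. Qed.

Lemma ip_res_step s u (f : R -> R) : res s f \in Lfun leb 2%:E ->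
  ip leb (res s f) (unit_step u) = \int[leb]_(x in `[0, Num.min s u]) f x.
Proof.
move=> fL; have [us|su] := leP u s; first by rewrite ip_res_unit_step.
rewrite -(ip_res_unit_step fL (lexx _)); apply: eq_Rintegral => x _.
rewrite resE !unit_stepE; case: ifPn => [/andP[x0 xs]|_]; last by rewrite !mul0r.
by rewrite xs (le_trans xs (ltW su)).
Qed.

Lemma ip_pw_step s u j : 0 <= s -> 0 <= u ->
  ip leb (res s (pw j)) (unit_step u) = Num.min s u `^ (lam j + 1) / (lam j + 1).
Proof.
move=> s0 u0; rewrite ip_res_step ?L2_pw// Rintegral_powR// ?le_min ?s0//.
by have := lam_gt j; lra.
Qed.

(* [kb s u] is the integral of [k(s,.)] over [[0, min s u]], that is E[Y_s B_u]. *)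
Definition kb s u := \sum_j a j * s `^ (- (lam j + 1)) *
  (Num.min s u `^ (lam j + 1) / (lam j + 1)).

Lemma ip_k_step s u : 0 < s -> 0 <= u ->
  ip leb (res s (k_ker lam s)) (unit_step u) = kb s u.
Proof.
move=> s0 u0; rewrite res_kE// ip_suml ?L2_unit_step//; last first.
  by move=> j; rewrite L2Z ?L2_pw ?ltW.
by apply: eq_bigr => j _; rewrite ipZl ?L2_pw ?L2_unit_step ?ip_pw_step// ltW.
Qed.

Lemma ip_pw_k t s j : 0 < s -> s <= t ->
  ip leb (res t (pw j)) (res s (k_ker lam s)) = s `^ lam j.
Proof.
move=> s0 st; have t0 := lt_le_trans s0 st; rewrite ipC res_kE// ip_suml ?L2_pw ?ltW//; last first.
  by move=> i; rewrite L2Z ?L2_pw ?ltW.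
rewrite -[RHS]mul1r -[X in _ = X * _](cm_sum lam_inj lam_gt j) mulr_suml; apply: eq_bigr => i _.
rewrite ipZl ?L2_pw ?(ltW s0) ?(ltW t0)// (ip_pw i j (ltW s0) st) cmC.
transitivity (a i * (s `^ (- (lam i + 1)) * s `^ (lam i + lam j + 1)) * cm lam j i).
  by rewrite !mulrA.
rewrite -powRD ?(gt_eqF s0) ?implybT// mulrAC; congr (_ * _ `^ _).
ring.
Qed.

(** Expand only k(r,.) in monomials and integrate each against k(s,.) by [ip_pw_k]: the power
    v^lam_j is reproduced at v = s. *)
Lemma ip_k_k s r : 0 < s -> s <= r ->
  ip leb (res s (k_ker lam s)) (res r (k_ker lam r)) = kpow r s.
Proof.
move=> s0 sr; have r0 := lt_le_trans s0 sr; rewrite ipC [in LHS](res_kE r0) ip_suml ?L2_k//.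
  by apply: eq_bigr => j _; rewrite ipZl ?L2_pw ?L2_k ?ip_pw_k// ltW.
by move=> j; rewrite L2Z ?L2_pw// ltW.
Qed.

(** The exponent has the shape [a * 2] expected by the moment bound on integrated processes, with a
    = -1/2. *)
Lemma kpow_diag s : 0 < s -> kpow s s = (\sum_j a j) * s `^ (- (1 / 2) * 2).
Proof.
move=> s0; rewrite mulr_suml; apply: eq_bigr => j _.
rewrite -mulrA -powRD ?(gt_eqF s0) ?implybT//; congr (_ * _ `^ _); lra.
Qed.

(** Homogeneity of degree -1: the integral of k(s,.) over [0,s] does not depend on s. *)
Lemma kb_le s u : 0 < s -> s <= u -> kb s u = S.
Proof.
move=> s0 su; apply: eq_bigr => j _; rewrite min_l//.
transitivity (a j * (s `^ (- (lam j + 1)) * s `^ (lam j + 1)) / (lam j + 1)).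
  by rewrite !mulrA.
by rewrite -powRD ?(gt_eqF s0) ?implybT// addNr powRr0 mulr1.
Qed.

Lemma kb_integral r t : 0 < r -> 0 <= t -> t <= r ->
  \int[leb]_(s in `[0, t]) kpow r s = kb r t.
Proof.
move=> r0 t0 tr; rewrite -ip_k_step// ip_res_step ?L2_k// min_r//; apply: eq_Rintegral => s.
rewrite inE/= in_itv/= => /andP[s0 st].
by rewrite k_kerE// (le_trans st tr).
Qed.

End kernel.

Section integral_from_zero.
Context (R : realType).
Local Notation leb := (@lebesgue_measure R).
Implicit Types (f g : R -> R) (t : R).

(** Identities known only for s > 0 can be used under an integral over [0,t], integrability
    included. *)
Lemma eq_Rintegral0 t f g : leb.-integrable `[0, t] (EFin \o f) ->
  (forall s, 0 < s -> s <= t -> f s = g s) ->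
  leb.-integrable `[0, t] (EFin \o g) /\
  \int[leb]_(s in `[0, t]) f s = \int[leb]_(s in `[0, t]) g s.
Proof.
move=> fi fg; have mf := measurable_int _ fi.
have fgo : {in `]0, t]%classic, EFin \o f =1 EFin \o g}.
  by move=> s; rewrite inE/= in_itv/= => /andP[s0 st]; rewrite fg.
have mfo := (emeasurable_fun_itv_obnd_cbndP _ _ _).2 mf.
have mgo : measurable_fun `]0, t] (EFin \o g) by exact: eq_measurable_fun mfo.
have mg := (emeasurable_fun_itv_obnd_cbndP _ _ _).1 mgo.
have E : forall h : \bar R -> \bar R, measurable_fun setT h ->
    (\int[leb]_(s in `[0%R, t]) h (f s)%:E = \int[leb]_(s in `[0%R, t]) h (g s)%:E)%E.
  move=> h mh; rewrite -!integral_itv_obnd_cbnd.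
  - by apply: eq_integral => s st; rewrite -[(f s)%:E]/((EFin \o f) s) fgo.
  - exact: measurableT_comp mh mgo.
  - exact: measurableT_comp mh mfo.
split; last first.
  by congr fine; exact: (E id).
apply/integrableP; split => //.
have /integrableP[_] := fi; rewrite /= -(E abse)//.
Qed.

Lemma integrable_itvB f g t : leb.-integrable `[0, t] (EFin \o f) ->
  leb.-integrable `[0, t] (EFin \o g) ->
  leb.-integrable `[0, t] (EFin \o (fun s => f s - g s)).
Proof.
have mt : measurable (`[0, t]%classic : set (measurableTypeR R)) by exact: measurable_itv.
by move=> fi gi; exact: (integrableB mt fi gi).
Qed.

End integral_from_zero.

(** * The pair (B, Y) described by its covariances *)

Section model.
Context d (T : measurableType d) (R : realType).
Variable mu : {sigma_finite_measure set T -> \bar R}.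
Context (n : nat) (lam : 'I_n -> R).
Hypothesis lam_inj : injective lam.
Hypothesis lam_gt : forall j, - (1 / 2) < lam j.
Local Notation leb := (@lebesgue_measure R).
Local Notation L2 := (Lfun mu 2%:E).
Local Notation S := (Ssum lam).

(* Shared by the pair (B, Y) in L^2(P) and by the pair (1_]0,u], k(s,.)) in
   L^2(R_+), from which the isometry identities are read off. *)
Record model (b y : R -> T -> R) : Prop := Model {
  model_b : brownian_cov mu b;
  model_y : forall s, 0 < s -> y s \in L2;
  model_yb : forall s u, 0 < s -> 0 <= u -> ip mu (y s) (b u) = kb lam s u;
  model_yy : forall s r, 0 < s -> s <= r -> ip mu (y s) (y r) = kpow lam r s;
  model_m : measurable_fun [set: R * T] (fun p : R * T => y p.1 p.2) }.

Variables b y : R -> T -> R.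
Hypothesis hM : model b y.

Definition xproc t w := \int[leb]_(s in `[0, t]) y s w.
Definition zproc t : T -> R := b t - xproc t.

Let yL t s : 0 < s -> s <= t -> y s \in L2.
Proof. by move=> s0 _; exact: (model_y hM). Qed.

Let yC t s : 0 < s -> s <= t ->
  ip mu (y s) (y s) <= (\sum_j a_coef lam j) * s `^ (- (1 / 2) * 2).
Proof. by move=> s0 _; rewrite (model_yy hM)// kpow_diag. Qed.

Let a1 : -1 < - (1 / 2) :> R. Proof. lra. Qed.

Lemma L2_xproc t : 0 <= t -> xproc t \in L2.
Proof. by move=> t0; exact: (L2_integral_process (model_m hM) t0 a1 (@yL t) (@yC t)). Qed.

Lemma integrable_xproc t : 0 <= t ->
  {ae mu, forall w, leb.-integrable `[0, t] (EFin \o y ^~ w)}.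
Proof. by move=> t0; exact: (integrable_process (model_m hM) t0 a1 (@yL t) (@yC t)). Qed.

Lemma ip_xproc t W (f : R -> R) : 0 <= t -> W \in L2 ->
  (forall s, 0 < s -> s <= t -> ip mu (y s) W = f s) ->
  leb.-integrable `[0, t] (EFin \o f) /\
  ip mu (xproc t) W = \int[leb]_(s in `[0, t]) f s.
Proof.
move=> t0 WL yW.
have [i ->] := ip_integral_process (model_m hM) t0 a1 (@yL t) (@yC t) WL.
exact: eq_Rintegral0.
Qed.

Let bL t : 0 <= t -> b t \in L2. Proof. exact: (brownian_L2 (model_b hM)). Qed.

Lemma L2_zproc t : 0 <= t -> zproc t \in L2.
Proof. by move=> t0; rewrite L2B ?bL ?L2_xproc. Qed.

Lemma ip_xb t u : 0 <= t -> 0 <= u ->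
  leb.-integrable `[0, t] (EFin \o kb lam ^~ u) /\
  ip mu (xproc t) (b u) = \int[leb]_(s in `[0, t]) kb lam s u.
Proof. by move=> t0 u0; apply: ip_xproc => // [|s s0 _]; rewrite ?bL// (model_yb hM). Qed.

Lemma ip_xb_ge t u : 0 <= t -> t <= u -> ip mu (xproc t) (b u) = t * S.
Proof.
move=> t0 tu; have u0 := le_trans t0 tu.
have [_ ->] := ip_xproc (f := cst S) t0 (bL u0) (fun s s0 st =>
  etrans (model_yb hM s0 u0) (kb_le lam s0 (le_trans st tu))).
rewrite Rintegral_cst//= lebesgue_measure_itv/= lte_fin mulrC.
by case: ltP => [_|t0']; rewrite ?oppr0 ?adde0//=; have -> : t = 0 by apply/le_anti/andP.
Qed.

(** For t <= r, [b t] and [xproc t] have the same inner product with [y r]: the first gives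
    [kb lam r t], the second the integral of k(r,.) over [0,t], which is equal to it. *)
Lemma ip_zy0 t r : 0 <= t -> t <= r -> 0 < r -> ip mu (zproc t) (y r) = 0.
Proof.
move=> t0 tr r0; rewrite ipBl ?bL ?L2_xproc ?(model_y hM)//.
have [_ ->] := ip_xproc (f := kpow lam r) t0 (model_y hM r0) (fun s s0 st =>
  model_yy hM s0 (le_trans st tr)).
by rewrite ipC (model_yb hM)// kb_integral// subrr.
Qed.

End model.

(** * Realization of the pair in L^2 of the line *)

Section lebesgue_model.
Context (R : realType) (n : nat) (lam : 'I_n -> R).
Hypothesis lam_inj : injective lam.
Hypothesis lam_gt : forall j, - (1 / 2) < lam j.
Local Notation leb := (@lebesgue_measure R).
Local Notation GR := (measurableTypeR R).
Local Notation S := (Ssum lam).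
Implicit Types (s r t u v q : R).

(** Written with [kpow] so that it is a finite sum of products of powers under a measurable cut-off,
    whence joint measurability in both variables. *)
Definition ker s : R -> R := res s (kpow lam s).

Lemma ker_k s : 0 < s -> ker s = res s (k_ker lam s).
Proof.
move=> s0; apply/funext => v; rewrite /ker !resE; case: ifPn => // /andP[v0 vs].
by rewrite k_kerE.
Qed.

Lemma measurable_ker : measurable_fun [set: R * GR] (fun p : R * GR => ker p.1 p.2).
Proof.
have m1 : measurable_fun [set: R * GR] (fun p : R * GR => p.1 : R) by exact: measurable_fst.
have m2 : measurable_fun [set: R * GR] (fun p : R * GR => p.2 : R) by exact: measurable_snd.
rewrite (_ : (fun p => _) = (fun p : R * GR =>
    if (0 <= p.2) && (p.2 <= p.1) then kpow lam p.1 p.2 else 0)); last first.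
  by apply/funext => p; rewrite /ker resE.
apply: measurable_fun_ifT => //.
  by apply: measurable_and; apply: measurable_fun_ler.
apply: measurable_sum => j; apply: measurable_funM; last first.
  exact: (measurableT_comp (@measurable_powR R _) m2).
apply: measurable_funM => //.
exact: (measurableT_comp (@measurable_powR R _) m1).
Qed.

Lemma lebesgue_model :
  @model _ GR R (@lebesgue_measure R) n lam (@unit_step R) ker.
Proof.
split.
- exact: brownian_cov_unit_step.
- by move=> s s0; rewrite ker_k//; exact: L2_k.
- by move=> s u s0 u0; rewrite ker_k// ip_k_step.
- by move=> s r s0 sr; rewrite !ker_k ?(lt_le_trans s0 sr)// ip_k_k.
- exact: measurable_ker.
Qed.

Definition xleb t v := \int[leb]_(s in `[0, t]) ker s v.

(** The inner product is k(q,r) for r < q and k(r,q) for r >= q. Integrating in r, the first part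
    gives S; the second is the integral of [ker r q], because [ker r] vanishes at q when r < q. *)
Lemma ker_ip_split s q : 0 < q -> q <= s ->
  \int[leb]_(r in `[0, s]) ip leb (ker r) (ker q) = S + xleb s q.
Proof.
move=> q0 qs; have s0 := le_trans (ltW q0) qs.
pose g := kpow lam q \_ `[0, q[.
have kqL : ker q \in Lfun leb 2%:E by rewrite ker_k//; exact: L2_k.
have ikq : leb.-integrable `[0, q] (EFin \o kpow lam q).
  have H r : 0 < r -> r <= q -> ip leb (ker r) (ker q) = kpow lam q r.
    by move=> r0 rq; exact: (model_yy lebesgue_model r0 rq).
  exact: (ip_xproc lebesgue_model (ltW q0) kqL H).1.
have ikqo : leb.-integrable `[0, q[ (EFin \o kpow lam q).
  by apply: integrableS ikq => //; apply: subset_itvl; rewrite bnd_simp.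
have qsE : `[0, s]%classic `&` `[0, q[%classic = `[0, q[%classic :> set R.
  apply/setIidr => x /=; rewrite !in_itv/= => /andP[-> xq].
  by rewrite (le_trans (ltW xq) qs).
have ig : leb.-integrable `[0, s] (EFin \o g).
  by rewrite /g -restrict_EFin; apply/integrable_restrict => //; rewrite qsE.
have [ikk _] := ip_xproc (f := fun r => ip leb (ker r) (ker q)) lebesgue_model s0 kqL
  (fun r (_ : 0 < r) (_ : r <= s) => erefl).
have gE : \int[leb]_(r in `[0, s]) g r = S.
  rewrite -Rintegral_mkcondr qsE Rintegral_itv_bndo_bndc//.
  by rewrite kb_integral ?(ltW q0)// kb_le.
rewrite -(subrK S (\int[leb]_(r in `[0, s]) _)) -{1}gE -RintegralB// addrC; congr (_ + _).
apply: (eq_Rintegral0 _ _).2 => [|r r0 rs]; first exact: integrable_itvB.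
rewrite /g patchE mem_setE in_itv/= (ltW r0)/= /ker.
have [rq|qr] := ltP r q.
  rewrite [RHS]resE (leNgt q r) rq andbF; apply/eqP; rewrite subr_eq0; apply/eqP.
  exact: (model_yy lebesgue_model r0 (ltW rq)).
rewrite subr0 [RHS]resE (ltW q0) qr ipC.
exact: (model_yy lebesgue_model q0 qr).
Qed.

Lemma ip_leb_unit_step (f : R -> R) u : f \in Lfun leb 2%:E ->
  ip leb f (unit_step u) = \int[leb]_(x in `[0, u]) f x.
Proof.
move=> fL; rewrite -Rintegral_obnd_cbnd; last by apply: measurable_funTS; exact: (L2_measurable fL).
rewrite Rintegral_mkcond; apply: eq_Rintegral => x _.
rewrite unit_stepE patchE mem_setE in_itv/=.
by case: (_ && _); rewrite ?mulr1 ?mulr0.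
Qed.

Lemma integrable_cst_itv (c u : R) : leb.-integrable `[0, u] (EFin \o cst c).
Proof.
apply: continuous_compact_integrable; first exact: segment_compact.
by apply: continuous_subspaceT => x; exact: cst_continuous.
Qed.

(** The integral is the inner product of the process [xleb] at time s with the indicator of
    ]0,s]. *)
Lemma xleb_total s : 0 <= s -> \int[leb]_(q in `[0, s]) xleb s q = s * S.
Proof.
move=> s0; rewrite -ip_leb_unit_step; last exact: (L2_xproc lebesgue_model s0).
exact: (ip_xb_ge lebesgue_model s0 (lexx _)).
Qed.

End lebesgue_model.

(** * The transform preserves the Brownian covariance *)

Section model_isometry.
Context d (T : measurableType d) (R : realType).
Variable mu : {sigma_finite_measure set T -> \bar R}.
Context (n : nat) (lam : 'I_n -> R).
Hypothesis lam_inj : injective lam.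
Hypothesis lam_gt : forall j, - (1 / 2) < lam j.
Local Notation leb := (@lebesgue_measure R).
Local Notation L2 := (Lfun mu 2%:E).
Local Notation S := (Ssum lam).
Variables b y : R -> T -> R.
Hypothesis hM : model mu lam b y.
Local Notation x := (xproc y).
Local Notation z := (zproc b y).

Let bL t : 0 <= t -> b t \in L2. Proof. exact: (brownian_L2 (model_b hM)). Qed.
Let xL t : 0 <= t -> x t \in L2. Proof. exact: (L2_xproc hM). Qed.
Let zL t : 0 <= t -> z t \in L2. Proof. exact: (L2_zproc hM). Qed.

(** Covariances of [y] are the same in every model, so they can be computed with explicit
    functions. *)
Lemma model_kk r q : 0 < r -> 0 < q ->
  ip mu (y r) (y q) = ip leb (ker lam r) (ker lam q).
Proof.
have hl := lebesgue_model lam_inj lam_gt.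
wlog rq : r q / r <= q.
  move=> H r0 q0; have [rq|/ltW qr] := leP r q; first exact: H.
  by rewrite (ipC mu (y r)) (ipC leb (ker lam r)); exact: H.
by move=> r0 q0; rewrite (model_yy hM)//; apply/esym; exact: (model_yy hl).
Qed.

(** The double integral of E[Y_r Y_q] is split by [ker_ip_split] into the parts r < q and r >= q;
    each contributes s S. *)
Lemma ip_xx s : 0 <= s -> ip mu (x s) (x s) = 2 * (s * S).
Proof.
move=> s0.
have H q : 0 < q -> q <= s -> ip mu (y q) (x s) = S + xleb lam s q.
  move=> q0 qs; rewrite ipC -(ker_ip_split lam_inj lam_gt q0 qs).
  apply: (ip_xproc hM s0 (model_y hM q0) _).2 => r r0 rs.
  exact: model_kk.
have [i ->] := ip_xproc hM s0 (xL s0) H.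
have ic := integrable_cst_itv S s.
rewrite RintegralD//.
  rewrite Rintegral_cst// xleb_total//= lebesgue_measure_itv/= lte_fin.
  case: ltP => [_|s0']; first by rewrite oppr0 adde0/=; ring.
  by have -> : s = 0 by [apply/le_anti/andP]; rewrite /=; ring.
have := integrable_itvB i ic; congr (integrable _ _ _); apply/funext => q /=.
by rewrite addrAC subrr add0r.
Qed.

Lemma ip_zz_le s t : 0 <= s -> s <= t -> ip mu (z s) (z t) = s.
Proof.
move=> s0 st; have t0 := le_trans s0 st.
(* By [ip_zy0] the times r >= s contribute nothing, so the integral defining [x t] may be stopped at
   s. *)
have E : ip mu (x t) (z s) = ip mu (x s) (z s).
  have [_ ->] := ip_xproc (f := fun r => ip mu (y r) (z s)) hM s0 (zL s0) (fun r _ _ => erefl).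
  have H r : 0 < r -> r <= t ->
      ip mu (y r) (z s) = ((fun r => ip mu (y r) (z s)) \_ `[0, s]) r.
    move=> r0 rt; rewrite patchE mem_setE in_itv/= (ltW r0)/=.
    by case: (leP r s) => // /ltW sr; rewrite ipC (ip_zy0 lam_gt hM).
  have [_ ->] := ip_xproc hM t0 (zL s0) H.
  rewrite -Rintegral_mkcondr; congr (Rintegral _ _ _).
  apply/setIidr => r /=; rewrite !in_itv/= => /andP[-> rs].
  exact: le_trans st.
have E1 : ip mu (z s) (z t) = ip mu (z s) (b t) - ip mu (z s) (x t).
  exact: (ipBr (bL t0) (xL t0) (zL s0)).
have E2 : ip mu (z s) (b t) = ip mu (b s) (b t) - ip mu (x s) (b t).
  exact: (ipBl (bL s0) (xL s0) (bL t0)).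
have E3 : ip mu (x s) (z s) = ip mu (x s) (b s) - ip mu (x s) (x s).
  exact: (ipBr (bL s0) (xL s0) (xL s0)).
have E4 : ip mu (z s) (x t) = ip mu (x t) (z s) by exact: ipC.
have E5 : ip mu (b s) (b t) = s := etrans ((model_b hM).2 s t s0 t0) (min_l st).
have E6 := ip_xb_ge hM s0 st; have E7 := ip_xb_ge hM s0 (lexx s); have E8 := ip_xx s0.
pose D (u v : R) := u - v.
(* The value is (s - sS) - (sS - 2sS) = s: the second moment of [x s] exactly compensates the cross
   terms. *)
have F : ip mu (z s) (z t) = D (D s (s * S)) (D (s * S) (2 * (s * S))) :=
  etrans E1 (congr2 D (etrans E2 (congr2 D E5 E6))
    (etrans E4 (etrans E (etrans E3 (congr2 D E7 E8))))).
by apply: (etrans F); rewrite /D; ring.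
Qed.

Lemma brownian_cov_zproc : brownian_cov mu z.
Proof.
split=> [//|s t s0 t0]; have [st|/ltW ts] := leP s t; first exact: ip_zz_le.
by transitivity (ip mu (z t) (z s)); [exact: ipC|exact: ip_zz_le].
Qed.

Lemma ip_zb t u : 0 <= t -> 0 <= u ->
  ip mu (z t) (b u) = Num.min t u - \int[leb]_(s in `[0, t]) kb lam s u.
Proof.
move=> t0 u0; rewrite -(ip_xb hM t0 u0).2 -(model_b hM).2//.
exact: (ipBl (bL t0) (xL t0) (bL u0)).
Qed.

End model_isometry.

Lemma Rintegral_sum d (T : measurableType d) (R : realType)
    (mu : {measure set T -> \bar R}) (D : set T) (m : nat) (f : 'I_m -> T -> R) :
  measurable D -> (forall i, mu.-integrable D (EFin \o f i)) ->
  \int[mu]_(x in D) (\sum_i f i x) = \sum_i \int[mu]_(x in D) f i x.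
Proof.
move=> mD fi; rewrite /Rintegral.
under eq_integral do rewrite -sumEFin.
rewrite integral_sum// (eq_bigr (fun i => (fine (\int[mu]_(x in D) (f i x)%:E)%E)%:E)).
  by rewrite sumEFin.
by move=> i _; rewrite fineK//; exact: (integrable_fin_num mD (fi i)).
Qed.

Lemma integrable_itvZ (R : realType) (i : interval R) (c : R) (f : R -> R) :
  (@lebesgue_measure R).-integrable [set` i] (EFin \o f) ->
  (@lebesgue_measure R).-integrable [set` i] (EFin \o (fun x => c * f x)).
Proof.
have mt : measurable ([set` i] : set (measurableTypeR R)) by exact: measurable_itv.
by move=> fi; exact: (integrableZl mt c fi).
Qed.

(** * The function rho *)

Section rho.
Context (R : realType) (n : nat) (lam : 'I_n -> R).
Hypothesis lam_inj : injective lam.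
Hypothesis lam_gt : forall j, - (1 / 2) < lam j.
Local Notation leb := (@lebesgue_measure R).
Local Notation a := (a_coef lam).
Implicit Types (s r t u v : R) (i j : 'I_n).

(** The integral of x^(-(l+1)) over [1,t]; the exponent l = 0 produces the logarithm. *)
Definition pprim l t : R := if l == 0 then ln t else (1 - t `^ (- l)) / l.

Lemma integral_pprim l u t : 0 < u -> u <= t ->
  leb.-integrable `[u, t] (EFin \o (fun y : R => y `^ (- (l + 1)))) /\
  \int[leb]_(x in `[u, t]) (x `^ (- (l + 1))) = u `^ (- l) * pprim l (t / u).
Proof.
move=> u0 ut; have t0 := lt_le_trans u0 ut; rewrite /pprim; case: eqVneq => [->|l0].
  have [i e] : leb.-integrable `[u, t] (EFin \o (fun y : R => y `^ (- (0 + 1)))) /\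
      (\int[leb]_(x in `[u, t]) (x `^ (- (0 + 1)))%:E = (ln t - ln u)%:E)%E.
    apply: FTC2_pos => // x x0; last exact: continuous_powR.
    by rewrite add0r powR_inv1 ?ltW//; exact: is_derive1_ln.
  split; first exact: i.
  by rewrite /Rintegral e/= oppr0 powRr0 mul1r ln_div// posrE.
have l1 : - (l + 1) != -1 by rewrite eqr_opp -subr_eq0 addrK.
have [i e] := integral_powR_pos l1 u0 ut; split; first exact: i.
rewrite /Rintegral e/= (_ : - (l + 1) + 1 = - l); last by ring.
have -> : (t / u) `^ (- l) = t `^ (- l) / u `^ (- l).
  have u1 : 0 <= u^-1 by rewrite invr_ge0 ltW.
  rewrite (powRM _ (ltW t0) u1); congr (_ * _).
  by rewrite -[in LHS](powR_inv1 (ltW u0)) -powRrM mulN1r powRN.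
have : u `^ (- l) != 0 by rewrite gt_eqF// powR_gt0.
by move=> h; field; rewrite l0 h.
Qed.

(** A closed form of rho on [1, +oo[, from which measurability is immediate. *)
Definition rho_closed x := 1 - \sum_j a j * pprim (lam j) x.

Lemma rho_closedE x : 1 <= x -> rho_fun lam x = rho_closed x.
Proof.
move=> x1; rewrite /rho_fun /rho_closed; congr (1 - _).
transitivity (\int[leb]_(r in `[1, x]) (\sum_j a j * r `^ (- (lam j + 1)))).
  apply: eq_Rintegral => r; rewrite inE/= in_itv/= => /andP[r1 _].
  have r0 : 0 < r by rewrite (lt_le_trans ltr01).
  rewrite /K_fun mulr_suml; apply: eq_bigr => j _; rewrite -mulrA; congr (_ * _).
  rewrite powR_split// -(powR_inv1 (ltW r0)) -powRrM mulN1r powRN (powR_inv1 (ltW r0)).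
  by rewrite mulrC.
have H j := integral_pprim (lam j) ltr01 x1.
rewrite Rintegral_sum//.
  apply: eq_bigr => j _; rewrite RintegralZl//; last exact: (H j).1.
  by rewrite (H j).2 powR1 mul1r divr1.
by move=> j; apply: integrable_itvZ; exact: (H j).1.
Qed.

Lemma xleb_pprim t v : 0 < v -> v <= t ->
  xleb lam t v = \sum_j a j * pprim (lam j) (t / v).
Proof.
move=> v0 vt; have H j := integral_pprim (lam j) v0 vt.
transitivity (\int[leb]_(s in `[v, t]) (\sum_j (a j * v `^ lam j) * s `^ (- (lam j + 1)))).
  rewrite /xleb.
  have E : `[0, t]%classic `&` `[v, t]%classic = `[v, t]%classic :> set R.
    by apply/setIidr => s /=; rewrite !in_itv/= => /andP[vs ->]; rewrite (le_trans (ltW v0)).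
  rewrite -[in RHS]E Rintegral_mkcondr; apply: eq_Rintegral => s.
  rewrite inE/= in_itv/= => /andP[s0 st]; rewrite /ker resE patchE mem_setE in_itv/=.
  rewrite (ltW v0) st andbT/=; case: ifP => // _.
  by apply: eq_bigr => j _; rewrite mulrAC.
rewrite Rintegral_sum//.
  apply: eq_bigr => j _; rewrite RintegralZl//; last exact: (H j).1.
  rewrite (H j).2 -mulrA (mulrA (_ `^ _)) -powRD ?(gt_eqF v0) ?implybT// addrN powRr0.
  by rewrite mul1r.
by move=> j; apply: integrable_itvZ; exact: (H j).1.
Qed.

(** The deterministic counterpart of Z_t under the Wiener isometry: the indicator of ]0,t] minus the
    integral of k(s,.) over s in [0,t]. *)
Definition zleb t : R -> R := zproc (@unit_step R) (ker lam) t.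

Lemma zleb_rho t v : 0 < v -> v <= t -> zleb t v = rho_fun lam (t / v).
Proof.
move=> v0 vt; rewrite rho_closedE; last by rewrite ler_pdivlMr// mul1r.
rewrite /rho_closed -xleb_pprim// -[LHS]/(unit_step t v - xleb lam t v).
by rewrite unit_stepE v0 vt.
Qed.

Lemma L2_zleb t : 0 <= t -> zleb t \in Lfun leb 2%:E.
Proof. by move=> t0; exact: (L2_zproc (lebesgue_model lam_inj lam_gt)). Qed.

(** No estimate of rho is needed: v -> rho(1/v) coincides on ]0,1] with [zleb 1], already known to
    be in L^2. *)
Lemma Mclass_rho : Mclass (rho_fun lam).
Proof.
split.
  apply: (eq_measurable_fun rho_closed).
    by move=> x; rewrite inE/= in_itv/= andbT => x1; rewrite rho_closedE.
  apply: measurable_funB => //; apply: measurable_sum => j; apply: measurable_funM => //.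
  rewrite /pprim; case: eqP => _; first by apply: measurable_funTS; exact: measurable_ln.
  apply: measurable_funM => //; apply: measurable_funB => //.
  by apply: measurable_funTS; exact: measurable_powR.
have [mz zy] := (L2P _ _).1 (L2_zleb ler01).
have mz2 : measurable_fun setT (fun v => (zleb 1 v ^+ 2)%:E).
  exact/measurable_EFinP/measurable_funX.
apply: le_lt_trans zy.
have -> : (\int[leb]_(v in `]0%R, 1%R]) ((rho_fun lam v^-1) ^+ 2)%:E =
    \int[leb]_(v in `]0%R, 1%R]) (zleb 1 v ^+ 2)%:E)%E.
  apply: eq_integral => v; rewrite inE/= in_itv/= => /andP[v0 v1].
  by rewrite zleb_rho// div1r.
by apply: ge0_subset_integral => // v _; rewrite lee_fin sqr_ge0.
Qed.

Lemma res_rho t : 0 < t ->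
  res t (fun v => rho_fun lam (t / v)) \in Lfun leb 2%:E /\
  {ae leb, forall v, res t (fun v => rho_fun lam (t / v)) v = zleb t v}.
Proof.
move=> t0; have E : {ae leb, forall v, res t (fun v => rho_fun lam (t / v)) v = zleb t v}.
  (* At v = 0 the quotient t/v takes its default value 0, so the identity may fail at this one
     point. *)
  exists [set 0]; split => //; first by rewrite lebesgue_measure_set1.
  move=> v /= H; apply: contrapT => /eqP v0; apply: H.
  rewrite resE; case: ifPn => [/andP[v0' vt]|nvt].
    by rewrite zleb_rho// lt_neqAle eq_sym v0.
  rewrite -[RHS]/(unit_step t v - xleb lam t v) unit_stepE.
  rewrite (_ : (0 < v <= t) = false); last first.
    by apply: contraNF nvt => /andP[/ltW -> ->].
  rewrite /xleb sub0r (_ : Rintegral _ _ _ = 0) ?oppr0//.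
  rewrite -[RHS](mul0r (fine (leb `[0, t]))) -Rintegral_cst//; apply: eq_Rintegral => s.
  rewrite inE/= in_itv/= => /andP[s0 st]; rewrite /ker resE.
  by case: ifPn => // /andP[v0' vs]; move: nvt; rewrite v0' (le_trans vs st).
split => //; apply: L2_ae E; first exact: (L2_zleb (ltW t0)).
apply: measurable_res; apply/measurable_fun_itv_obnd_cbndP.
apply: (eq_measurable_fun (zleb t)).
  by move=> v; rewrite inE/= in_itv/= => /andP[v0 vt]; rewrite zleb_rho.
apply: measurable_funTS; exact: (L2_measurable (L2_zleb (ltW t0))).
Qed.

End rho.

(** * L^2-limits of centered Gaussian variables *)

Section laws_on_the_line.
Context (R : realType).
Local Notation GR := (measurableTypeR R).
Implicit Types (P Q : probability GR R) (x e : R).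

Definition half_line x : set GR := `]-oo, x]%classic.

Lemma half_lineE x y : half_line x y = (y <= x).
Proof. by rewrite /half_line/= in_itv. Qed.

Lemma measurable_half_line x : measurable (half_line x).
Proof. exact: measurable_itv. Qed.

(** Right continuity of the distribution function of [Q], along the shifts 1/(n+1). *)
Lemma cdf_le_shift P Q : (forall x e, 0 < e -> (P (half_line x) <= Q (half_line (x + e)))%E) ->
  forall x, (P (half_line x) <= Q (half_line x))%E.
Proof.
move=> PQ x; pose F n := half_line (x + n.+1%:R^-1).
have FE : \bigcap_n F n = half_line x.
  apply/seteqP; split=> y; rewrite half_lineE => H.
    apply/ler_addgt0Pr => e e0; have [n] := ltr_add_invr e0.
    rewrite add0r => ne; have := H n Logic.I; rewrite /F half_lineE => /le_trans; apply.
    by rewrite lerD2l ltW.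
  by move=> n _; rewrite /F half_lineE (le_trans H)// lerDl invr_ge0.
have H : Q (F n) @[n --> \oo] --> Q (\bigcap_n F n).
  apply: nonincreasing_cvg_mu => //.
  - by rewrite (le_lt_trans (probability_le1 _ _)) ?ltry//; exact: measurable_half_line.
  - by move=> n; exact: measurable_half_line.
  - by apply: bigcapT_measurable => n; exact: measurable_half_line.
  - apply/nonincreasing_seqP => n; rewrite subsetEset => y; rewrite /F !half_lineE.
    by move=> /le_trans; apply; rewrite lerD2l lef_pV2 ?posrE// ler_nat.
rewrite FE in H; apply: (cvge_to_ge H); apply: nearW => n.
by apply: PQ; rewrite invr_gt0.
Qed.

(** The intervals ]a,b] are stable under intersection and generate the Borel sets; their
    probabilities are differences of distribution functions. *)
Lemma prob_eq_cdf P Q : (forall x, P (half_line x) = Q (half_line x)) ->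
  forall A, measurable A -> P A = Q A.
Proof.
move=> PQ A mA.
have mE : @measurable _ GR = <<s @ocitv R >> by [].
apply: (@measure_unique _ _ GR (@ocitv R) (fun n => `](- n%:R), n%:R]%classic) mE (@ocitvI R)) => //.
- by move=> n; exact: is_ocitv.
- rewrite -subTset => x _; exists (Num.bound `|x|) => //=; rewrite in_itv/=.
  by have := archi_boundP (normr_ge0 x); rewrite ltr_norml => /andP[-> /ltW ->].
- move=> _ [[a b] _ <-] /=; have [ab|ba] := leP a b; last first.
    by rewrite set_itv_ge ?measure0// bnd_simp -leNgt ltW.
  have H (Q' : probability GR R) : Q' `]a, b]%classic = (Q' (half_line b) - Q' (half_line a))%E.
    rewrite -[half_line a](_ : half_line b `&` half_line a = _); last first.
      by apply/setIidr => x; rewrite !half_lineE => /le_trans; apply.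
    rewrite -measureD/=.
    + congr (Q' _); apply/seteqP; split=> x; rewrite /= in_itv/= !half_lineE.
        by move=> /andP[ax xb]; split=> //; apply/negP; rewrite -ltNge.
      by move=> [xb /negP]; rewrite -ltNge => -> /=.
    + exact: measurable_half_line.
    + exact: measurable_half_line.
    + by rewrite (le_lt_trans (probability_le1 _ _)) ?ltry//; exact: measurable_half_line.
  by rewrite !H !PQ.
- by move=> k; rewrite (le_lt_trans (probability_le1 _ _)) ?ltry//; exact: measurable_itv.
Qed.

(** Substitution by the affine map x -> (x - m)/s, whose derivative accounts for the ratio of the
    normalizing constants. *)
Lemma normal_cdf (m s b : R) : 0 < s ->
  normal_prob m s (half_line b) = normal_prob 0 1 (half_line ((b - m) / s)).
Proof.
move=> s0; rewrite /normal_prob; pose F (x : R) := (x - m) / s.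
have dF x : is_derive x 1 F s^-1.
  rewrite /F (_ : (fun x => _) = s^-1 *: (id - cst m)); last first.
    by apply/funext => y; rewrite mulrC.
  by apply: is_derive_eq; rewrite subr0 [LHS]mulr1.
have F'E : F^`()%classic = cst s^-1.
  by apply/funext => x; rewrite derive1E (@derive_val _ _ _ _ _ _ _ (dF x)).
rewrite -/(F b) (@increasing_ge0_integration_by_substitutionNy _ F (normal_pdf 0 1) b).
- apply: eq_integral => x _; rewrite F'E /= ; congr EFin.
  rewrite -[RHS]/(normal_pdf 0 1 (F x) * s^-1) /normal_pdf (gt_eqF s0) oner_eq0.
  have -> : normal_peak s = s^-1 * normal_peak 1 :> R.
    rewrite /normal_peak expr1n mul1r -mulrnAr sqrtrM ?sqr_ge0// sqrtr_sqr (gtr0_norm s0).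
    by rewrite invfM.
  rewrite mulrC mulrA mulrAC; congr (_ * _); rewrite [in LHS]mulrC; congr (_ * expR _).
  by rewrite /F subr0 expr1n; field; rewrite gt_eqF.
- by move=> x y _ _ xy; rewrite /F ltr_pM2r ?invr_gt0// ltrD2r.
- by move=> x _; rewrite F'E; exact: cvg_cst.
- by rewrite F'E; exact: is_cvg_cst.
- by rewrite F'E; exact: cvg_cst.
- split; first by move=> x _; exact: (@ex_derive _ _ _ _ _ _ _ (dF x)).
  apply: cvg_at_left_filter; apply: differentiable_continuous; apply/derivable1_diffP.
  exact: (@ex_derive _ _ _ _ _ _ _ (dF b)).
- apply: gt0_cvgMlNy; first by rewrite invr_gt0.
  exact: cvg_addrr_Ny.
- by apply: continuous_subspaceT => x; apply: continuous_normal_pdf; rewrite oner_neq0.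
- by move=> x _; exact: normal_pdf_ge0.
Qed.

End laws_on_the_line.

Section laws.
Context d (T : measurableType d) (R : realType) (P : probability T R).
Local Notation GR := (measurableTypeR R).
Local Notation L2 := (Lfun P 2%:E).
Implicit Types X Y : T -> R.

Definition rv X (mX : measurable_fun [set: T] X) : {mfun T >-> GR} :=
  HB.pack X (@isMeasurableFun.Build _ _ T GR X mX).

Definition law X (mX : measurable_fun [set: T] X) : probability GR R :=
  distribution P (rv mX).

Lemma lawE X (mX : measurable_fun [set: T] X) A : law mX A = P (X @^-1` A).
Proof. by []. Qed.

Lemma ip1E X : ip P X (cst 1) = \int[P]_w X w.
Proof. by apply: eq_Rintegral => w _; rewrite mulr1. Qed.

Lemma L2_cst1 : cst 1 \in L2. Proof. exact: Lfun_cst. Qed.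

Lemma law_moments X Y (mX : measurable_fun [set: T] X) (mY : measurable_fun [set: T] Y) :
  X \in L2 -> Y \in L2 ->
  (forall A : set GR, measurable A -> law mX A = law mY A) ->
  ip P X (cst 1) = ip P Y (cst 1) /\ ip P X X = ip P Y Y.
Proof.
move=> XL YL XY.
have m2 : measurable_fun [set: GR] (fun y : GR => (y ^+ 2)%:E).
  by apply/measurable_EFinP; apply: measurable_funX.
split.
  rewrite !ip1E; congr fine.
  have iE Z (mZ : measurable_fun [set: T] Z) : Z \in L2 ->
      (\int[P]_w (Z w)%:E = \int[law mZ]_y y%:E)%E.
    move=> ZL; rewrite (@integral_distribution _ _ T GR R P (rv mZ) EFin)//.
    have := ip_integrable ZL L2_cst1; apply: eq_integrable => // w _ /=.
    by rewrite mulr1.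
  rewrite (iE _ mX)// (iE _ mY)//.
  by apply: eq_measure_integral => A mA _; exact: XY.
apply: EFin_inj; rewrite -!sqr_integralE//.
rewrite -(@ge0_integral_distribution _ _ T GR R P (rv mX) (fun y => (y ^+ 2)%:E))//; last first.
  by move=> y; rewrite lee_fin sqr_ge0.
rewrite -(@ge0_integral_distribution _ _ T GR R P (rv mY) (fun y => (y ^+ 2)%:E))//; last first.
  by move=> y; rewrite lee_fin sqr_ge0.
by apply: eq_measure_integral => A mA _; exact: XY.
Qed.

(* The parameters of the normal law are recovered without computing its moments:
   after standardization both variables have the same law, hence the same moments. *)
Lemma gaussian_params X Y v m s m' s' : X \in L2 -> Y \in L2 ->
  ip P X (cst 1) = 0 -> ip P Y (cst 1) = 0 -> ip P X X = v -> ip P Y Y = v -> 0 < v ->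
  0 < s -> 0 < s' ->
  (forall A : set GR, measurable A -> P (X @^-1` A) = normal_prob m s A) ->
  (forall A : set GR, measurable A -> P (Y @^-1` A) = normal_prob m' s' A) ->
  m = m' /\ s = s'.
Proof.
move=> XL YL X1 Y1 XX YY v0 s0 s'0 lX lY.
have c1 := L2_cst1.
pose St (Z : T -> R) (m0 s0 : R) := s0^-1 *: (Z - m0 *: (cst 1 : T -> R)).
have StL Z m0 s1 : Z \in L2 -> St Z m0 s1 \in L2 by move=> ZL; rewrite L2Z ?L2B ?L2Z.
have ip11 : ip P (cst 1) (cst 1) = 1.
  transitivity (fine (P setT)); last by rewrite probability_setT.
  by rewrite ip1E (Rintegral_cst P measurableT 1) mul1r.
have St1 Z m0 s1 : Z \in L2 -> ip P Z (cst 1) = 0 -> ip P (St Z m0 s1) (cst 1) = - m0 / s1.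
  move=> ZL Z1; rewrite ipZl ?L2B ?L2Z// ipBl ?L2Z// ipZl// Z1 ip11.
  by rewrite mulr1 sub0r mulrC.
have St2 Z m0 s1 : Z \in L2 -> ip P Z (cst 1) = 0 -> ip P Z Z = v ->
    ip P (St Z m0 s1) (St Z m0 s1) = v / s1 ^+ 2 + (- m0 / s1) ^+ 2.
  move=> ZL Z1 ZZ; have d1 : Z - m0 *: (cst 1 : T -> R) \in L2 by rewrite L2B ?L2Z.
  rewrite ipZl ?StL// ipZr// ipBl ?L2Z// !ipBr ?L2Z// !ipZl ?L2Z// !ipZr// (ipC _ (cst 1)) Z1 ZZ ip11.
  by rewrite expr_div_n sqrrN -exprVn; ring.
have cdfSt Z m0 s1 (mZ : measurable_fun setT (St Z m0 s1)) : 0 < s1 ->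
    (forall A : set GR, measurable A -> P (Z @^-1` A) = normal_prob m0 s1 A) ->
    forall x, law mZ (half_line x) = normal_prob 0 1 (half_line x).
  move=> s10 lZ x; rewrite lawE.
  have -> : St Z m0 s1 @^-1` half_line x = Z @^-1` half_line (m0 + s1 * x).
    apply/funext => w; apply/propext; rewrite /preimage/= !half_lineE.
    have -> : St Z m0 s1 w = (Z w - m0) / s1.
      by rewrite -[LHS]/(s1^-1 * (Z w - m0 * 1)) mulr1 mulrC.
    by rewrite ler_pdivrMr// lerBlDl (mulrC x).
  rewrite lZ; last exact: measurable_half_line.
  rewrite normal_cdf//; congr (normal_prob _ _ (half_line _)).
  by rewrite addrAC subrr add0r mulrC mulKf// gt_eqF.
have mX := L2_measurable (StL _ m s XL); have mY := L2_measurable (StL _ m' s' YL).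
have lE : forall A : set GR, measurable A -> law mX A = law mY A.
  by apply: prob_eq_cdf => x; rewrite !cdfSt.
have [E1 E2] := @law_moments _ _ mX mY (StL _ _ _ XL) (StL _ _ _ YL) lE.
(* Equal means give m/s = m'/s'. The second moments v/s^2 + (m/s)^2 then leave v/s^2 = v/s'^2, and v
   > 0. *)
move: E1 E2; rewrite !St1// !St2// => E1; rewrite E1 => /addIr E2.
have ss : s = s'.
  apply/eqP; rewrite -(@eqrXn2 _ 2) ?ltW//; apply/eqP/invr_inj.
  exact: (mulfI (lt0r_neq0 v0)).
split => //; move: E1; rewrite ss => /(divIf (lt0r_neq0 s'0))/oppr_inj.
exact.
Qed.

Lemma dirac_rv X m : X \in L2 ->
  (forall A : set GR, measurable A -> P (X @^-1` A) = \d_m A) ->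
  {ae P, forall w, X w = m}.
Proof.
move=> XL lX; have mX := L2_measurable XL.
have m1 : measurable (~` [set m] : set GR) by exact: measurableC.
exists (X @^-1` (~` [set m])); split.
- by rewrite -[X in measurable X]setTI; exact: mX.
- by rewrite lX// /dirac indicE memNset//= => /(_ erefl).
- by move=> w /= Xm Xw; apply: Xm.
Qed.

(** The degenerate case is excluded: a centered Dirac mass sits at 0 and has zero second moment. *)
Lemma gaussian_law X : X \in L2 -> gaussian_rv P X -> ip P X (cst 1) = 0 -> 0 < ip P X X ->
  exists m s, 0 < s /\ (forall A : set GR, measurable A -> P (X @^-1` A) = normal_prob m s A).
Proof.
move=> XL [mX [m [s [s0 H]]]] X1 XX; exists m, s.
have [s00|sn0] := eqVneq s 0; last first.
  split; first by rewrite lt_neqAle eq_sym sn0.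
  by move=> A mA; rewrite H// (negbTE sn0).
have Xm : {ae P, forall w, X w = m}.
  by apply: dirac_rv => // A mA; rewrite H// s00 eqxx.
have cL : m *: (cst 1 : T -> R) \in L2 by rewrite L2Z ?L2_cst1.
have Xm' : {ae P, forall w, X w = (m *: (cst 1 : T -> R)) w}.
  by apply: filterS Xm => w ->; rewrite -[RHS]/(m * 1) mulr1.
have m0 : m = 0.
  rewrite -X1 (ip_ae cL XL L2_cst1 Xm') ipZl ?L2_cst1//.
  rewrite (_ : ip _ _ _ = 1) ?mulr1//.
  transitivity (fine (P setT)); last by rewrite probability_setT.
  by rewrite ip1E (Rintegral_cst P measurableT 1) mul1r.
by move: XX; rewrite (ip_ae cL XL XL Xm') m0 scale0r ip0l ltxx.
Qed.

Lemma gaussian_rv0 X : X \in L2 -> ip P X X = 0 -> gaussian_rv P X.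
Proof.
move=> XL X0; split; first exact: L2_measurable XL.
exists 0, 0; split => // A mA; rewrite eqxx.
have mX := L2_measurable XL.
have XA : measurable (X @^-1` A) by rewrite -[X in measurable X]setTI; exact: mX.
transitivity (\int[P]_w (\1_(X @^-1` A) w)%:E)%E.
  by rewrite integral_indic// setIT.
transitivity ((\1_A (0 : R))%:E * P setT)%E; last by rewrite probability_setT mule1.
rewrite -integral_cst//.
apply: ae_eq_integral => //.
  by apply/measurable_EFinP; exact: measurable_indic.
apply: filterS (ip_self0 XL X0) => w Xw _.
have E : (w \in X @^-1` A) = ((0 : R) \in A) by rewrite -Xw.
by rewrite /= !indicE E.
Qed.

Lemma chebyshev_L2 X (e : R) : X \in L2 -> 0 < e ->
  (P [set w | (e <= `|X w|)%R] <= (ip P X X / e ^+ 2)%:E)%E.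
Proof.
move=> XL e0; have mX := L2_measurable XL.
have mS : measurable [set w | e <= `|X w|].
  have -> : [set w | e <= `|X w|] = (fun w => `|X w|) @^-1` `[e, +oo[%classic.
    by apply/seteqP; split=> w /=; rewrite in_itv/= andbT.
  rewrite -[X in measurable X]setTI.
  have mn : measurable_fun setT (fun w => `|X w|) by exact: measurableT_comp.
  by apply: mn => //; exact: measurable_itv.
have -> : P [set w | (e <= `|X w|)%R] = (\int[P]_w (\1_[set w | (e <= `|X w|)%R] w)%:E)%E.
  by rewrite integral_indic// setIT.
have m2 : measurable_fun setT (fun w => ((X w) ^+ 2)%:E).
  by apply/measurable_EFinP; apply: measurable_funX.
rewrite mulrC EFinM -sqr_integralE// -ge0_integralZl//; last 2 first.
- by move=> w _; rewrite lee_fin sqr_ge0.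
- by rewrite lee_fin invr_ge0 sqr_ge0.
apply: ge0_le_integral => //.
- by apply/measurable_EFinP; exact: measurable_indic.
- exact: measurable_funeM.
- move=> w _; rewrite -EFinM lee_fin indicE; case: (boolP (w \in _)) => [/set_mem/= ew|_].
    rewrite mulrC ler_pdivlMr ?exprn_gt0// mul1r -(@real_normK _ (X w)) ?num_real//.
    by rewrite ler_pXn2r ?nnegrE ?(ltW e0).
  by rewrite mulr_ge0// ?invr_ge0 sqr_ge0.
Qed.

End laws.

(** * Gaussianity of closed spans *)

Section gaussian_limits.
Context d (T : measurableType d) (R : realType) (P : probability T R).
Local Notation GR := (measurableTypeR R).
Local Notation L2 := (Lfun P 2%:E).
Implicit Types X Y : T -> R.

(** The event X <= x is contained in the union of Y <= x + h and |X - Y| >= h; Chebyshev bounds the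
    latter. *)
Lemma cdf_close X Y (mX : measurable_fun [set: T] X) (mY : measurable_fun [set: T] Y)
  (x e h : R) : X \in L2 -> Y \in L2 -> 0 < h -> nrm P (X - Y) < e ->
  (law P mX (half_line x) <= law P mY (half_line (x + h)) + (e ^+ 2 / h ^+ 2)%:E)%E.
Proof.
move=> XL YL h0 e1; pose D := [set w | h <= `|(X - Y) w|].
have DL := L2B XL YL.
have mD : measurable D.
  have -> : D = (fun w => `|(X - Y) w|) @^-1` `[h, +oo[%classic.
    by apply/seteqP; split=> w /=; rewrite in_itv/= andbT.
  rewrite -[X in measurable X]setTI.
  have mn : measurable_fun setT (fun w => `|(X - Y) w|).
    by apply: measurableT_comp => //; exact: L2_measurable DL.
  by apply: mn => //; exact: measurable_itv.
have mH (Z : T -> R) (mZ : measurable_fun [set: T] Z) y : measurable (Z @^-1` half_line y).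
  by rewrite -[X in measurable X]setTI; apply: mZ => //; exact: measurable_half_line.
rewrite !lawE (@le_trans _ _ (P (Y @^-1` half_line (x + h) `|` D)))//.
  apply: le_measure; rewrite ?inE; [exact: mH|by apply: measurableU => //; exact: mH|].
  move=> w; rewrite /preimage/= !half_lineE => Xx.
  have [Yx|Yx] := leP (Y w) (x + h); [by left|right; rewrite /D/=].
  rewrite -[(X - Y) w]/(X w - Y w) -normrN; apply: le_trans (ler_norm _); lra.
rewrite (le_trans (measureU2 _ _ _))// ?leeD2l//; first exact: mH.
rewrite (le_trans (chebyshev_L2 DL h0))// lee_fin ler_wpM2r ?invr_ge0 ?sqr_ge0//.
by rewrite -sqr_nrm ler_pXn2r ?nnegrE ?nrm_ge0 ?ltW// (le_lt_trans (nrm_ge0 P (X-Y))).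
Qed.

Variable B : R -> T -> R.
Hypothesis hB : brownian_motion P B.
Variable t : R.

Hypothesis BL : forall s, 0 <= s -> B s \in L2.
Hypothesis B1 : forall s, 0 <= s -> ip P (B s) (cst 1) = 0.

(** The distribution function of [X] is squeezed, up to a shift h and a Chebyshev error, between
    those of approximants sharing one normal law. The error goes to 0 first, then h by right
    continuity. *)
Lemma gaussian_clspan X : clspan P B t X -> gaussian_rv P X.
Proof.
move=> HX; have XL := HX.1.
have BL' s : 0 <= s -> s <= t -> B s \in L2 by move=> s0 _; exact: BL.
have c1 := L2_cst1 P.
have X1 : ip P X (cst 1) = 0.
  by apply: (clspan_ip0 BL' HX c1) => s s0 _; exact: B1.
have [X0|X0] := eqVneq (ip P X X) 0; first exact: gaussian_rv0.
have v0 : 0 < ip P X X by rewrite lt_neqAle eq_sym X0 ip_ge0.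
have n0 : 0 < nrm P X by rewrite sqrtr_gt0.
(* The approximants are rescaled to the variance of [X], so that they all have the
   same law. *)
have H e : 0 < e -> e <= nrm P X -> exists Y, [/\ Y \in L2, nrm P (X - Y) < e,
    gaussian_rv P Y, ip P Y (cst 1) = 0 & ip P Y Y = ip P X X].
  move=> e0 eX; have e2 : 0 < e / 2 by rewrite divr_gt0.
  have [m [c [s [st Hs]]]] := HX.2 _ e2.
  pose Z := \sum_i c i *: B (s i); have ZL : Z \in L2 by exact: (L2_lin BL' c st).
  (* [Z] is within |X|/2 of [X], hence nonzero and fit for rescaling. *)
  have Z0 : 0 < nrm P Z.
    have h := nrmD (L2B XL ZL) ZL; rewrite subrK in h.
    by move: Hs; rewrite -/Z; lra.
  exists ((nrm P X / nrm P Z) *: Z); have YL : (nrm P X / nrm P Z) *: Z \in L2 by rewrite L2Z.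
  have YY : ip P ((nrm P X / nrm P Z) *: Z) ((nrm P X / nrm P Z) *: Z) = ip P X X.
    rewrite ipZl// ipZr// -(sqr_nrm _ Z) -(sqr_nrm _ X); field.
    by rewrite gt_eqF.
  split => //.
  - rewrite -(subrKA Z) (le_lt_trans (nrmD _ _)) ?L2B// [ltRHS]splitr ltr_leD//.
    rewrite -[X in X - _]scale1r -scalerBl nrmZ//.
    have nB : nrm P (Z - X) < e / 2 by rewrite nrmBC.
    have h1 := nrmD (L2B XL ZL) ZL; rewrite subrK in h1.
    have h2 := nrmD (L2B ZL XL) XL; rewrite subrK in h2.
    (* Rescaling moves [Z] by exactly the difference of the norms of [Z] and [X], which is below
       e/2. *)
    have -> : `|1 - nrm P X / nrm P Z| * nrm P Z = `|nrm P Z - nrm P X|.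
      rewrite -{2}(gtr0_norm Z0) -normrM mulrBl mul1r divfK// gt_eqF//.
    by rewrite ler_norml; move: Hs; rewrite -/Z; lra.
  - have [G _ _ _] := hB.
    have := G m (fun i => nrm P X / nrm P Z * c i) s (fun i => (andP (st i)).1).
    congr (gaussian_rv P _); apply/funext => w.
    rewrite -[RHS]/((nrm P X / nrm P Z) * Z w) /Z fct_sumE mulr_sumr.
    by apply: eq_bigr => i _; rewrite -mulrA.
  - rewrite ipZl// ip_suml//; last by move=> i; have /andP[*] := st i; rewrite L2Z ?BL.
    rewrite big1 ?mulr0// => i _; have /andP[*] := st i.
    by rewrite ipZl ?BL// B1// mulr0.
have [Y0 [Y0L _ gY0 Y01 Y0Y0]] := H _ n0 (lexx _).
have Y0v : 0 < ip P Y0 Y0 by rewrite Y0Y0.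
have [m [s [s0 law0]]] := gaussian_law Y0L gY0 Y01 Y0v.
split; first exact: L2_measurable XL.
exists m, s; split; first exact: ltW.
have mX := L2_measurable XL.
have eta_small (h x : R) : 0 < h -> 0 < x -> exists e, [/\ 0 < e, e <= nrm P X & e ^+ 2 / h ^+ 2 <= x].
  move=> h0 x0; exists (Num.min (nrm P X) (Num.sqrt x * h)).
  have sx : 0 < Num.sqrt x * h by rewrite mulr_gt0// sqrtr_gt0.
  split; [by rewrite lt_min n0|by rewrite ge_min lexx|].
  rewrite ler_pdivrMr ?exprn_gt0// -[leRHS](_ : (Num.sqrt x * h) ^+ 2 = _).
    rewrite ler_pXn2r ?nnegrE ?(ltW sx) ?le_min ?(ltW sx) ?nrm_ge0//.
    by rewrite ge_min lexx orbT.
  by rewrite exprMn sqr_sqrtr ?ltW.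
suff E : forall A : set GR, measurable A -> law P mX A = normal_prob m s A.
  by move=> A mA; rewrite (gt_eqF s0) -E.
have lawH e : 0 < e -> e <= nrm P X -> exists Y (mY : measurable_fun [set: T] Y),
    [/\ Y \in L2, nrm P (X - Y) < e & forall A : set GR, measurable A -> law P mY A = normal_prob m s A].
  move=> e0 eX; have [Y [YL XY gY Y1 YY]] := H _ e0 eX.
  exists Y, (L2_measurable YL); split => // A mA; rewrite lawE.
  have Yv : 0 < ip P Y Y by rewrite YY.
  have [m' [s' [s'0 law']]] := gaussian_law YL gY Y1 Yv.
  have [-> ->] := gaussian_params Y0L YL Y01 Y1 Y0Y0 YY v0 s0 s'0 law0 law'.
  exact: law'.
apply: prob_eq_cdf => x; apply/eqP; rewrite eq_le; apply/andP; split.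
  apply: cdf_le_shift => {}x h h0; apply/lee_addgt0Pr => eta eta0.
  have [e [e0 eX ee]] := eta_small _ _ h0 eta0.
  have [Y [mY [YL XY lY]]] := lawH _ e0 eX.
  have := cdf_close mX mY x XL YL h0 XY.
  rewrite lY; last exact: measurable_half_line.
  by move=> /le_trans; apply; rewrite leeD2l// lee_fin.
apply: cdf_le_shift => {}x h h0; apply/lee_addgt0Pr => eta eta0.
have [e [e0 eX ee]] := eta_small _ _ h0 eta0.
have [Y [mY [YL XY lY]]] := lawH _ e0 eX.
rewrite nrmBC in XY.
have := cdf_close mY mX x YL XL h0 XY.
rewrite lY; last exact: measurable_half_line.
by move=> /le_trans; apply; rewrite leeD2l// lee_fin.
Qed.

End gaussian_limits.

(** * Brownian motion and the existence of the transform *)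

Section brownian_facts.
Context d (T : measurableType d) (R : realType) (P : probability T R).
Local Notation leb := (@lebesgue_measure R).
Implicit Types X Y : T -> R.

Lemma covariance0 X Y : ('E_P[X] = 0)%E -> ('E_P[Y] = 0)%E ->
  covariance P X Y = (\int[P]_w (X w * Y w)%:E)%E.
Proof.
move=> X0 Y0; rewrite covariance.unlock X0 Y0 expectation.unlock.
by apply: eq_integral => w _; rewrite /= -[LHS]/(((X w - 0) * (Y w - 0))%:E) !subr0.
Qed.

Variable B : R -> T -> R.
Hypothesis hB : brownian_motion P B.

Lemma brownian_measurable t : 0 <= t -> measurable_fun [set: T] (B t).
Proof.
have [G _ _ _] := hB => t0; have [mB _] := G 1%N (fun=> 1) (fun=> t) (fun=> t0).
by apply: eq_measurable_fun mB => w _; rewrite big_ord1 mul1r.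
Qed.

Lemma brownian_motion_cov : brownian_cov P B.
Proof.
have [_ B0 covB _] := hB.
have H s t : 0 <= s -> 0 <= t -> (\int[P]_w (B s w * B t w)%:E = (Num.min s t)%:E)%E.
  by move=> s0 t0; rewrite -covB// covariance0// B0.
split=> [t t0|s t s0 t0]; last by rewrite /ip /Rintegral H.
apply/L2P; split; first exact: brownian_measurable.
by under eq_integral do rewrite expr2; rewrite H// ltry.
Qed.

Lemma brownian_mean t : 0 <= t -> ip P (B t) (cst 1) = 0.
Proof.
have [_ B0 _ _] := hB => t0; rewrite ip1E /Rintegral.
by have := B0 _ t0; rewrite unlock => ->.
Qed.

End brownian_facts.

Section wiener_int_increments.
Context d (T : measurableType d) (R : realType) (P : probability T R).
Variable B : R -> T -> R.
Hypothesis hC : brownian_cov P B.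
Local Notation leb := (@lebesgue_measure R).
Implicit Types X : T -> R.

Lemma res_cst1 (t : R) : 0 <= t -> res t (cst 1) \in Lfun leb 2%:E.
Proof.
move=> t0; rewrite -[cst 1](_ : (fun y : R => y `^ 0) = _).
  by apply: L2_res_powR => //; lra.
by apply/funext => y; rewrite powRr0.
Qed.

Lemma Rintegral_cst1 (t : R) : 0 <= t -> \int[leb]_(x in `[0, t]) (cst 1 x : R) = t.
Proof.
move=> t0; transitivity (\int[leb]_(x in `[0, t]) (x `^ 0)).
  by apply: eq_Rintegral => x _; rewrite powRr0.
by rewrite Rintegral_powR// ?add0r ?divr1 ?powRr1// ltrN10.
Qed.

(** Seeing [B t] as an integral makes inner products with it instances of the isometry. *)
Lemma is_wiener_int_cst1 t : 0 <= t -> is_wiener_int P B t (cst 1) (B t).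
Proof.
move=> t0; apply: is_wiener_int_char => //.
- exact: res_cst1.
- exact: hC.1.
- by move=> u u0 ut; rewrite hC.2// Rintegral_cst1// min_r.
- rewrite hC.2// minxx ip_res -[leLHS]Rintegral_cst1// le_eqVlt; apply/orP; left; apply/eqP.
  by apply: eq_Rintegral => x _; rewrite mulr1.
Qed.

Lemma ip_wiener_int_B s u (f : R -> R) X : 0 <= s -> 0 <= u ->
  is_wiener_int P B s f X ->
  ip P X (B u) = \int[leb]_(v in `[0, Num.min s u]) f v.
Proof.
move=> s0 u0 HX; rewrite (wiener_isometry hC HX (is_wiener_int_cst1 u0)).
have [su|us] := leP s u.
  by rewrite ip_res_le// ip_res; apply: eq_Rintegral => x _; rewrite mulr1.
by rewrite ipC ip_res_le ?ltW// ip_res; apply: eq_Rintegral => x _; rewrite mul1r.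
Qed.

End wiener_int_increments.

(** * Joint measurability of continuous processes *)

Section joint_measurability.
Context d (T : measurableType d) (R : realType).
Variable X : R -> T -> R.
Hypotheses (mX : forall s, 0 <= s -> measurable_fun [set: T] (X s))
  (cX : forall w, {within `[0, +oo[, continuous (X ^~ w)}).

(** The grid has mesh 1/(k+1). Truncation sends negative numbers to 0, so the limit is
    [Num.max 0 s]. *)
Let dyad (k : nat) (s : R) : R := (Num.truncn (s * k.+1%:R))%:R / k.+1%:R.

Let dyad_cvg (s : R) : dyad k s @[k --> \oo] --> Num.max 0 s.
Proof.
apply/cvgrPdist_le => e e0; have H := near_infty_natSinv_lt (PosNum e0).
near=> k; have k0 : 0 < k.+1%:R :> R by [].
have ke : k.+1%:R^-1 <= e by apply: ltW; near: k.
apply: le_trans ke; rewrite /dyad; have [s0|s0] := leP 0 s.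
  have s1 : 0 <= s * k.+1%:R by rewrite mulr_ge0.
  have /andP[h1 h2] := truncn_itv s1.
  set N := (Num.truncn _)%:R; have -> : s - N / k.+1%:R = (s * k.+1%:R - N) / k.+1%:R.
    by rewrite mulrBl mulfK// gt_eqF.
  rewrite normrM normfV (gtr0_norm k0) ger0_norm ?subr_ge0// ler_piMl ?invr_ge0//.
  by rewrite lerBlDl natr1 ltW.
have -> : Num.truncn (s * k.+1%:R) = 0%N.
  by apply/truncn0Pn; rewrite -ltNge (@lt_trans _ _ 0)// pmulr_llt0.
by rewrite mul0r subrr normr0 invr_ge0.
Unshelve. all: by end_near.
Qed.

(** A pointwise limit of processes that are constant in time on the cells of the grid. Clamping
    negative times to 0 makes continuity on [0, +oo[ sufficient. *)
Lemma measurable_continuous_process :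
  measurable_fun [set: R * T] (fun p : R * T => X (Num.max 0 p.1) p.2).
Proof.
apply: (@measurable_fun_cvg _ _ _ setT (fun k (p : R * T) => X (dyad k p.1) p.2)).
  move=> k _ A mA; rewrite setTI.
  (* The preimage is cut into countably many measurable rectangles, one per grid point. *)
  have -> : (fun p : R * T => X (dyad k p.1) p.2) @^-1` A =
      \bigcup_m ([set s : R | Num.truncn (s * k.+1%:R) = m] `*`
        (X (m%:R / k.+1%:R) @^-1` A)).
    apply/seteqP; split=> [[s w]|[s w] [m _ []]].
      by move=> /= H; exists (Num.truncn (s * k.+1%:R)).
    by rewrite /dyad /= => ->.
  apply: bigcup_measurable => m _; apply: measurableX; last first.
    rewrite -[X in measurable X]setTI; exact: mX.
  have mle j : measurable [set s : R | (j <= Num.truncn (s * k.+1%:R))%N].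
    case: j => [|j]; first by rewrite (_ : [set s | _] = setT)//; apply/seteqP; split.
    have -> : [set s : R | (j.+1 <= Num.truncn (s * k.+1%:R))%N] = `[j.+1%:R / k.+1%:R, +oo[%classic.
      apply/seteqP; split=> s /=; rewrite in_itv/= andbT truncn_gt_nat.
        by rewrite ler_pdivrMr.
      by rewrite ler_pdivrMr.
    exact: measurable_itv.
  have -> : [set s : R | Num.truncn (s * k.+1%:R) = m] =
      [set s : R | (m <= Num.truncn (s * k.+1%:R))%N] `\` [set s : R | (m.+1 <= Num.truncn (s * k.+1%:R))%N].
    apply/seteqP; split=> s /=; first by move=> ->; rewrite leqnn ltnn.
    by move=> [h1 h2]; apply/eqP; rewrite eqn_leq h1 andbT leqNgt; apply/negP.
  exact: measurableD.
move=> [s w] _ /=.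
have s0 : (0 <= Num.max 0 s)%R by rewrite le_max lexx.
have /subspace_continuousP/(_ (Num.max 0 s)) := @cX w.
rewrite /= in_itv/= s0 => /(_ isT) H.
apply: cvg_trans H => U /= H.
have HU : \forall k \near \oo, (`[0, +oo[%classic : set R) (dyad k s) -> U (X (dyad k s) w).
  exact: (@dyad_cvg s _ H).
change (\forall k \near \oo, U (X (dyad k s) w)).
near=> k; have Hk : (`[0, +oo[%classic : set R) (dyad k s) -> U (X (dyad k s) w) by near: k.
apply: Hk; by rewrite /= in_itv/= andbT divr_ge0.
Unshelve. all: by end_near.
Qed.

End joint_measurability.

Section running_integral.
Context d (T : measurableType d) (R : realType).
Local Notation leb := (@lebesgue_measure R).
Local Notation GR := (measurableTypeR R).

(** The moving endpoint becomes part of the parameter: integrate in v the function f(v,w) cut off to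
    0 <= v <= s, over the parameters (s,w). *)
Lemma measurable_running_integral (f : R -> T -> R) :
  measurable_fun [set: R * T] (fun p : R * T => f p.1 p.2) ->
  measurable_fun [set: R * T]
    (fun p : R * T => \int[leb]_(v in `[0, p.1]) f v p.2).
Proof.
move=> mf; pose g (v : R) (p : GR * T) : R := if (0 <= v) && (v <= p.1) then f v p.2 else 0.
have mg : measurable_fun [set: R * (GR * T)] (fun q : R * (GR * T) => g q.1 q.2).
  have m1 : measurable_fun [set: R * (GR * T)] (fun q : R * (GR * T) => q.1 : R).
    exact: measurable_fst.
  have m2 : measurable_fun [set: R * (GR * T)] (fun q : R * (GR * T) => q.2.1 : R).
    by apply: (measurableT_comp measurable_fst); exact: measurable_snd.
  have m3 : measurable_fun [set: R * (GR * T)] (fun q : R * (GR * T) => q.2.2 : T).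
    by apply: (measurableT_comp measurable_snd); exact: measurable_snd.
  apply: measurable_fun_ifT => //.
  - by apply: measurable_and; apply: measurable_fun_ler.
  - exact: (measurableT_comp mf (measurable_fun_pair m1 m3)).
have H := measurable_integral_section mg.
apply: (eq_measurable_fun (fun p => fine (\int[leb]_v (g v p)%:E))).
  move=> [s w] _; rewrite Rintegral_mkcond; congr fine; apply: eq_integral => v _.
  by rewrite /g patchE mem_setE in_itv/=; case: ifP.
by apply: (measurableT_comp _ H) => //; exact: measurable_fine.
Qed.

End running_integral.

Section wiener_lin.
Context d (T : measurableType d) (R : realType) (P : probability T R).
Variable B : R -> T -> R.
Hypothesis hC : brownian_cov P B.
Local Notation leb := (@lebesgue_measure R).
Implicit Types (f : R -> R) (X : T -> R).

Lemma is_wiener_int_lin (m : nat) (c : 'I_m -> R) (g : 'I_m -> R -> R)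
    (X : 'I_m -> T -> R) t f : 0 <= t ->
  (forall i, is_wiener_int P B t (g i) (X i)) ->
  res t f = \sum_i c i *: res t (g i) ->
  is_wiener_int P B t f (\sum_i c i *: X i).
Proof.
move=> t0 HX fE.
have XL i : X i \in Lfun P 2%:E by have [] := HX i.
have gL i : res t (g i) \in Lfun leb 2%:E by have [] := HX i.
have cXL i : c i *: X i \in Lfun P 2%:E by exact: L2Z.
have cgL i : c i *: res t (g i) \in Lfun leb 2%:E by exact: L2Z.
have fL : res t f \in Lfun leb 2%:E by rewrite fE; exact: L2_sum.
have SL : \sum_i c i *: X i \in Lfun P 2%:E by exact: L2_sum.
apply: (is_wiener_int_char hC) => //.
  move=> u u0 ut; rewrite -(ip_res_unit_step fL ut) fE.
  have BL := hC.1 _ u0; have UL := L2_unit_step u0.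
  rewrite !ip_suml//; apply: eq_bigr => i _; rewrite !ipZl//; congr (_ * _).
  by rewrite (ip_wiener_int_B hC t0 u0 (HX i)) min_r// ip_res_unit_step.
rewrite le_eqVlt; apply/orP; left; apply/eqP; rewrite fE.
rewrite fE in fL; rewrite !ip_suml//.
apply: eq_bigr => i _; rewrite !ipZl//.
congr (_ * _); rewrite !ip_sumr//; apply: eq_bigr => j _; rewrite !ipZr//; congr (_ * _).
exact: (wiener_isometry hC (HX i) (HX j)).
Qed.

(** The criterion involves [B] only through inner products, which a modification does not change. *)
Lemma is_wiener_int_modification (B' : R -> T -> R) t f X : brownian_cov P B' ->
  (forall s, 0 <= s -> {ae P, forall w, B' s w = B s w}) -> 0 <= t ->
  is_wiener_int P B t f X -> is_wiener_int P B' t f X.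
Proof.
move=> hC' BB t0 HX; have [fL XL _] := HX.
apply: (is_wiener_int_char hC') => //; last by rewrite (wiener_isometry hC HX HX).
move=> u u0 ut; have BL := hC.1 _ u0; have BL' := hC'.1 _ u0.
by rewrite ipC (ip_ae BL BL' XL (BB _ u0)) ipC (ip_wiener_int_B hC t0 u0 HX) min_r.
Qed.

End wiener_lin.

(** * Integrals of powers with respect to B *)

Section power_integrals.
Context d (T : measurableType d) (R : realType) (P : probability T R).
Variable B : R -> T -> R.
Hypotheses (hB : brownian_cov P B)
  (mB : measurable_fun [set: R * T] (fun p : R * T => B p.1 p.2)).
Variable l : R.
Hypothesis l2 : - (1 / 2) < l.
Local Notation leb := (@lebesgue_measure R).
Local Notation L2 := (Lfun P 2%:E).
Implicit Types s t u v : R.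

Let y v w : R := v `^ (l - 1) * B v w.

(* Integration by parts for the integral of v^l with respect to B on [[0,s]]. *)
Definition jproc s w := s `^ l * B s w - l * \int[leb]_(v in `[0, s]) y v w.

Let my : measurable_fun [set: R * T] (fun p : R * T => y p.1 p.2).
Proof.
apply: measurable_funM => //.
by apply: (measurableT_comp (measurable_powR _)); exact: measurable_fst.
Qed.

Lemma measurable_jproc : measurable_fun [set: R * T] (fun p : R * T => jproc p.1 p.2).
Proof.
apply: measurable_funB.
  apply: measurable_funM => //.
  by apply: (measurableT_comp (measurable_powR _)); exact: measurable_fst.
by apply: measurable_funM => //; exact: measurable_running_integral.
Qed.

Let BL v : 0 <= v -> B v \in L2. Proof. exact: hB.1. Qed.

Let yE v : y v = v `^ (l - 1) *: B v. Proof. by []. Qed.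

Let yL t v : 0 < v -> v <= t -> y v \in L2.
Proof. by move=> v0 _; rewrite yE L2Z ?BL ?ltW. Qed.

(** The norm of v^(l-1) B_v is v^(l-1/2); it is integrable at 0 exactly when l > -1/2. *)
Let a1 : -1 < l - 1 / 2. Proof. by have := l2; lra. Qed.

Let yC t v : 0 < v -> v <= t -> ip P (y v) (y v) <= 1 * v `^ ((l - 1 / 2) * 2).
Proof.
move=> v0 _; rewrite !yE ipZl ?L2Z ?BL ?(ltW v0)// ipZr ?BL ?(ltW v0)// hB.2 ?(ltW v0)// minxx mul1r.
rewrite -{3}(powRr1 (ltW v0)) -!powRD ?(gt_eqF v0) ?implybT//.
by have -> : (l - 1 / 2) * 2 = l - 1 + (l - 1 + 1) by lra.
Qed.

Let jint s w := \int[leb]_(v in `[0, s]) y v w.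

Let jprocE s : jproc s = s `^ l *: B s - l *: jint s. Proof. by []. Qed.

Let jintL s : 0 <= s -> jint s \in L2.
Proof. by move=> s0; exact: (L2_integral_process my s0 a1 (@yL s) (@yC s)). Qed.

Lemma L2_jproc s : 0 <= s -> jproc s \in L2.
Proof. by move=> s0; rewrite jprocE; apply: L2B; apply: L2Z; [exact: BL|exact: jintL]. Qed.

Let ip_jint s W (f : R -> R) : 0 <= s -> W \in L2 ->
  (forall v, 0 < v -> v <= s -> ip P (y v) W = f v) ->
  leb.-integrable `[0, s] (EFin \o f) /\
  ip P (jint s) W = \int[leb]_(v in `[0, s]) f v.
Proof.
move=> s0 WL yW.
have [i ->] := ip_integral_process my s0 a1 (@yL s) (@yC s) WL.
exact: eq_Rintegral0.
Qed.

Let l1 : 0 < l + 1. Proof. by have := l2; lra. Qed.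

(** The inner product is u s^l - l times the integral of v^(l-1) min(v,u) over [0,s], which is
    evaluated by splitting at v = u. *)
Lemma ip_jproc_B s u : 0 <= u -> u <= s ->
  ip P (jproc s) (B u) = u `^ (l + 1) / (l + 1).
Proof.
move=> u0 us; have s0 := le_trans u0 us.
rewrite jprocE ipBl ?L2Z ?BL ?jintL// !ipZl ?BL ?jintL// hB.2// min_r//.
have [u00|un0] := eqVneq u 0.
  have B0 : {ae P, forall w, B u w = (0 : T -> R) w}.
    by apply: (ip_self0 (BL u0)); rewrite hB.2// minxx.
  rewrite ipC (ip_ae (L2_0 P) (BL u0) (jintL s0) B0) ip0l u00 powR0 ?gt_eqF//; ring.
have up : 0 < u by rewrite lt_neqAle eq_sym un0.
have sp := lt_le_trans up us.
have H v : 0 < v -> v <= s -> ip P (y v) (B u) = v `^ (l - 1) * Num.min v u.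
  by move=> v0 vs; rewrite yE ipZl ?BL ?ltW// hB.2// ltW.
have [i ->] := ip_jint s0 (BL u0) H.
have [->|l0] := eqVneq l 0.
  by rewrite mul0r subr0 powRr0 add0r divr1 mul1r powRr1.
have lN : l - 1 != -1 by rewrite -subr_eq0 opprK subrK.
have ll : -1 < l by have := l2; lra.
have [J1 J2] := integral_powR_pos lN up us.
have sE := @Rintegral_itvB R _ (BLeft 0) (BRight s) u i.
rewrite !bnd_simp in sE; have {}sE := sE u0 us.
have I1 := eq_Rintegral0 (g := fun v => v `^ (l - 1) * Num.min v u) (integrable_powR ll u0).
have [|_ E1] := I1.
  move=> v v0 vu; rewrite min_l// -{3}(powRr1 (ltW v0)) -powRD ?(gt_eqF v0) ?implybT//.
  by rewrite subrK.
have E2 : \int[leb]_(v in `]u, s]) (v `^ (l - 1) * Num.min v u) = u * ((s `^ l - u `^ l) / l).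
  rewrite Rintegral_itv_obnd_cbnd; last first.
    by apply: integrableS i => //; apply: subset_itvr; rewrite bnd_simp.
  transitivity (\int[leb]_(v in `[u, s]) (u * v `^ (l - 1))).
    by apply: eq_Rintegral => v; rewrite inE/= in_itv/= => /andP[uv _]; rewrite min_r// mulrC.
  rewrite RintegralZl//; congr (_ * _); rewrite /Rintegral J2 /=.
  by rewrite subrK.
rewrite E2 -E1 Rintegral_powR// in sE.
move: sE => /eqP; rewrite subr_eq => /eqP ->.
have -> : u `^ (l + 1) = u `^ l * u by rewrite powRD ?(gt_eqF up) ?implybT// powRr1.
by field; rewrite l0 gt_eqF.
Qed.

(** The second moment follows from [ip_jproc_B] by expanding one of the two factors; it equals the
    integral of v^(2l), so the norm condition of the criterion holds with equality. *)
Lemma is_wiener_int_jproc s : 0 < s -> is_wiener_int P B s (fun v => v `^ l) (jproc s).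
Proof.
move=> sp; have s0 := ltW sp; have ll : -1 < l by have := l2; lra.
apply: is_wiener_int_char => //.
- exact: L2_res_powR.
- exact: L2_jproc.
- by move=> u u0 us; rewrite ip_jproc_B// Rintegral_powR.
rewrite ip_res_powR// {1}jprocE ipBl ?L2Z ?BL ?jintL ?L2_jproc// !ipZl ?BL ?jintL ?L2_jproc//.
have H v : 0 < v -> v <= s -> ip P (y v) (jproc s) = (l + 1)^-1 * v `^ (l * 2).
  move=> v0 vs; rewrite yE ipZl ?BL ?L2_jproc ?(ltW v0)// ipC ip_jproc_B ?(ltW v0)//.
  rewrite mulrA -powRD ?(gt_eqF v0) ?implybT// mulrC; congr (_ * _ `^ _); lra.
have l3 : -1 < l * 2 by have := l2; lra.
have [_ ->] := ip_jint s0 (L2_jproc s0) H.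
rewrite RintegralZl//; last exact: integrable_powR.
rewrite Rintegral_powR// ipC ip_jproc_B// mulrA -powRD ?(gt_eqF sp) ?implybT//.
rewrite le_eqVlt; apply/orP; left; apply/eqP.
have -> : l + (l + 1) = l + l + 1 by lra.
have -> : l * 2 + 1 = l + l + 1 by lra.
by field; rewrite gt_eqF ?gt_eqF//; have := l2; lra.
Qed.

End power_integrals.

(** * Existence of the transform *)

Section existence.
Context d (T : measurableType d) (R : realType) (P : probability T R).
Variable B : R -> T -> R.
Hypothesis hB : brownian_motion P B.
Context (n : nat) (lam : 'I_n -> R).
Hypotheses (lam_inj : injective lam) (lam_gt : forall j, - (1 / 2) < lam j).
Local Notation leb := (@lebesgue_measure R).
Let hC := brownian_motion_cov hB.

Lemma continuous_running_integral (f : R -> R) :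
  (forall m, leb.-integrable `[0%R, m%:R] (EFin \o f)) ->
  {within `[0, +oo[, continuous (fun t => \int[leb]_(s in `[0, t]) f s)}.
Proof.
move=> fi; apply/subspace_continuousP => x; rewrite /= in_itv/= andbT => x0.
have xm := archi_boundP x0; set m := Num.bound x in xm.
have /subspace_continuousP/(_ x) := parameterized_integral_continuous (ler0n R m) (fi m).
rewrite /= in_itv/= x0 (ltW xm) => /(_ isT) H U /= /H {H} HU.
have HU' : \forall y \near x, (`[0, m%:R]%classic : set R) y ->
  U (\int[leb]_(s in `[0, y]) f s) := HU.
change (\forall y \near x, (`[0, +oo[%classic : set R) y -> U (\int[leb]_(s in `[0, y]) f s)).
have xm' := lt_nbhsl xm.
near=> y; rewrite /= in_itv/= andbT => y0.
have : (`[0, m%:R]%classic : set R) y -> U (\int[leb]_(s in `[0, y]) f s) by near: y.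
apply; rewrite /= in_itv/= y0 ltW//; near: y; exact: xm'.
Unshelve. all: by end_near.
Qed.

(** Paths are set to 0 on a measurable null set containing all discontinuous ones, so that every
    path is continuous. *)
Lemma measurable_modification : exists B' : R -> T -> R,
  measurable_fun [set: R * T] (fun p : R * T => B' p.1 p.2) /\
  forall s, 0 <= s -> {ae P, forall w, B' s w = B s w}.
Proof.
have [_ _ _ [A [mA A0 cA]]] := hB.
pose X s w := \1_(~` A) w * B s w.
exists (fun s w => X (Num.max 0 s) w); split.
  apply: measurable_continuous_process.
    move=> s s0; apply: measurable_funM; last exact: (brownian_measurable hB).
    by apply: measurable_indic; exact: measurableC.
  move=> w; rewrite /X indicE; case: (boolP (w \in ~` A)) => wA.
    rewrite (_ : (fun s => _) = B ^~ w); last by apply/funext => s; rewrite mul1r.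
    apply: contrapT => cw; move/set_mem: wA; apply; exact: cA.
  rewrite (_ : (fun s => _) = cst 0); last by apply/funext => s; rewrite mul0r.
  by apply: continuous_subspaceT => x; exact: cst_continuous.
move=> s s0; exists A; split => // w /= Xw; apply: contrapT => wA; apply: Xw.
by rewrite max_r// /X indicE mem_set// mul1r.
Qed.

Lemma pw_process : exists J : 'I_n -> R -> T -> R,
  (forall j, measurable_fun [set: R * T] (fun p : R * T => J j p.1 p.2)) /\
  forall j s, 0 < s -> is_wiener_int P B s (pw lam j) (J j s).
Proof.
have [B' [mB' BB']] := measurable_modification.
have B'L s : 0 <= s -> B' s \in Lfun P 2%:E.
  move=> s0; apply: (L2_ae (hC.1 _ s0) _ (BB' _ s0)).
  exact: (measurable_fun_pair2 s mB').
have hC' : brownian_cov P B'.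
  split=> // s t s0 t0; rewrite (ip_ae (hC.1 _ s0) (B'L _ s0) (B'L _ t0) (BB' _ s0)).
  by rewrite ipC (ip_ae (hC.1 _ t0) (B'L _ t0) (hC.1 _ s0) (BB' _ t0)) ipC hC.2.
exists (fun j => jproc B' (lam j)); split=> [j|j s s0]; first exact: measurable_jproc.
apply: (is_wiener_int_modification hC' hC).
- by move=> t t0; apply: filterS (BB' _ t0) => w ->.
- exact: ltW.
- exact: is_wiener_int_jproc.
Qed.

Lemma kernel_process : exists Y : R -> T -> R,
  measurable_fun [set: R * T] (fun p : R * T => Y p.1 p.2) /\
  forall s, 0 < s -> is_wiener_int P B s (k_ker lam s) (Y s).
Proof.
have [J [mJ HJ]] := pw_process.
pose c (j : 'I_n) s := a_coef lam j * s `^ (- (lam j + 1)).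
exists (fun s => \sum_j c j s *: J j s); split.
  rewrite (_ : (fun p => _) = (fun p : R * T => \sum_j c j p.1 * J j p.1 p.2)); last first.
    by apply/funext => p; rewrite fct_sumE.
  apply: measurable_sum => j; apply: measurable_funM; last exact: mJ.
  apply: measurable_funM => //.
  by apply: (measurableT_comp (measurable_powR _)); exact: measurable_fst.
move=> s s0; apply: (is_wiener_int_lin hC (g := pw lam)) => //.
- exact: ltW.
- by move=> j; exact: HJ.
- exact: res_kE.
Qed.

Lemma kernel_process_model (Y : R -> T -> R) :
  measurable_fun [set: R * T] (fun p : R * T => Y p.1 p.2) ->
  (forall s, 0 < s -> is_wiener_int P B s (k_ker lam s) (Y s)) ->
  model P lam B Y.
Proof.
move=> mY HY; split => //.
- by move=> s s0; have [] := HY _ s0.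
- move=> s u s0 u0; rewrite (ip_wiener_int_B hC (ltW s0) u0 (HY _ s0)).
  by rewrite -ip_k_step// ip_res_step// L2_k.
- move=> s r s0 sr; have r0 := lt_le_trans s0 sr.
  by rewrite (wiener_isometry hC (HY _ s0) (HY _ r0)) ip_k_k.
Qed.

Lemma volterra_transform_exists : exists Z, volterra_transform P B (k_ker lam) Z.
Proof.
have [Y [mY HY]] := kernel_process.
have hM := kernel_process_model mY HY.
(* Integer horizons suffice, and being countable they give one null set for all t. *)
have iY : {ae P, forall w, forall m : nat, leb.-integrable `[0%R, m%:R] (EFin \o Y ^~ w)}.
  by apply/ae_foralln => m; exact: (integrable_xproc hM).
exists (zproc B Y); split.
- by move=> t t0; exact: L2_measurable (L2_zproc hM t0).
- have [_ _ _ cB] := hB; rewrite /continuous_paths; near=> w.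
  have cBw : {within `[0, +oo[, continuous (fun t : R => B t w)} by near: w.
  have iYw : forall m : nat, leb.-integrable `[0%R, m%:R] (EFin \o Y ^~ w) by near: w.
  have cx := continuous_running_integral iYw.
  move=> x; exact: (cvgB (cBw x) (cx x)).
- by move=> s s0; exact: L2_k.
- exists Y; split => //.
  + by move=> s s0; exact: (wiener_int_ae hC (HY _ s0)).
  + apply: filterS iY => w iw t t0; have tm := archi_boundP (ltW t0).
    apply: integrableS (iw (Num.bound t)) => //.
    by apply: subset_itvl; rewrite bnd_simp ltW.
  + by move=> t t0; apply: nearW.
Unshelve. all: by end_near.
Qed.

End existence.

(** * Properties of an arbitrary version of the transform *)

Section transform.
Context d (T : measurableType d) (R : realType) (P : probability T R).
Variable B : R -> T -> R.
Hypothesis hB : brownian_motion P B.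
Context (n : nat) (lam : 'I_n -> R).
Hypotheses (lam_inj : injective lam) (lam_gt : forall j, - (1 / 2) < lam j).
Variable Z : R -> T -> R.
Hypothesis hZ : volterra_transform P B (k_ker lam) Z.
Local Notation leb := (@lebesgue_measure R).
Local Notation L2 := (Lfun P 2%:E).
Let hC := brownian_motion_cov hB.

(** Brings any version of the transform back to the model: its inner integrals are the [Y], and Z_t
    is almost surely [zproc B Y t]. *)
Lemma transform_data : exists Y, [/\ model P lam B Y,
  forall s, 0 < s -> is_wiener_int P B s (k_ker lam s) (Y s) &
  forall t, 0 <= t -> {ae P, forall w, Z t w = zproc B Y t w}].
Proof.
have [_ _ _ [Y [mY YE _ ZE]]] := hZ.
(* A version of the inner integral must exist for [wiener_int] not to be its default value. *)
have [Y0 [_ HY0]] := kernel_process hB lam_gt.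
have HY s : 0 < s -> is_wiener_int P B s (k_ker lam s) (Y s).
  move=> s0; have HI := wiener_intP (HY0 _ s0).
  have [_ IL _] := HI.
  apply: (is_wiener_int_ae hC HI _ (YE _ s0)).
  by apply: (L2_ae IL _ (YE _ s0)); exact: (measurable_fun_pair2 s mY).
exists Y; split => //; exact: kernel_process_model.
Qed.

Lemma L2_transform t : 0 <= t -> Z t \in L2.
Proof.
move=> t0; have [Y [hM _ ZE]] := transform_data; have [mZ _ _ _] := hZ.
exact: (L2_ae (L2_zproc hM t0) (mZ _ t0) (ZE _ t0)).
Qed.

Lemma ip_transform Y t W : model P lam B Y ->
  (forall t, 0 <= t -> {ae P, forall w, Z t w = zproc B Y t w}) -> 0 <= t ->
  W \in L2 -> ip P (Z t) W = ip P (zproc B Y t) W.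
Proof.
move=> hM ZE t0 WL; apply: ip_ae (ZE _ t0) => //; first exact: (L2_zproc hM).
exact: L2_transform.
Qed.

Lemma transform_cov : brownian_cov P Z.
Proof.
split; first exact: L2_transform.
move=> s t s0 t0; have [Y [hM _ ZE]] := transform_data.
rewrite (ip_transform hM ZE s0 (L2_transform t0)) ipC.
rewrite (ip_transform hM ZE t0 (L2_zproc hM s0)) ipC.
exact: (brownian_cov_zproc lam_inj lam_gt hM).2.
Qed.

(** E[Z_t B_u] and E[Z_t^2] coincide with the corresponding inner products of [zleb t], which is
    rho(t/.) almost everywhere; the criterion concludes. *)
Lemma transform_wiener_int t : 0 < t ->
  is_wiener_int P B t (fun s => rho_fun lam (t / s)) (Z t).
Proof.
move=> tp; have t0 := ltW tp; have [Y [hM _ ZE]] := transform_data.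
have hl := lebesgue_model lam_inj lam_gt.
have [rL rE] := res_rho lam_inj lam_gt tp; have zL := L2_zleb lam_inj lam_gt t0.
apply: (is_wiener_int_char hC) => //.
- exact: L2_transform.
- move=> u u0 ut; rewrite (ip_transform hM ZE t0 (hC.1 _ u0)) (ip_zb hM t0 u0).
  rewrite -(ip_zb hl t0 u0) -(ip_res_unit_step rL ut).
  by rewrite (ip_ae zL rL (L2_unit_step u0) rE).
- rewrite transform_cov.2// minxx (ip_ae zL rL rL rE) ipC (ip_ae zL rL zL rE).
  by have [_ ->] := brownian_cov_zproc lam_inj lam_gt hl; rewrite ?minxx.
Qed.

Lemma clspan_transform t : 0 <= t -> clspan P B t (Z t).
Proof.
rewrite le_eqVlt => /predU1P[<-|t0]; last first.
  by apply: clspan_wiener_int => //; [exact: ltW|exact: transform_wiener_int].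
apply: (@clspan_ae _ _ _ P B 0 _ 0); first by move=> *; exact: hC.1.
- exact: clspan0.
- exact: L2_transform.
- by apply: ip_self0; [exact: L2_transform|rewrite transform_cov.2// minxx].
Qed.

Lemma transform_mean t : 0 <= t -> ip P (Z t) (cst 1) = 0.
Proof.
move=> t0; apply: (clspan_ip0 _ (clspan_transform t0) (L2_cst1 P)).
  by move=> *; exact: hC.1.
by move=> s s0 _; exact: (brownian_mean hB).
Qed.

Lemma transform_brownian : brownian_motion P Z.
Proof.
have ZL := L2_transform; have EZ t : 0 <= t -> ('E_P[Z t] = 0)%E.
  move=> t0; rewrite expectation.unlock.
  transitivity (ip P (Z t) (cst 1))%:E; last by rewrite transform_mean.
  rewrite -ip_EFin ?ZL ?L2_cst1//.
  by apply: eq_integral => w _; rewrite mulr1.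
split => //.
(* The sum of the nonnegative times bounds each of them, so all the variables lie in one closed
   span. *)
- move=> m c t t0; pose tm := \sum_i t i.
  have ttm i : t i <= tm.
    by rewrite /tm (bigD1 i)//= lerDl sumr_ge0.
  have BL s : 0 <= s -> s <= tm -> B s \in L2 by move=> *; exact: hC.1.
  rewrite (_ : (fun w => _) = \sum_i c i *: Z (t i)); last first.
    by apply/funext => w; rewrite fct_sumE.
  apply: (gaussian_clspan hB (t := tm) hC.1 (brownian_mean hB)).
  apply: clspan_sum => // i; apply: clspanZ => //.
  exact: clspan_le (clspan_transform (t0 i)).
- move=> s t s0 t0; rewrite covariance0 ?EZ// -transform_cov.2// ip_EFin ?ZL//.
- by have [_ ? _ _] := hZ.
Qed.

End transform.

Section kernel_regularity.
Context (R : realType) (n : nat) (lam : 'I_n -> R).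

Lemma symmetrized_k_ker (t s : R) :
  symmetrized (k_ker lam) t s = (Num.max t s)^-1 * K_fun lam (Num.min t s / Num.max t s).
Proof.
rewrite /symmetrized /k_ker; have [st|ts] := leP s t => //.
by rewrite (ltW ts).
Qed.

(** In terms of max and min the symmetrized kernel is a single formula, and on the open quadrant the
    ratio min/max is positive, where every real power is continuous. *)
Lemma volterra_kernel_k_ker : volterra_kernel (k_ker lam).
Proof.
split=> [s v s0 sv|]; first by rewrite /k_ker leNgt sv.
apply/subspace_continuousP => -[t s] /= [t0 s0].
rewrite (_ : (fun p : R * R => _) = (fun p : R * R =>
    (Num.max p.1 p.2)^-1 * K_fun lam (Num.min p.1 p.2 / Num.max p.1 p.2))); last first.
  by apply/funext => p; exact: symmetrized_k_ker.
apply: cvg_within_filter.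
have M0 : 0 < Num.max t s by rewrite lt_max t0.
have m0 : 0 < Num.min t s by rewrite lt_min t0.
have cM : Num.max p.1 p.2 @[p --> (t, s)] --> Num.max t s.
  exact: (@continuous_max R (R * R)%type fst snd (t, s) cvg_fst cvg_snd).
have cm : Num.min p.1 p.2 @[p --> (t, s)] --> Num.min t s.
  exact: (@continuous_min R (R * R)%type fst snd (t, s) cvg_fst cvg_snd).
have cMV : (Num.max p.1 p.2)^-1 @[p --> (t, s)] --> (Num.max t s)^-1.
  by apply: cvgV => //; rewrite gt_eqF.
have cq : Num.min p.1 p.2 / Num.max p.1 p.2 @[p --> (t, s)] --> Num.min t s / Num.max t s.
  exact: cvgM.
apply: cvgM => //; rewrite /K_fun; apply: cvg_big; first exact: add_continuous.
move=> j _; apply: cvgM; first exact: cvg_cst.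
have q0 : 0 < Num.min t s / Num.max t s by rewrite divr_gt0.
exact: (cvg_comp _ _ cq (continuous_powR (a := lam j) q0)).
Qed.

End kernel_regularity.

(** * The orthogonal decomposition of H_t(B) *)

Section innovation.
Context (R : realType) (n : nat) (lam : 'I_n -> R).
Hypotheses (lam_inj : injective lam) (lam_gt : forall j, - (1 / 2) < lam j).
Local Notation leb := (@lebesgue_measure R).
Local Notation a := (a_coef lam).
Local Notation S := (Ssum lam).
Implicit Types (i j : 'I_n).

(** The inverse of the Gram matrix of the s^lam_j in L^2[0,t], obtained by scaling from the inverse
    Cauchy matrix. *)
Definition ginv (t : R) i j : R :=
  t `^ (- (lam i + lam j + 1)) * (a i * cm lam i j * a j).

Lemma ginvP t i k : 0 < t ->
  \sum_j ginv t i j * (t `^ (lam j + lam k + 1) * cm lam j k) = (i == k)%:R.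
Proof.
move=> t0.
transitivity (t `^ (lam k - lam i) * \sum_j cm lam k j * (a j * cm lam j i * a i)).
  rewrite mulr_sumr; apply: eq_bigr => j _; rewrite /ginv (cmC _ i j) (cmC _ k j).
  have -> : t `^ (lam k - lam i) =
      t `^ (- (lam i + lam j + 1)) * t `^ (lam j + lam k + 1).
    by rewrite -powRD ?(gt_eqF t0) ?implybT//; congr (_ `^ _); ring.
  ring.
rewrite cm_inv// eq_sym; have [->|_] := eqVneq i k; last by rewrite mulr0.
by rewrite subrr powRr0 mulr1.
Qed.

Variables u t : R.
Hypotheses (u0 : 0 < u) (ut : u <= t).
Let t0 : 0 < t := lt_le_trans u0 ut.

Let h j : R -> R := fun s => if u < s <= t then s `^ (- (lam j + 1)) else 0.

Let hE i j s : h i s * h j s =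
  ((fun s => s `^ (- (lam i + lam j + 2))) \_ `]u, t]) s.
Proof.
rewrite /h patchE mem_setE in_itv/=; case: ifPn => [/andP[us st]|_]; last by rewrite mul0r.
have s0 := lt_trans u0 us.
by rewrite -powRD ?(gt_eqF s0) ?implybT//; congr (_ `^ _); ring.
Qed.

Let pw_itv l : l != 0 ->
  leb.-integrable `[u, t] (EFin \o (fun s : R => s `^ (- (l + 1)))) /\
  \int[leb]_(s in `]u, t]) (s `^ (- (l + 1))) = (u `^ (- l) - t `^ (- l)) / l.
Proof.
move=> l0; have lN : - (l + 1) != -1 by rewrite eqr_opp -subr_eq0 addrK.
have [H1 H2] := integral_powR_pos lN u0 ut; split => //.
rewrite Rintegral_itv_obnd_cbnd; last first.
  by apply: integrableS H1 => //; apply: subset_itvr; rewrite bnd_simp.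
rewrite /Rintegral H2 /=.
have -> : - (l + 1) + 1 = - l by ring.
by rewrite invrN mulrN -mulNr opprB.
Qed.

Let dE i j : - (lam i + lam j + 2) = - (lam i + lam j + 1 + 1).
Proof. ring. Qed.

Let hL j : h j \in Lfun leb 2%:E.
Proof.
have mh : measurable_fun setT (h j).
  have -> : h j = (fun s => s `^ (- (lam j + 1))) \_ `]u, t].
    by apply/funext => s; rewrite patchE mem_setE in_itv.
  by apply/(measurable_restrictT _ _).1 => //; exact: measurable_funTS.
apply/L2P; split => //.
have D := lamD1_gt0 lam_gt j j.
have [H1 _] := pw_itv (lt0r_neq0 D).
have H2 : leb.-integrable `]u, t] (EFin \o (fun s : R => s `^ (- (lam j + lam j + 1 + 1)))).
  by apply: integrableS H1 => //; apply: subset_itvr; rewrite bnd_simp.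
have -> : (\int[leb]_x (h j x ^+ 2)%:E = \int[leb]_(s in `]u, t]) (s `^ (- (lam j + lam j + 1 + 1)))%:E)%E.
  rewrite [RHS]integral_mkcond; apply: eq_integral => s _.
  by rewrite expr2 hE dE /patch; case: ifP.
by rewrite ltey_eq (integrable_fin_num _ H2).
Qed.

Let ip_hh i j : ip leb (h i) (h j) =
  (u `^ (- (lam i + lam j + 1)) - t `^ (- (lam i + lam j + 1))) * cm lam i j.
Proof.
have D := lamD1_gt0 lam_gt i j; have [_ <-] := pw_itv (lt0r_neq0 D).
rewrite /ip [RHS]Rintegral_mkcond; apply: eq_Rintegral => s _.
by rewrite hE dE.
Qed.

Let ip_eh j : ip leb (unit_step u) (h j) = 0.
Proof.
rewrite -(ip0l leb (h j)); apply: eq_Rintegral => s _.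
rewrite [X in _ = X * _]/GRing.zero/= mul0r unit_stepE /h.
case: (ltP u s) => us /=; last by rewrite mulr0.
by rewrite andbF mul0r.
Qed.

Let e j := a j * (u `^ (lam j + 1) / (lam j + 1)).

(* The derivative in [r] of E[B_u Z_r], for [r <= t]. *)
Definition innov : R -> R := (1 - S) *: unit_step u - \sum_j e j *: h j.

Let ehL j : e j *: h j \in Lfun leb 2%:E. Proof. exact: L2Z. Qed.
Let SL : \sum_j e j *: h j \in Lfun leb 2%:E. Proof. exact: L2_sum. Qed.
Let UL := L2_unit_step (ltW u0).
Let uL : (1 - S) *: unit_step u \in Lfun leb 2%:E. Proof. exact: L2Z. Qed.

Let sumE s : (\sum_j e j *: h j) s = \sum_j e j * h j s.
Proof. by rewrite fct_sumE. Qed.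

Let innovE s : innov s = (1 - S) * unit_step u s - \sum_j e j * h j s.
Proof. by rewrite -sumE. Qed.

Lemma L2_innov : innov \in Lfun leb 2%:E.
Proof. exact: L2B. Qed.

Lemma innov_kb s : 0 < s -> s <= t -> innov s = unit_step u s - kb lam s u.
Proof.
move=> s0 st; rewrite innovE unit_stepE s0; case: (leP s u) => su /=.
  rewrite kb_le// mulr1 big1 ?subr0// => j _.
  by rewrite /h ltNge su mulr0.
rewrite mulr0 !sub0r; congr (- _); apply: eq_bigr => j _.
by rewrite /h su st min_r ?(ltW su)// /e mulrAC.
Qed.

Lemma res_innov : res t innov = innov.
Proof.
apply/funext => s; rewrite resE; case: ifPn => // st; rewrite innovE unit_stepE.
have [/andP[s0 su]|_] := boolP (0 < s <= u).
  by move: st; rewrite (ltW s0) (le_trans su ut).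
rewrite mulr0 sub0r big1 ?oppr0// => j _; rewrite /h.
have [/andP[us st']|_] := boolP (u < s <= t); last by rewrite mulr0.
by move: st; rewrite (ltW (lt_trans u0 us)) st'.
Qed.

(** The right-hand side is the squared norm of [B u] minus its projection. In the computation (1 -
    S)^2 u from [0,u] and u (2S - S^2) from ]u,t] add up to u. *)
Lemma ip_innov : ip leb innov innov = u - \sum_j (\sum_i ginv t i j *
  (u `^ (lam i + 1) / (lam i + 1))) * (u `^ (lam j + 1) / (lam j + 1)).
Proof.
have hS : ip leb (unit_step u) (\sum_j e j *: h j) = 0.
  by rewrite ip_sumr// big1// => j _; rewrite ipZr// ip_eh mulr0.
have SS : ip leb (\sum_j e j *: h j) (\sum_j e j *: h j) =
    \sum_i \sum_j e i * (e j * ip leb (h i) (h j)).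
  rewrite ip_suml//; apply: eq_bigr => i _; rewrite ipZl// ip_sumr// mulr_sumr.
  by apply: eq_bigr => j _; rewrite ipZr.
have UU : ip leb (unit_step u) (unit_step u) = u by rewrite ip_unit_step ?ltW// minxx.
have -> : ip leb innov innov = (1 - S) ^+ 2 * u + \sum_i \sum_j e i * (e j * ip leb (h i) (h j)).
  rewrite /innov (ipBl uL SL L2_innov) (ipBr uL SL uL) (ipBr uL SL SL) SS.
  rewrite (ipC leb (\sum_j e j *: h j) ((1 - S) *: unit_step u)).
  rewrite (ipZl _ UL SL) hS (ipZl _ UL uL) (ipZr _ UL UL) UU; ring.
(* In the contribution of the endpoint u the powers multiply to u, leaving the form of [cm_quad];
   the endpoint t gives the inverse Gram matrix. *)
have -> : \sum_i \sum_j e i * (e j * ip leb (h i) (h j)) =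
    u * (2 * S - S ^+ 2) - \sum_i \sum_j e i * (e j * (t `^ (- (lam i + lam j + 1)) * cm lam i j)).
  rewrite -(cm_quad lam_inj lam_gt) mulr_sumr -sumrB; apply: eq_bigr => i _.
  rewrite mulr_sumr -sumrB; apply: eq_bigr => j _; rewrite ip_hh.
  have uu : u `^ (lam i + 1) * u `^ (lam j + 1) * u `^ (- (lam i + lam j + 1)) = u.
    rewrite -!powRD ?(gt_eqF u0) ?implybT// -[RHS](powRr1 (ltW u0)); congr (_ `^ _); ring.
  rewrite mulrBl !mulrBr; congr (_ - _); rewrite -[X in _ = X * _]uu /e.
  by field; rewrite !gt_eqF// lam1_gt0.
rewrite (_ : \sum_j _ = \sum_i \sum_j e i * (e j * (t `^ (- (lam i + lam j + 1)) * cm lam i j))); last first.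
  rewrite [RHS]exchange_big; apply: eq_bigr => j _; rewrite mulr_suml; apply: eq_bigr => i _.
  rewrite /ginv /e; ring.
ring.
Qed.

End innovation.

(** * Orthogonal projection through an inverse Gram matrix *)

Section gram_projection.
Context d (T : measurableType d) (R : realType).
Variable mu : {measure set T -> \bar R}.
Local Notation L2 := (Lfun mu 2%:E).
Context (n : nat) (I : 'I_n -> T -> R) (Gi : 'I_n -> 'I_n -> R).
Hypothesis IL : forall j, I j \in L2.
Hypothesis GiP : forall i k, \sum_j Gi i j * ip mu (I j) (I k) = (i == k)%:R.
Implicit Types X Y : T -> R.

Definition gproj X : T -> R := \sum_j (\sum_i Gi i j * ip mu X (I i)) *: I j.

Lemma L2_gproj X : gproj X \in L2.
Proof. by apply: L2_sum => j; rewrite L2Z. Qed.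

Lemma ip_gprojl X Y : Y \in L2 ->
  ip mu (gproj X) Y = \sum_j (\sum_i Gi i j * ip mu X (I i)) * ip mu (I j) Y.
Proof.
move=> YL; rewrite ip_suml//; last by move=> j; rewrite L2Z.
by apply: eq_bigr => j _; rewrite ipZl.
Qed.

Lemma ip_gproj X k : ip mu (gproj X) (I k) = ip mu X (I k).
Proof.
rewrite ip_gprojl//; transitivity (\sum_i ip mu X (I i) * (i == k)%:R); last first.
  rewrite (bigD1 k)//= eqxx mulr1 big1 ?addr0// => i /negbTE ->.
  by rewrite mulr0.
under [RHS]eq_bigr do rewrite -GiP mulr_sumr.
rewrite exchange_big; apply: eq_bigr => j _; rewrite mulr_suml.
by apply: eq_bigr => i _; ring.
Qed.

Lemma ip_sub_gproj X k : X \in L2 -> ip mu (X - gproj X) (I k) = 0.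
Proof. by move=> XL; rewrite ipBl ?L2_gproj// ip_gproj subrr. Qed.

Lemma ip_sub_gproj_proj X Y : X \in L2 -> ip mu (X - gproj X) (gproj Y) = 0.
Proof.
move=> XL; rewrite ipC ip_gprojl ?L2B ?L2_gproj//.
by rewrite big1// => j _; rewrite ipC ip_sub_gproj// mulr0.
Qed.

Lemma nrm_sub_gproj X : X \in L2 ->
  ip mu (X - gproj X) (X - gproj X) = ip mu X X - ip mu (gproj X) X.
Proof.
move=> XL; have pL := L2_gproj X.
by rewrite (ipBr XL pL (L2B XL pL)) ip_sub_gproj_proj// subr0 ipBl.
Qed.

Lemma nrm_sub_gproj_le X : X \in L2 -> nrm mu (X - gproj X) <= nrm mu X.
Proof.
move=> XL; rewrite -(@ler_pXn2r _ 2)// ?nnegrE ?nrm_ge0// !sqr_nrm nrm_sub_gproj//.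
have -> : ip mu (gproj X) X = ip mu (gproj X) (gproj X).
  apply/eqP; rewrite -subr_eq0 -ipBr ?L2_gproj//; apply/eqP.
  by rewrite ipC ip_sub_gproj_proj.
by rewrite lerBlDr lerDl ip_ge0.
Qed.

Lemma gproj_lin m (c : 'I_m -> R) (X : 'I_m -> T -> R) : (forall i, X i \in L2) ->
  gproj (\sum_i c i *: X i) = \sum_i c i *: gproj (X i).
Proof.
move=> XL; under [RHS]eq_bigr do rewrite scaler_sumr.
rewrite exchange_big; apply: eq_bigr => j _.
under [RHS]eq_bigr do rewrite scalerA.
rewrite -scaler_suml; congr (_ *: _).
under [RHS]eq_bigr do rewrite mulr_sumr.
rewrite [RHS]exchange_big; apply: eq_bigr => i _.
rewrite ip_suml ?mulr_sumr//; last by move=> k; rewrite L2Z.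
by apply: eq_bigr => k _; rewrite ipZl//; ring.
Qed.

Lemma gprojB X Y : X \in L2 -> Y \in L2 -> gproj (X - Y) = gproj X - gproj Y.
Proof.
move=> XL YL; rewrite /gproj -sumrB; apply: eq_bigr => j _.
rewrite -scalerBl -sumrB; congr (_ *: _); apply: eq_bigr => i _.
by rewrite ipBl// mulrBr.
Qed.

Variables (B Z : R -> T -> R) (t : R).
Hypotheses (BL : forall s, 0 <= s -> s <= t -> B s \in L2)
  (ZL : forall s, 0 <= s -> s <= t -> Z s \in L2)
  (BZ : forall s, 0 <= s -> s <= t -> clspan mu Z t (B s - gproj (B s))).

(** The map X -> X - gproj X is linear and contracting, so sending the generators [B s] into the
    closed span of [Z] makes it send their whole closed span there. *)
Lemma clspan_sub_gproj X : clspan mu B t X -> clspan mu Z t (X - gproj X).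
Proof.
move=> [XL HX]; apply: clspan_closed => //; first by rewrite L2B ?L2_gproj.
move=> e e0; have [m [c [s [st Hs]]]] := HX _ e0.
pose L := \sum_i c i *: B (s i).
have BsL i : B (s i) \in L2 by have /andP[*] := st i; exact: BL.
have LL : L \in L2 by exact: (L2_lin BL c st).
exists (L - gproj L).
  rewrite /L gproj_lin// -sumrB; apply: clspan_sum => // i.
  by rewrite -scalerBr; apply: clspanZ => //; have /andP[*] := st i; exact: BZ.
have -> : X - gproj X - (L - gproj L) = X - L - gproj (X - L).
  by rewrite gprojB// !opprB addrACA [in RHS]addrACA; congr (_ + _); exact: addrC.
by rewrite (le_lt_trans _ Hs)// nrm_sub_gproj_le// L2B.
Qed.

End gram_projection.

Lemma L2orthogonalP d (T : measurableType d) (R : realType)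
    (P : probability T R) (X Y : T -> R) :
  X \in Lfun P 2%:E -> Y \in Lfun P 2%:E ->
  L2orthogonal P X Y <-> ip P X Y = 0.
Proof.
move=> XL YL; rewrite /L2orthogonal expectation.unlock.
by rewrite [integral _ _ _](ip_EFin XL YL); split=> [[]|->].
Qed.

(** * The orthogonal decomposition at each time *)

Section decomposition.
Context d (T : measurableType d) (R : realType) (P : probability T R).
Variable B : R -> T -> R.
Hypothesis hB : brownian_motion P B.
Context (n : nat) (lam : 'I_n -> R).
Hypotheses (lam_inj : injective lam) (lam_gt : forall j, - (1 / 2) < lam j).
Variable Z : R -> T -> R.
Hypothesis hZ : volterra_transform P B (k_ker lam) Z.
Local Notation leb := (@lebesgue_measure R).
Local Notation L2 := (Lfun P 2%:E).
Let hC := brownian_motion_cov hB.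
Let hCZ := transform_cov hB lam_inj lam_gt hZ.
Let I t j := wiener_int P B t (pw lam j).

Section positive_time.
Variable t : R.
Hypothesis t0 : 0 < t.

Lemma pw_wiener_int j : is_wiener_int P B t (pw lam j) (I t j).
Proof.
have [J [_ HJ]] := pw_process hB lam_gt.
exact: wiener_intP (HJ j _ t0).
Qed.

Let IL j : I t j \in L2. Proof. by have [] := pw_wiener_int j. Qed.

(** Since E[Y_s I_j] = s^lam_j for s <= t, the integrated process up to r and [B r] have the same
    inner product with I_j. *)
Lemma ip_pw_transform j r : 0 <= r -> r <= t -> ip P (Z r) (I t j) = 0.
Proof.
move=> r0 rt; have [Y [hM HY ZE]] := transform_data hB lam_inj lam_gt hZ.
rewrite (ip_transform hB lam_inj lam_gt hZ hM ZE r0 (IL j)).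
rewrite (ipBl (hC.1 _ r0) (L2_xproc hM r0) (IL j)).
have H s : 0 < s -> s <= r -> ip P (Y s) (I t j) = s `^ lam j.
  move=> s0 sr; rewrite ipC (wiener_isometry hC (pw_wiener_int j) (HY _ s0)).
  by rewrite ip_pw_k// (le_trans sr rt).
have [_ ->] := ip_xproc hM r0 (IL j) H.
rewrite ipC (ip_wiener_int_B hC (ltW t0) r0 (pw_wiener_int j)) min_r//.
exact: subrr.
Qed.

Let GiP i k : \sum_j ginv lam t i j * ip P (I t j) (I t k) = (i == k)%:R.
Proof.
rewrite -(ginvP lam_inj lam_gt i k t0); apply: eq_bigr => j _; congr (_ * _).
by rewrite (wiener_isometry hC (pw_wiener_int j) (pw_wiener_int k)) (ip_pw lam_gt j k (ltW t0) (lexx t)).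
Qed.

Let pr := gproj P (I t) (ginv lam t).

Let ZL s : 0 <= s -> s <= t -> Z s \in L2. Proof. by move=> s0 _; exact: hCZ.1. Qed.
Let BL s : 0 <= s -> s <= t -> B s \in L2. Proof. by move=> s0 _; exact: hC.1. Qed.

Let ip_B_I u j : 0 <= u -> u <= t -> ip P (B u) (I t j) = u `^ (lam j + 1) / (lam j + 1).
Proof.
move=> u0 ut; rewrite ipC (ip_wiener_int_B hC (ltW t0) u0 (pw_wiener_int j)) min_r//.
by rewrite Rintegral_powR//; have := lam_gt j; lra.
Qed.

(** The projection is orthogonal to every [Z r], so the remainder correlates with [Z r] as [B u]
    does; [innov] is the density of this correlation. The norms agree by [ip_innov], and the
    criterion relative to [Z] applies. *)
Let BZ u : 0 <= u -> u <= t -> clspan P Z t (B u - pr (B u)).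
Proof.
rewrite le_eqVlt => /predU1P[<-|u0] ut.
  have W0 : B 0 - pr (B 0) \in L2 by rewrite L2B ?hC.1 ?L2_gproj.
  apply: (clspan_ae ZL (clspan0 P Z t) W0); apply: ip_self0 => //.
  apply/eqP; rewrite -sqr_nrm sqrf_eq0; apply/eqP/le_anti; rewrite nrm_ge0 andbT.
  rewrite (le_trans (nrm_sub_gproj_le IL GiP (hC.1 _ (lexx 0))))//.
  by rewrite /nrm hC.2// minxx sqrtr0.
have u0' := ltW u0; have BuL := hC.1 _ u0'; have pL := L2_gproj (ginv lam t) IL (B u).
have WL := L2B BuL pL.
apply: (clspan_wiener_int hCZ (ltW t0) (f := innov lam u t)).
apply: (is_wiener_int_char hCZ (ltW t0)) => //.
- by rewrite res_innov//; exact: L2_innov.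
- move=> r r0 rt; have ZrL := hCZ.1 _ r0.
  rewrite (ipBl BuL pL ZrL) (ip_gprojl _ IL _ ZrL) big1 ?subr0; last first.
    by move=> j _; rewrite (ipC P (I t j)) ip_pw_transform// mulr0.
  have [Y [hM HY ZE]] := transform_data hB lam_inj lam_gt hZ.
  rewrite ipC (ip_transform hB lam_inj lam_gt hZ hM ZE r0 BuL) (ip_zb hM r0 u0').
  have [ki _] := ip_xb hM r0 u0'.
  have UL := L2_unit_step u0'.
  have ui : leb.-integrable `[0, r] (EFin \o unit_step u).
    have uiT : leb.-integrable setT (EFin \o unit_step u).
      apply: eq_integrable (ip_integrable UL UL) => // s _ /=.
      by rewrite unit_stepE; case: (_ && _); rewrite ?mulr1 ?mulr0.
    by apply: (integrableS _ _ _ uiT) => //; exact: measurable_itv.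
  rewrite minC -ip_unit_step// ip_leb_unit_step//.
  rewrite -RintegralB//; apply: (eq_Rintegral0 _ _).2; first exact: integrable_itvB.
  by move=> s s0 sr; rewrite innov_kb// (le_trans sr).
- rewrite res_innov// ip_innov// nrm_sub_gproj// hC.2// minxx lerD2l lerN2.
  rewrite ip_gprojl// le_eqVlt; apply/orP; left; apply/eqP.
  apply: eq_bigr => j _; rewrite (ipC P (I t j)) ip_B_I//; congr (_ * _).
  by apply: eq_bigr => i _; rewrite ip_B_I.
Qed.

Lemma clspan_transform_sub : clspan P Z t `<=` clspan P B t.
Proof.
move=> X [XL HX]; apply: (clspan_closed BL) => // e e0.
have [m [c [s [st Hs]]]] := HX _ e0; exists (\sum_i c i *: Z (s i)) => //.
apply: clspan_sum => // i; apply: clspanZ => //.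
have /andP[s0 /clspan_le] := st i; apply.
exact: (clspan_transform hB lam_inj lam_gt hZ s0).
Qed.

Let IB j : clspan P B t (I t j).
Proof. by apply: (clspan_wiener_int hC (ltW t0)); exact: pw_wiener_int. Qed.

Lemma L2span_sub : L2span P (I t) `<=` clspan P B t.
Proof.
move=> Y [YL [c Yc]].
apply: (clspan_ae BL (X := \sum_j c j *: I t j)) => //.
  by apply: clspan_sum => // j; exact: clspanZ.
by apply: filterS Yc => w ->; rewrite fct_sumE.
Qed.

Lemma ip_clspan_L2span X Y : clspan P Z t X -> L2span P (I t) Y -> ip P X Y = 0.
Proof.
move=> HX [YL [c Yc]]; have XL := HX.1.
have SL : \sum_j c j *: I t j \in L2 by apply: L2_sum => j; exact: L2Z.
have Yc' : {ae P, forall w, Y w = (\sum_j c j *: I t j) w}.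
  by apply: filterS Yc => w ->; rewrite fct_sumE.
rewrite ipC (ip_ae SL YL XL Yc') ip_suml//; last by move=> j; exact: L2Z.
rewrite big1// => j _; rewrite ipZl// ipC (clspan_ip0 ZL HX (IL j)) ?mulr0//.
by move=> s s0 st; exact: ip_pw_transform.
Qed.

Lemma L2span_gproj X : L2span P (I t) (pr X).
Proof.
split; first exact: L2_gproj.
exists (fun j => \sum_i ginv lam t i j * ip P X (I t i)); apply: nearW => w.
by rewrite /pr /gproj fct_sumE.
Qed.

Lemma transform_orthogonal_sum :
  orthogonal_sum P (Hspace P B t) (Hspace P Z t) (L2span P (I t)).
Proof.
rewrite !HspaceE//; split=> [X Y HX HY|].
  by apply/(L2orthogonalP HX.1 HY.1); exact: ip_clspan_L2span.
apply/seteqP; split=> [V HV|V [X [Y [HX HY ->]]]]; last first.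
  by apply: (clspanD BL (X := X) (Y := Y)); [exact: clspan_transform_sub|exact: L2span_sub].
exists (V - pr V), (pr V); split.
- exact: (clspan_sub_gproj IL GiP BL ZL BZ).
- exact: L2span_gproj.
- by apply/funext => w; rewrite -[RHS]/(V w - pr V w + pr V w) subrK.
Qed.

(** If V is orthogonal to H_t(Z), the remainder V - pr V, which belongs to H_t(Z), is orthogonal to
    V and to pr V, hence to itself. *)
Lemma transform_orthogonal_complement :
  orthogonal_complement P (Hspace P Z t) (Hspace P B t) = L2span P (I t).
Proof.
rewrite !HspaceE//; apply/seteqP; split=> [V [HV VZ]|Y HY]; last first.
  split=> [|X HX]; first exact: L2span_sub.
  by apply/(L2orthogonalP HX.1 HY.1); exact: ip_clspan_L2span.
have WZ := clspan_sub_gproj IL GiP BL ZL BZ HV.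
have VL := HV.1; have WL := WZ.1; have pL := L2_gproj (ginv lam t) IL V.
have W0 : ip P (V - pr V) (V - pr V) = 0.
  rewrite (ipBr VL pL WL) (ip_clspan_L2span WZ (L2span_gproj V)) subr0.
  exact/(L2orthogonalP WL VL)/VZ.
have [_ [c pc]] := L2span_gproj V.
split => //; exists c; apply: filterS2 pc (ip_self0 WL W0) => w <- /eqP.
by rewrite -[X in X == _]/(V w - pr V w) subr_eq0 => /eqP.
Qed.

End positive_time.

Let ae0 t X : t = 0 -> clspan P B t X -> {ae P, forall w, X w = 0}.
Proof.
move=> -> HX; have XL := HX.1; apply: (ip_self0 XL).
have BL s : 0 <= s -> s <= 0 -> B s \in L2 by move=> s0 _; exact: hC.1.
apply: (clspan_ip0 BL HX XL) => s s0 s0'.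
have B0 : {ae P, forall w, B s w = (0 : T -> R) w}.
  by apply: (ip_self0 (hC.1 _ s0)); rewrite hC.2// minxx; apply/le_anti/andP.
by rewrite (ip_ae (L2_0 P) (hC.1 _ s0) XL B0) ip0l.
Qed.

(** At time 0 the Gram matrix is not invertible, but both sides consist of the square integrable
    variables that vanish almost surely. *)
Lemma transform_orthogonal_complement0 :
  orthogonal_complement P (Hspace P Z 0) (Hspace P B 0) = L2span P (I 0).
Proof.
have BL s : 0 <= s -> s <= 0 -> B s \in L2 by move=> s0 _; exact: hC.1.
have ZL s : 0 <= s -> s <= 0 -> Z s \in L2 by move=> s0 _; exact: hCZ.1.
have I0 j : {ae P, forall w, I 0 j w = 0}.
  have H0 : is_wiener_int P B 0 (pw lam j) 0.
    apply: (is_wiener_int_char hC) => //; [exact: L2_pw|exact: L2_0| |by rewrite ip0l ip_ge0].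
    move=> u u0 u0'; have -> : u = 0 by apply/le_anti/andP.
    by rewrite ip0l set_itv1 Rintegral_set1.
  by apply: filterS (wiener_int_ae hC H0) => w E; rewrite /I -E.
rewrite !HspaceE//; apply/seteqP; split=> [V [HV _]|Y [YL [c Yc]]].
  split; first exact: HV.1.
  exists (fun=> 0); apply: filterS (ae0 erefl HV) => w ->.
  by rewrite big1// => j _; rewrite mul0r.
have Y0 : {ae P, forall w, Y w = (0 : T -> R) w}.
  have Iall : {ae P, forall w, forall j, I 0 j w = 0} by exact: filter_forall.
  by apply: filterS2 Yc Iall => w -> Iw; rewrite big1// => j _; rewrite Iw mulr0.
split; first by apply: (clspan_ae BL (clspan0 P B 0) YL Y0).
move=> X [XL _]; apply/(L2orthogonalP XL YL).
by rewrite ipC (ip_ae (L2_0 P) YL XL Y0) ip0l.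
Qed.

End decomposition.

(** Taking inner products over [0,1] with each power turns a relation into a linear system with the
    invertible matrix [cm]. *)
Lemma linearly_independent_pw (R : realType) (n : nat) (lam : 'I_n -> R) :
  injective lam -> (forall j, - (1 / 2) < lam j) -> linearly_independent (pw lam).
Proof.
move=> lam_inj lam_gt c c0.
have L2g j : res 1 (pw lam j) \in Lfun (@lebesgue_measure R) 2%:E by exact: L2_pw.
have FL : \sum_j c j *: res 1 (pw lam j) \in Lfun (@lebesgue_measure R) 2%:E.
  by apply: L2_sum => j; exact: L2Z.
have F0 : {ae @lebesgue_measure R, forall x,
    (\sum_j c j *: res 1 (pw lam j)) x = (0 : R -> R) x}.
  have [N [mN N0 cN]] := c0; exists N; split => // x; rewrite /= fct_sumE => xF.
  apply: cN => /= cx; apply: xF.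
  have [x01|x01] := boolP (0 <= x <= 1).
    rewrite -[RHS](cx (andP x01).1); apply: eq_bigr => j _.
    by rewrite -[LHS]/(c j * res 1 (pw lam j) x) resE x01.
  rewrite big1// => j _.
  by rewrite -[LHS]/(c j * res 1 (pw lam j) x) resE (negbTE x01) mulr0.
have H k : \sum_j c j * cm lam j k = 0.
  transitivity (ip (@lebesgue_measure R) (\sum_j c j *: res 1 (pw lam j)) (res 1 (pw lam k))).
    rewrite ip_suml//; last by move=> j; exact: L2Z.
    by apply: eq_bigr => j _; rewrite ipZl// ip_pw// powR1 mul1r.
  by rewrite (ip_ae (L2_0 _) FL (L2g k) F0) ip0l.
move=> j; transitivity (\sum_i c i * (i == j)%:R).
  rewrite (bigD1 j)//= eqxx mulr1 big1 ?addr0// => i /negbTE ->.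
  by rewrite mulr0.
under eq_bigr => i _ do rewrite -(cm_inv lam_inj lam_gt) mulr_sumr.
rewrite exchange_big big1// => k _ /=.
transitivity ((\sum_i c i * cm lam i k) * (a_coef lam k * cm lam k j * a_coef lam j)).
  by rewrite mulr_suml; apply: eq_bigr => i _; ring.
by rewrite H mul0r.
Qed.

Theorem theorem2p1 (d : measure_display) (T : measurableType d) (R : realType)
    (P : probability T R) (Pcomplete : measure_is_complete P)
    (B : R -> T -> R) (hB : brownian_motion P B)
    (n : nat) (lam : 'I_n -> R) (lam_inj : injective lam)
    (lam_gt : forall j, - (1 / 2) < lam j) :
  goursat_volterra_kernel P B n (k_ker lam) /\
  Mclass (rho_fun lam) /\
  forall Z : R -> T -> R, volterra_transform P B (k_ker lam) Z ->
    (forall t, 0 <= t ->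
      orthogonal_complement P (Hspace P Z t) (Hspace P B t)
      = L2span P (fun j => wiener_int P B t (fun s => s `^ lam j))) /\
    (forall t, 0 < t ->
      {ae P, forall w,
        Z t w = wiener_int P B t (fun s => rho_fun lam (t / s)) w}).
Proof.
split; [split|split].
- exact: volterra_kernel_k_ker.
- exact: volterra_transform_exists.
- move=> Z hZ; split; first exact: (transform_brownian hB lam_inj lam_gt hZ).
  exists (pw lam); split.
  + by move=> j t t0; apply: L2_pw => //; exact: ltW.
  + exact: linearly_independent_pw.
  + by move=> t t0; exact: transform_orthogonal_sum.
- exact: Mclass_rho.
move=> Z hZ; split=> t.
  rewrite le_eqVlt => /predU1P[<-|t0].
    exact: (transform_orthogonal_complement0 hB lam_inj lam_gt hZ).
  exact: (transform_orthogonal_complement hB lam_inj lam_gt hZ).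
move=> t0; have hC := brownian_motion_cov hB.
exact: (wiener_int_ae hC (transform_wiener_int hB lam_inj lam_gt hZ t0)).
Qed.
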